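(* For $\mathcal{ALCO}$ weighted knowledge bases, $\mathsf{C}^{p}_{b}$ (bounded-cost possible BCQ entailment) is in NP in data complexity and $\mathsf{C}^{c}_{b}$ (bounded-cost certain BCQ entailment) is in coNP in data complexity, even if the weights are encoded in binary.
   Context: Fix pairwise disjoint countably infinite sets $\mathsf{N_C}$, $\mathsf{N_R}$, $\mathsf{N_I}$ of concept, role and individual names. $\mathcal{ALCO}$ concepts: $C ::= A \mid \{a\} \mid \top \mid \bot \mid C\sqcap C \mid C\sqcup C \mid \neg C \mid \exists R.C \mid \forall R.C$. A TBox is a finite set of concept inclusions $C\sqsubseteq D$; an ABox is a finite set of assertions $A(a)$, $R(a,b)$. Interpretations $\mathcal I=(\Delta^{\mathcal I},\cdot^{\mathcal I})$ have the usual semantics under a weak standard names assumption: individual names occurring in the input are interpreted as themselves, $a^{\mathcal I}=a\in\Delta^{\mathcal I}$, while $\Delta^{\mathcal I}$ need not contain all of $\mathsf{N_I}$. A weighted knowledge base (WKB) is $\mathcal K_\omega=(\langle\mathcal T,\mathcal A\rangle,\omega)$ with $\omega:\mathcal T\cup\mathcal A\to\mathbb N_{>0}\cup\{\infty\}$. For $\tau=B\sqsubseteq C$ let $\mathrm{vio}_\tau(\mathcal I)=(B\sqcap\neg C)^{\mathcal I}$ and $\mathrm{vio}_{\mathcal A}(\mathcal I)=\{\alpha\in\mathcal A\mid\mathcal I\not\models\alpha\}$. $\mathrm{cost}_{\mathcal K_\omega}(\mathcal I)=\sum_{\tau\in\mathcal T}\omega(\tau)|\mathrm{vio}_\tau(\mathcal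 I)|+\sum_{\alpha\in\mathrm{vio}_{\mathcal A}(\mathcal I)}\omega(\alpha)$ (summands with empty violation set are $0$; cost $\infty$ if an infinite-weight element is violated or some violation set is infinite). A BCQ is $q=\exists\vec y\,\psi$ with $\psi$ a conjunction of atoms $A(t)$, $R(t,t')$ (terms: variables or individual names); $\mathcal I\models q$ iff some map from terms to $\Delta^{\mathcal I}$, identity on individuals, makes all atoms true. $\mathcal K_\omega\models^c_k q$ iff every $\mathcal I$ with cost $\le k$ satisfies $q$; $\mathcal K_\omega\models^p_k q$ iff some such $\mathcal I$ satisfies $q$. $\mathsf C^c_b$ (resp. $\mathsf C^p_b$): given $\mathcal K_\omega$, BCQ $q$, integer $k$, decide $\mathcal K_\omega\models^c_k q$ (resp. $\models^p_k$). Data complexity measures complexity only in the size of the weighted ABox $\{(\alpha,\omega(\alpha))\mid\alpha\in\mathcal A\}$, with the TBox, its weights, the query and $k$ fixed. *)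

(* Defs.v *)
From HB Require Import structures.
From mathcomp Require Import all_boot all_order all_algebra all_classical.

Set Implicit Arguments.
Unset Strict Implicit.
Unset Printing Implicit Defensive.

Local Open Scope classical_set_scope.

Inductive enat : Type := Fin of nat | Infty.

Lemma enat_comparable : comparable enat.
Proof. by move=> x y; rewrite /decidable; decide equality; exact: eq_comparable. Qed.
HB.instance Definition _ := hasDecEq.Build enat (compareP enat_comparable).

Definition eadd (x y : enat) : enat :=
  match x, y with
  | Fin m, Fin n => Fin (m + n)
  | _, _ => Infty
  end.

(* 0 * Infty = Infty * 0 = 0: an unviolated inclusion costs nothing. *)
Definition emul (x y : enat) : enat :=
  match x, y with
  | Fin m, Fin n => Fin (m * n)
  | Fin 0, Infty | Infty, Fin 0 => Fin 0
  | _, _ => Infty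
  end.

Definition epos (x : enat) : bool := x != Fin 0.

Definition ele_int (x : enat) (k : int) : Prop :=
  match x with
  | Fin n => (n%:Z <= k)%R
  | Infty => False
  end.

Definition ecard (T : Type) (A : set T) : enat :=
  match pselect (finite_set A) with
  | left fA => Fin (projT1 (cid fA))
  | right _ => Infty
  end.

(* Names of the three sorts are never confused, as the syntax keeps their
   positions apart; this is how disjointness of the sorts is rendered. *)
Definition NC : Type := nat.
Definition NR : Type := nat.
Definition NI : Type := nat.

Inductive concept : Type :=
  | CAtom of NC
  | CNom of NI
  | CTop
  | CBot
  | CAnd of concept & concept
  | COr of concept & concept
  | CNot of concept
  | CEx of NR & concept
  | CAll of NR & concept.

Inductive inclusion : Type := Sub of concept & concept.

Inductive assertion : Type :=
  | AC of NC & NI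
  | AR of NR & NI & NI.

Lemma concept_comparable : comparable concept.
Proof. by move=> x y; rewrite /decidable; decide equality; exact: eq_comparable. Qed.
HB.instance Definition _ := hasDecEq.Build concept (compareP concept_comparable).

Lemma inclusion_comparable : comparable inclusion.
Proof. by move=> x y; rewrite /decidable; decide equality; exact: eq_comparable. Qed.
HB.instance Definition _ := hasDecEq.Build inclusion (compareP inclusion_comparable).

Lemma assertion_comparable : comparable assertion.
Proof. by move=> x y; rewrite /decidable; decide equality; exact: eq_comparable. Qed.
HB.instance Definition _ := hasDecEq.Build assertion (compareP assertion_comparable).

(* The graph of a weight function on a finite set, listed without repetition. *)
Definition weighting (T : eqType) (s : seq (T * enat)) : bool :=
  uniq [seq p.1 | p <- s] && all (fun p => epos p.2) s.

Definition wtbox : Type := seq (inclusion * enat).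
Definition wabox : Type := seq (assertion * enat).

Record wkb : Type := WKB {
  tbox : wtbox;
  abox : wabox;
  tbox_weighting : weighting tbox;
  abox_weighting : weighting abox }.

Inductive term : Type := TVar of nat | TInd of NI.

Inductive atom : Type :=
  | QC of NC & term
  | QR of NR & term & term.

Lemma term_comparable : comparable term.
Proof. by move=> x y; rewrite /decidable; decide equality; exact: eq_comparable. Qed.
HB.instance Definition _ := hasDecEq.Build term (compareP term_comparable).

Lemma atom_comparable : comparable atom.
Proof. by move=> x y; rewrite /decidable; decide equality; exact: eq_comparable. Qed.
HB.instance Definition _ := hasDecEq.Build atom (compareP atom_comparable).

(* All variables of a Boolean CQ are existentially quantified, so the prefix is
   left implicit. *)
Definition bcq : Type := seq atom.

Fixpoint concept_inds (C : concept) : seq NI :=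
  match C with
  | CNom a => [:: a]
  | CAtom _ | CTop | CBot => [::]
  | CAnd C D | COr C D => concept_inds C ++ concept_inds D
  | CNot C | CEx _ C | CAll _ C => concept_inds C
  end.

Definition inclusion_inds (t : inclusion) : seq NI :=
  let: Sub B C := t in concept_inds B ++ concept_inds C.

Definition assertion_inds (f : assertion) : seq NI :=
  match f with
  | AC _ a => [:: a]
  | AR _ a b => [:: a; b]
  end.

Definition atom_terms (u : atom) : seq term :=
  match u with
  | QC _ t => [:: t]
  | QR _ t t' => [:: t; t']
  end.

Definition bcq_terms (q : bcq) : seq term := flatten [seq atom_terms u | u <- q].

Definition term_inds (t : term) : seq NI :=
  if t is TInd a then [:: a] else [::].

Definition input_inds (K : wkb) (q : bcq) : seq NI :=
  flatten [seq inclusion_inds p.1 | p <- tbox K]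
  ++ flatten [seq assertion_inds p.1 | p <- abox K]
  ++ flatten [seq term_inds t | t <- bcq_terms q].

(* A domain is a nonempty set of individual names ([inl]) and of arbitrary
   further elements ([inr]); the name [a] is interpreted as [inl a]. *)
Record interp : Type := Interp {
  other : Type;
  dom : set (NI + other)%type;
  dom_nonempty : dom !=set0;
  Cint : NC -> set (NI + other)%type;
  Cint_sub : forall A, Cint A `<=` dom;
  Rint : NR -> set ((NI + other) * (NI + other))%type;
  Rint_sub : forall r, Rint r `<=` dom `*` dom }.

Arguments dom : clear implicits.
Arguments Cint : clear implicits.
Arguments Rint : clear implicits.

Fixpoint ext (I : interp) (C : concept) : set (NI + other I)%type :=
  match C with
  | CAtom A => Cint I A
  | CNom a => dom I `&` [set inl a]
  | CTop => dom I
  | CBot => set0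
  | CAnd C D => @ext I C `&` @ext I D
  | COr C D => @ext I C `|` @ext I D
  | CNot C => dom I `\` @ext I C
  | CEx r C => [set x | dom I x /\ exists y, Rint I r (x, y) /\ @ext I C y]
  | CAll r C => [set x | dom I x /\ forall y, Rint I r (x, y) -> @ext I C y]
  end.
Arguments ext : clear implicits.

Definition sat_assertion (I : interp) (f : assertion) : Prop :=
  match f with
  | AC A a => Cint I A (inl a)
  | AR r a b => Rint I r (inl a, inl b)
  end.

(* The weak standard names assumption: the names of the input, but not
   necessarily all of [NI], belong to the domain. *)
Definition interprets (I : interp) (K : wkb) (q : bcq) : Prop :=
  forall a, a \in input_inds K q -> dom I (inl a).

Definition vio (I : interp) (t : inclusion) : set (NI + other I)%type :=
  let: Sub B C := t in ext I (CAnd B (CNot C)).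
Arguments vio : clear implicits.

Definition cost (K : wkb) (I : interp) : enat :=
  eadd (\big[eadd/Fin 0]_(p <- tbox K) emul p.2 (ecard (vio I p.1)))
       (\big[eadd/Fin 0]_(p <- abox K | `[< ~ sat_assertion I p.1 >]) p.2).

Definition sat_atom (I : interp) (h : term -> (NI + other I)%type) (u : atom) : Prop :=
  match u with
  | QC A t => Cint I A (h t)
  | QR r t t' => Rint I r (h t, h t')
  end.

Definition sat_bcq (I : interp) (q : bcq) : Prop :=
  exists h : term -> (NI + other I)%type,
    [/\ forall a, h (TInd a) = inl a,
        forall t, t \in bcq_terms q -> dom I (h t)
      & forall u, u \in q -> sat_atom h u].

Definition certain (K : wkb) (k : int) (q : bcq) : Prop :=
  forall I : interp, interprets I K q -> ele_int (cost K I) k -> sat_bcq I q.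

Definition possible (K : wkb) (k : int) (q : bcq) : Prop :=
  exists I : interp, [/\ interprets I K q, ele_int (cost K I) k & sat_bcq I q].

Inductive move : Type := MLeft | MStay | MRight.

(* A two-way infinite tape: the cells left of the head (nearest first), the
   scanned cell, the cells right of the head (nearest first).  [None] is the
   blank, and cells outside the lists are blank. *)
Record tape (G : Type) : Type := Tape {
  tleft : seq (option G);
  thead : option G;
  tright : seq (option G) }.

Definition tape_of_word (G : Type) (w : seq G) : tape G :=
  Tape [::] (ohead w) [seq Some a | a <- behead w].

Definition tape_write (G : Type) (t : tape G) (c : option G) : tape G :=
  Tape (tleft t) c (tright t).

Definition tape_move (G : Type) (t : tape G) (m : move) : tape G :=
  match m with
  | MLeft => Tape (behead (tleft t)) (head None (tleft t)) (thead t :: tright t)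
  | MStay => t
  | MRight => Tape (thead t :: tleft t) (head None (tright t)) (behead (tright t))
  end.

(* Tape [ord0] is the input tape.  [tm_verdict s] is [Some true] if [s] is an
   accepting state, [Some false] if it is rejecting, [None] if it is not halting. *)
Record machine (S : finType) : Type := Machine {
  tm_tapes : nat;
  tm_state : finType;
  tm_alphabet : finType;
  tm_input : S -> tm_alphabet;
  tm_start : tm_state;
  tm_verdict : tm_state -> option bool;
  tm_delta : tm_state -> {ffun 'I_tm_tapes.+1 -> option tm_alphabet} ->
    tm_state * ('I_tm_tapes.+1 -> option tm_alphabet * move) }.

Record config (S : finType) (M : machine S) : Type := Config {
  cf_state : tm_state M;
  cf_tapes : 'I_(tm_tapes M).+1 -> tape (tm_alphabet M) }.

Definition tm_init (S : finType) (M : machine S) (w : seq S) : config M :=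
  Config (tm_start M)
    (fun i => tape_of_word (if i == ord0 then map (@tm_input S M) w else [::])).

Definition tm_step (S : finType) (M : machine S) (c : config M) : config M :=
  if tm_verdict (cf_state c) is Some _ then c else
  let d := tm_delta (cf_state c) [ffun i => thead (cf_tapes c i)] in
  Config d.1
    (fun i => tape_move (tape_write (cf_tapes c i) (d.2 i).1) (d.2 i).2).

Definition verdict_after (S : finType) (M : machine S) (n : nat) (w : seq S) :
    option bool :=
  tm_verdict (cf_state (iter n (@tm_step S M) (tm_init M w))).

Definition in_P (S : finType) (L : set (seq S)) : Prop :=
  exists (M : machine S) (p : {poly nat}), forall w : seq S,
    exists b : bool, verdict_after M p.[size w]%R w = Some b /\ (b <-> L w).

(* The word [w # c], over the disjoint union of the alphabet of [w], the bits
   of [c] and the separator [#]. *)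
Definition with_certificate (S : finType) (w : seq S) (c : seq bool) :
    seq (option (S + bool)%type) :=
  [seq Some (inl a) | a <- w] ++ None :: [seq Some (inr b) | b <- c].

Definition in_NP (S : finType) (L : set (seq S)) : Prop :=
  exists (V : set (seq (option (S + bool)%type))) (p : {poly nat}),
    in_P V /\
    forall w : seq S,
      L w <-> exists c : seq bool, size c <= p.[size w]%R /\ V (with_certificate w c).

Definition in_coNP (S : finType) (L : set (seq S)) : Prop := in_NP (~` L).

Inductive letter : Type := LBit of bool | LConcept | LRole | LSep | LInfty.

Definition letter_code (x : letter) : bool + 'I_4 :=
  match x with
  | LBit b => inl b
  | LConcept => inr (inord 0)
  | LRole => inr (inord 1)
  | LSep => inr (inord 2)
  | LInfty => inr (inord 3)
  end.

Definition letter_decode (u : bool + 'I_4) : letter :=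
  match u with
  | inl b => LBit b
  | inr i => nth LSep [:: LConcept; LRole; LSep; LInfty] i
  end.

Lemma letter_codeK : cancel letter_code letter_decode.
Proof. by case=> [b||||] //=; rewrite inordK. Qed.
HB.instance Definition _ := Finite.copy letter (can_type letter_codeK).

Fixpoint pos_bits (n : BinNums.positive) : seq bool :=
  match n with
  | BinNums.xH => [:: true]
  | BinNums.xO m => false :: pos_bits m
  | BinNums.xI m => true :: pos_bits m
  end.

(* Binary notation, least significant bit first and without leading zeros. *)
Definition binary (n : nat) : seq letter :=
  if bin_of_nat n is BinNums.Npos m then map LBit (pos_bits m) else [::].

Definition enc_assertion (f : assertion) : seq letter :=
  match f with
  | AC A a => LConcept :: binary A ++ LSep :: binary a
  | AR r a b => LRole :: binary r ++ LSep :: binary a ++ LSep :: binary b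
  end.

Definition enc_weight (x : enat) : seq letter :=
  if x is Fin n then binary n else [:: LInfty].

Definition enc_wabox (s : wabox) : seq letter :=
  flatten [seq enc_assertion p.1 ++ LSep :: enc_weight p.2 | p <- s].

(* Data complexity: the weighted TBox, the query and the bound are parameters,
   only the weighted ABox is read from the input.  Words that do not encode a
   weighted ABox belong to neither language. *)

Definition possible_language (T : wtbox) (q : bcq) (k : int) : set (seq letter) :=
  [set w | exists K : wkb,
     [/\ tbox K = T, w = enc_wabox (abox K) & possible K k q]].

Definition certain_language (T : wtbox) (q : bcq) (k : int) : set (seq letter) :=
  [set w | exists K : wkb,
     [/\ tbox K = T, w = enc_wabox (abox K) & certain K k q]].

(* Main.v *)
From HB Require Import structures.
Require Import Defs.
From mathcomp Require Import all_boot all_order all_algebra all_classical.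
From mathcomp Require Import zify.

(* Both problems reduce to deciding, for a fixed finite amount of data (TBox, query,
   bound), whether the positions of the input word can be coloured so that a fixed
   first-order sentence holds; such a colouring is the certificate, and the sentence
   is evaluated in polynomial time by nested loops over the positions.

   Given an interpretation of cost at most [k], call special the individuals of the
   TBox and the query, the violators of the TBox (at most [k]) and, if the query is
   to hold, the elements of a match of it.  The colour of an element is the truth
   value of finitely many facts about the interpretation with its special elements
   and that element as a point: concepts of the TBox, roles between the point and
   special elements, and which pieces of the query can be matched.  The ABox coloured
   in this way suffices to rebuild an interpretation: take for every individual a
   disjoint copy of an interpretation realising its colour, share the special
   elements, and add the satisfied role assertions between the points.  All
   violators are special, so the cost of the TBox does not change, and a match of
   the query in the amalgam falls into pieces recorded in the colours and joined by
   ABox edges, hence yields a match in the original interpretation.  The cost of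
   the ABox is certified by pairwise disjoint sets of units attached to the violated
   assertions. *)

(** A model may be infinite, so it cannot be guessed; what is guessed is one of finitely many
    colours per individual. Whether a colour is realised by an interpretation is never computed: the
    answer depends on the TBox, the query and [k] alone, so the sentence contains it as a finite
    table obtained by classical reasoning. The special elements must be shared rather than copied,
    because nominals denote single elements and copied violators would be paid for once per copy. As
    all weights are positive, at most [k] violators occur, which bounds the number of slots. Binary
    weights can be exponentially large, but a violated assertion within the budget weighs at most
    [k]. Hence only the numerals 1 to [k] have to be recognised, and disjoint unit sets replace the
    addition of numerals. Absence of a match is first-order as well: a match meets at most as many
    copies as the query has terms, so boundedly many ABox entries are quantified over. Words that
    encode no weighted ABox belong to the complement of the certain language, so the encoding is
    itself described in the logic, by local patterns and a comparison of pairs of entries. *)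

Set Implicit Arguments.
Unset Strict Implicit.
Unset Printing Implicit Defensive.

(** * Turing machine fragments *)

Section Tapes.
Variable G : Type.
Implicit Types (t : tape G) (f : int -> option G).

Definition cell t (z : int) : option G :=
  match z with
  | Posz n => nth None (Defs.thead t :: tright t) n
  | Negz n => nth None (tleft t) n
  end.

(* A tape up to trailing blanks: its content and the position of its head. *)
Definition atape : Type := ((int -> option G) * int)%type.

Definition shift (m : move) : int :=
  match m with MLeft => -1 | MStay => 0 | MRight => 1 end%R.

Definition upd f (x : int) (c : option G) : int -> option G :=
  fun z => if z == x then c else f z.

Definition aact (a : atape) (d : option G * move) : atape :=
  (upd a.1 a.2 d.1, a.2 + shift d.2)%R.

(** The list tape is indexed from its head, the abstract one absolutely, so that a move only changes
    an integer. Cells outside the lists read as [None], which makes trailing blanks invisible. *)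
Definition tape_repr (a : atape) t : Prop := forall z, cell t z = a.1 (a.2 + z)%R.

Lemma tape_repr_head a t : tape_repr a t -> Defs.thead t = a.1 a.2.
Proof. by move=> /(_ 0%R); rewrite GRing.addr0. Qed.

Lemma tape_repr_act a t d :
  tape_repr a t -> tape_repr (aact a d) (tape_move (tape_write t d.1) d.2).
Proof.
case: d => c m rt z.
have E (n : int) : n != 0%R -> cell t n = upd a.1 a.2 c (a.2 + n)%R.
  by move=> n0; rewrite rt /upd ifN //; lia.
have E0 : c = upd a.1 a.2 c a.2 by rewrite /upd eqxx.
case: m => /=.
- case: z => [[|[|n]]|n] /=.
  + have -> : (a.2 + -1 + 0 = a.2 + Negz 0)%R by lia.
    by rewrite -E //= nth0.
  + by rewrite {1}E0; congr upd; lia.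
  + have -> : (a.2 + -1 + n.+2 = a.2 + n.+1)%R by lia.
    by rewrite -E.
  + have -> : (a.2 + -1 + Negz n = a.2 + Negz n.+1)%R by lia.
    by rewrite -E //= nth_behead.
- have -> : (a.2 + 0 + z = a.2 + z)%R by lia.
  case: z => [[|n]|n] /=.
  + by rewrite {1}E0; congr upd; lia.
  + by rewrite -E.
  + by rewrite -E.
- case: z => [n|[|n]] /=.
  + have -> : (a.2 + 1 + n = a.2 + n.+1)%R by lia.
    rewrite -E //=; case: n => [|n] /=; by rewrite ?nth0 ?nth_behead.
  + by rewrite {1}E0; congr upd; lia.
  + have -> : (a.2 + 1 + Negz n.+1 = a.2 + Negz n)%R by lia.
    by rewrite -E.
Qed.

Definition look (w : seq G) (z : int) : option G :=
  if z is Posz n then onth w n else None.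

Lemma tape_repr_word (w : seq G) : tape_repr (look w, 0%R) (tape_of_word w).
Proof.
move=> z; rewrite [_.1]/= [_.2]/= GRing.add0r; case: z => [n|n] /=; last by rewrite nth_nil.
by case: w => [|a w]; case: n => [|n] //=; rewrite ?nth_nil // onthE.
Qed.

Lemma upd_same f x : upd f x (f x) = f.
Proof. by apply/funext => z; rewrite /upd; case: eqP => [->|]. Qed.

End Tapes.

Section Fragments.
Variables (K : nat) (G : finType).

Definition reads : Type := {ffun 'I_K.+1 -> option G}.
Definition action : Type := 'I_K.+1 -> option G * move.
Definition tapes : Type := 'I_K.+1 -> atape G.

(* A machine without distinguished input; it halts with a Boolean outcome. *)
Record frag : Type := Frag {
  fst_type : finType;
  fini : fst_type;
  fout : fst_type -> option bool;
  fdel : fst_type -> reads -> fst_type * action }.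

Definition scan (c : tapes) : reads := [ffun i => (c i).1 (c i).2].

Definition tact (c : tapes) (d : action) : tapes := fun i => aact (c i) (d i).

Definition fstep (A : frag) (s : fst_type A * tapes) : fst_type A * tapes :=
  if fout s.1 is Some _ then s else
  let d := fdel s.1 (scan s.2) in (d.1, tact s.2 d.2).

(** Since [fstep] fixes halted states, [t] is only an upper bound on the halting time; time bounds
    can be rounded up freely. *)
Definition halts (A : frag) (a : fst_type A) (c c' : tapes) (b : bool) (t : nat) :=
  exists q, iter t (@fstep A) (a, c) = (q, c') /\ fout q = Some b.

Definition runs (A : frag) := halts (fini A).

Lemma iter_halted (A : frag) t (a : fst_type A) c b :
  fout a = Some b -> iter t (@fstep A) (a, c) = (a, c).
Proof. by move=> h; elim: t => //= t ->; rewrite /fstep h. Qed.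

Lemma halts_mono (A : frag) (a : fst_type A) c c' b t t' :
  t <= t' -> halts a c c' b t -> halts a c c' b t'.
Proof.
move=> tt' [q [Eq hq]]; exists q; split=> //.
by rewrite -(subnK tt') iterD Eq (iter_halted _ _ hq).
Qed.

(** Passing control between fragments takes a step, and every step writes; writing back what was
    scanned leaves the tapes unchanged. *)
Definition keep (r : reads) : action := fun i => (r i, MStay).

Lemma tact_keep c : tact c (keep (scan c)) = c.
Proof.
apply/funext => i; rewrite /tact /aact /keep ffunE /= upd_same GRing.addr0.
by case: (c i).
Qed.

Definition act (test : reads -> bool) (d : reads -> action) : frag :=
  @Frag (option bool) None id (fun _ r => (Some (test r), d r)).

Lemma runs_act test d c : runs (act test d) c (tact c (d (scan c))) (test (scan c)) 1.
Proof. by exists (Some (test (scan c))). Qed.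

Section Branch.
Variables A B C : frag.

Definition branch_del (s : fst_type A + (fst_type B + fst_type C)) (r : reads) :
    (fst_type A + (fst_type B + fst_type C)) * action :=
  match s with
  | inl a => match fout a with
             | Some true => (inr (inl (fini B)), keep r)
             | Some false => (inr (inr (fini C)), keep r)
             | None => let d := fdel a r in (inl d.1, d.2)
             end
  | inr (inl b) => let d := fdel b r in (inr (inl d.1), d.2)
  | inr (inr c) => let d := fdel c r in (inr (inr d.1), d.2)
  end.

Definition branch : frag :=
  @Frag (fst_type A + (fst_type B + fst_type C))%type (inl (fini A))
    (fun s => match s with
              | inl _ => None | inr (inl b) => fout b | inr (inr c) => fout c
              end) branch_del.

(** The time [t] may exceed the moment at which [A] halts, and from then on the composite no longer
    follows [A]; hence the possibly earlier time [t']. *)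
Lemma branch_fst t a c q c' b :
  iter t (@fstep A) (a, c) = (q, c') -> fout q = Some b ->
  exists2 t', t' <= t & iter t' (@fstep branch) (inl a, c) = (inl q, c').
Proof.
elim: t a c => [|t IH] a c; first by move=> [-> ->] _; exists 0.
rewrite iterSr; case E: (fout a) => [b'|] it hq.
  move: it; rewrite {2}/fstep /= E (iter_halted _ _ E) => -[-> ->].
  by exists 0.
move: it; rewrite {2}/fstep /= E => /IH/(_ hq) [t' le it].
by exists t'.+1 => //; rewrite iterSr {2}/fstep /= E.
Qed.

Lemma branch_left t (x : fst_type B) c :
  iter t (@fstep branch) (inr (inl x), c) =
  let s := iter t (@fstep B) (x, c) in (inr (inl s.1), s.2).
Proof.
elim: t => //= t ->; set s := iter _ _ _.
by rewrite /fstep /=; case: (fout s.1) => //; case: s.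
Qed.

Lemma branch_right t (x : fst_type C) c :
  iter t (@fstep branch) (inr (inr x), c) =
  let s := iter t (@fstep C) (x, c) in (inr (inr s.1), s.2).
Proof.
elim: t => //= t ->; set s := iter _ _ _.
by rewrite /fstep /=; case: (fout s.1) => //; case: s.
Qed.

Lemma runs_branch c c1 c2 (b1 b2 : bool) t1 t2 :
  runs A c c1 b1 t1 -> runs (if b1 then B else C) c1 c2 b2 t2 ->
  runs branch c c2 b2 (t1 + t2).+1.
Proof.
move=> [q [Eq hq]]; have [t' le it] := branch_fst Eq hq.
have st : fstep (inl q : fst_type branch, c1) =
    (if b1 then inr (inl (fini B)) else inr (inr (fini C)), c1).
  by rewrite /fstep /= hq; case: (b1); rewrite /= tact_keep.
have le' : (t2.+1 + t') <= (t1 + t2).+1 by rewrite addnC addnS ltnS leq_add2r.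
case: b1 hq st => hq st [r [Er hr]]; apply: (halts_mono le');
  [exists (inr (inl r)) | exists (inr (inr r))]; split=> //;
  by rewrite iterD it iterSr st ?branch_left ?branch_right Er.
Qed.

End Branch.

Section Loop.
Variable A : frag.

Definition loop_del (s : option (fst_type A)) (r : reads) :
    option (fst_type A) * action :=
  match s with
  | Some a => match fout a with
              | Some true => (Some (fini A), keep r)
              | Some false => (None, keep r)
              | None => let d := fdel a r in (Some d.1, d.2)
              end
  | None => (None, keep r)
  end.

(** The body doubles as the guard: outcome [true] asks for another round. Leaving the loop always
    yields [true], so that [branch] can sequence a loop with what follows. *)
Definition loop : frag :=
  @Frag (option (fst_type A)) (Some (fini A))
    (fun s => if s is Some _ then None else Some true) loop_del.

Lemma loop_fst t a c q c' b :
  iter t (@fstep A) (a, c) = (q, c') -> fout q = Some b ->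
  exists2 t', t' <= t & iter t' (@fstep loop) (Some a, c) = (Some q, c').
Proof.
elim: t a c => [|t IH] a c; first by move=> [-> ->] _; exists 0.
rewrite iterSr; case E: (fout a) => [b'|] it hq.
  move: it; rewrite {2}/fstep /= E (iter_halted _ _ E) => -[-> ->].
  by exists 0.
move: it; rewrite {2}/fstep /= E => /IH/(_ hq) [t' le it].
by exists t'.+1 => //; rewrite iterSr {2}/fstep /= E.
Qed.

Lemma runs_loop_stop c c' t : runs A c c' false t -> runs loop c c' true t.+1.
Proof.
move=> [q [Eq hq]]; have [t' le it] := loop_fst Eq hq.
apply: (@halts_mono _ _ _ _ _ t'.+1) => //; exists None; split=> //.
by rewrite iterS it /fstep /= hq tact_keep.
Qed.

Lemma runs_loop_next c c1 c2 t1 t2 :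
  runs A c c1 true t1 -> runs loop c1 c2 true t2 ->
  runs loop c c2 true (t1 + t2).+1.
Proof.
move=> [q [Eq hq]] [r [Er hr]]; have [t' le it] := loop_fst Eq hq.
apply: (@halts_mono _ _ _ _ _ (t2.+1 + t')).
  by rewrite addnC addnS ltnS leq_add2r.
exists r; split=> //; rewrite iterD it iterSr {2}/fstep /= hq tact_keep.
exact: Er.
Qed.

Lemma runs_loop (c : nat -> tapes) c' n t t' :
  (forall i, i < n -> runs A (c i) (c i.+1) true t) ->
  runs A (c n) c' false t' ->
  runs loop (c 0) c' true (n * t.+1 + t').+1.
Proof.
move=> step stop.
(* Here [i] counts the rounds still to come, so that the induction prepends one round at a time. *)
have H i : i <= n -> runs loop (c (n - i)) c' true (i * t.+1 + t').+1.
  elim: i => [_|i IH lt]; first by rewrite subn0; apply: runs_loop_stop.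
  have -> : (i.+1 * t.+1 + t').+1 = (t + (i * t.+1 + t').+1).+1 by lia.
  apply: (@runs_loop_next _ (c (n - i))); last exact/IH/ltnW.
  by rewrite -(subnSK lt); apply: step; rewrite ltn_subrL (leq_ltn_trans _ lt).
by have := H n (leqnn n); rewrite subnn.
Qed.

End Loop.

End Fragments.

(** * A first-order logic on words, and its evaluation by machines *)

Section Formulas.
Variable B : Type.
Implicit Types (s t u : seq B) (v : nat -> nat).

(* Greedy patterns for two heads moving right.  An item tests the two scanned
   letters ([None] past the end) and the flags tell which heads move on. *)
Inductive item : Type :=
  | One of bool & bool & (option B -> option B -> bool)
  | Star of bool & bool & (option B -> option B -> bool).

(** Matching a pattern from two positions is the only atomic formula; even equality of positions is
    expressed through it. *)
Inductive fo : Type :=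
  | Pat of seq item & nat & nat
  | Neg of fo
  | Conj of fo & fo
  | Ex of nat & fo.

(** A head asked to move must stand on a letter, and at least one head must be asked to move. Each
    repetition therefore consumes a letter, and the fuel [size s + size t] given to [star]
    suffices. *)
Definition goes (ml mr : bool) (p : option B -> option B -> bool) (a b : option B) :=
  [&& p a b, ml ==> isSome a, mr ==> isSome b & ml || mr].

Definition adv (m : bool) s := if m then behead s else s.

Fixpoint star ml mr p n s t : seq B * seq B :=
  if n is n'.+1 then
    if goes ml mr p (ohead s) (ohead t) then star ml mr p n' (adv ml s) (adv mr t)
    else (s, t)
  else (s, t).

Fixpoint pmatch (ps : seq item) s t : bool :=
  match ps with
  | [::] => true
  | One ml mr p :: ps' =>
      p (ohead s) (ohead t) && pmatch ps' (adv ml s) (adv mr t)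
  | Star ml mr p :: ps' =>
      let st := star ml mr p (size s + size t) s t in pmatch ps' st.1 st.2
  end.

Definition vset v (i x : nat) : nat -> nat := fun k => if k == i then x else v k.

(* Variables range over the positions of [u] and the end of [u]. *)
Fixpoint sem (f : fo) u v : bool :=
  match f with
  | Pat ps i j => pmatch ps (drop (v i) u) (drop (v j) u)
  | Neg g => ~~ sem g u v
  | Conj g h => sem g u v && sem h u v
  | Ex i g => has (fun x => sem g u (vset v i x)) (iota 0 (size u).+1)
  end.

Fixpoint bound (f : fo) : seq nat :=
  match f with
  | Pat _ _ _ => [::]
  | Neg g => bound g
  | Conj g h => bound g ++ bound h
  | Ex i g => i :: bound g
  end.

(** Variable [i] lives on tape [i]. Tape 0 holds the input and tapes 1 and 2 are counters, so
    variables start at 3; a variable must not be bound again below its own quantifier, because its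
    head is in use there. *)
Fixpoint wf (K : nat) (f : fo) : bool :=
  match f with
  | Pat _ i j => [&& i != j, 2 < i <= K & 2 < j <= K]
  | Neg g => wf K g
  | Conj g h => wf K g && wf K h
  | Ex i g => [&& 2 < i <= K, i \notin bound g & wf K g]
  end.

Lemma ohead_drop n u : ohead (drop n u) = onth u n.
Proof. by elim: n u => [|n IH] [|a u] //=; rewrite IH. Qed.

Lemma behead_drop n u : behead (drop n u) = drop n.+1 u.
Proof. by rewrite -drop1 drop_drop. Qed.

(** A move past the end leaves the remaining word empty, so the position can stay put and never
    exceeds [size u]. *)
Lemma adv_drop m n u :
  adv m (drop n u) = drop (n + (m && isSome (onth u n))) u.
Proof.
case: m; rewrite /= ?addn0 // behead_drop onthTE; case: ltnP => h; first by rewrite addn1.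
by rewrite addn0 !drop_oversize // ltnW.
Qed.

End Formulas.

(** * Compilation of formulas into machine fragments *)

Section Compilation.
Variables (K : nat) (R B : finType).
Let G : finType := (R + B)%type.
Variables (c0 : int -> option G) (p0 : int).
Implicit Types (u : seq B) (v : nat -> nat) (z : nat -> int).

Definition letter_at (r : reads K G) (i : nat) : option B :=
  if r (inord i) is Some (inr b) then Some b else None.

Definition read_only (test : reads K G -> bool) (m : reads K G -> nat -> move) :
    frag K G :=
  act test (fun r i => (r i, if i == ord0 then MStay else m r i)).

(* Tape 0 is kept aside; every other tape holds [u], tape [i] being scanned at [z i]. *)
Definition scene u z : tapes K G :=
  fun i => if i == ord0 then (c0, p0) else (look (map inr u), z i).

Lemma letter_scene u z i :
  0 < i <= K -> letter_at (scan (scene u z)) i = look u (z i).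
Proof.
move=> /andP[i0 iK]; rewrite /letter_at /scan ffunE /scene.
have Ei : val (inord i : 'I_K.+1) = i by rewrite /= inordK.
rewrite -val_eqE Ei eqn0Ngt i0 /= inordK // /look.
by case: (z i) => n //; rewrite onth_map; case: onth.
Qed.

Lemma runs_read_only test m u z :
  runs (read_only test m) (scene u z)
    (scene u (fun k => (z k + shift (m (scan (scene u z)) k))%R))
    (test (scan (scene u z))) 1.
Proof.
have := runs_act test (fun r i => (r i, if i == ord0 then MStay else m r i)) (scene u z).
congr runs; apply/funext => i; rewrite /tact /aact ffunE /= upd_same /scene.
by case: eqP => //= _; rewrite GRing.addr0.
Qed.

Definition const (b : bool) : frag K G := read_only (fun=> b) (fun _ _ => MStay).

Lemma runs_const b u z : runs (const b) (scene u z) (scene u z) b 1.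
Proof.
have := runs_read_only (fun=> b) (fun _ _ => MStay) u z.
by congr runs; congr scene; apply/funext => k; rewrite GRing.addr0.
Qed.

(** Head [k] measures the distance: it walks left until it reads no letter and then steps back onto
    cell 0, while the heads in [js] move left once per letter passed. The left move precedes the
    test, so starting on the blank behind the word is harmless. *)
Definition back (k : nat) (js : pred nat) : frag K G :=
  loop (branch
    (read_only (fun=> true) (fun _ i => if i == k then MLeft else MStay))
    (read_only (fun r => isSome (letter_at r k))
       (fun r i => if letter_at r k is Some _ then
                     if js i then MLeft else MStay
                   else if i == k then MRight else MStay))
    (const false)).

Lemma runs_back k js u z (d : nat) :
  0 < k <= K -> ~~ js k -> z k = d -> d <= size u ->
  runs (back k js) (scene u z)
    (scene u (fun i => if (i == k) || js i then (z i - d%:Z)%R else z i)) true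
    (4 * d + 4).
Proof.
move=> kK jk zk du.
set c := fun n : nat => scene u (fun i => if (i == k) || js i then (z i - n%:Z)%R else z i).
have -> : scene u z = c 0.
  by congr scene; apply/funext => i; rewrite GRing.subr0 if_same.
have -> : 4 * d + 4 = (d * 3.+1 + 3).+1 by lia.
pose mid n := scene u (fun i => if i == k then (z i - n%:Z - 1)%R
                               else if js i then (z i - n%:Z)%R else z i).
have first n : runs (read_only (fun=> true) (fun _ i => if i == k then MLeft else MStay))
    (c n) (mid n) true 1.
  have := runs_read_only (fun=> true) (fun _ i => if i == k then MLeft else MStay) u
    (fun i => if (i == k) || js i then (z i - n%:Z)%R else z i).
  congr runs; congr scene; apply/funext => i.
  by case: eqP => [->|_] //=; rewrite GRing.addr0.
apply: (runs_loop (c := c)) => [n nd|]; apply: (@runs_branch _ _ _ _ _ _ _ _ true _ 1 1) => //.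
- have := runs_read_only (fun r => isSome (letter_at r k))
       (fun r i => if letter_at r k is Some _ then
                     if js i then MLeft else MStay
                   else if i == k then MRight else MStay) u
      (fun i => if i == k then (z i - n%:Z - 1)%R else if js i then (z i - n%:Z)%R else z i).
  rewrite letter_scene // eqxx zk.
  have -> : (d%:Z - n%:Z - 1 = Posz (d - n.+1))%R by lia.
  rewrite /= ; case E: onth => [a|]; last first.
    by have := onthTE u (d - n.+1); rewrite E /=; lia.
  congr runs; congr scene; apply/funext => i.
  case: eqP => [->|_] /=; first by rewrite (negPf jk) /= ; lia.
  by case: (js i) => /=; lia.
- have := runs_read_only (fun r => isSome (letter_at r k))
       (fun r i => if letter_at r k is Some _ then
                     if js i then MLeft else MStay
                   else if i == k then MRight else MStay) u
      (fun i => if i == k then (z i - d%:Z - 1)%R else if js i then (z i - d%:Z)%R else z i).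
  rewrite letter_scene // eqxx zk.
  have -> : (d%:Z - d%:Z - 1 = Negz 0)%R by lia.
  congr runs; congr scene; apply/funext => i.
  by case: eqP => [->|_] /=; [lia | rewrite GRing.addr0].
Qed.

Section Pattern.
Variables i j : nat.

(** Heads 1 and 2 mirror heads [i] and [j]. Starting from cell 0, they record the displacements that
    [restore] has to undo after the match. *)
Definition walk (l r : bool) (k : nat) : move :=
  if (k == i) || (k == 1) then if l then MRight else MStay
  else if (k == j) || (k == 2) then if r then MRight else MStay
  else MStay.

Definition item_frag (ml mr : bool) (p : option B -> option B -> bool) : frag K G :=
  read_only (fun r => p (letter_at r i) (letter_at r j))
    (fun r => walk (ml && isSome (letter_at r i)) (mr && isSome (letter_at r j))).

Definition goes_frag (ml mr : bool) (p : option B -> option B -> bool) : frag K G :=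
  read_only (fun r => goes ml mr p (letter_at r i) (letter_at r j))
    (fun r => let b := goes ml mr p (letter_at r i) (letter_at r j) in
              walk (ml && b) (mr && b)).

Fixpoint pat_frag (ps : seq (item B)) : frag K G :=
  match ps with
  | [::] => const true
  | One ml mr p :: ps' => branch (item_frag ml mr p) (pat_frag ps') (const false)
  | Star ml mr p :: ps' => branch (loop (goes_frag ml mr p)) (pat_frag ps') (const false)
  end.

Hypotheses (ij : i != j) (iK : 2 < i <= K) (jK : 2 < j <= K).

Definition disp v (a b : nat) : nat -> int := fun k =>
  (v k + (if (k == i) || (k == 1) then a else if (k == j) || (k == 2) then b else 0)).

Lemma disp_walk v a b (l r : bool) :
  (fun k => (disp v a b k + shift (walk l r k))%R) = disp v (a + l) (b + r).
Proof.
apply/funext => k; rewrite /disp /walk.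
by case: ifP => _; [case: l|case: ifP => _; [case: r|]] => /=; lia.
Qed.

Lemma letter_i u v a b : letter_at (scan (scene u (disp v a b))) i = onth u (v i + a).
Proof. by rewrite letter_scene ?/disp ?eqxx //; case/andP: iK => /ltnW/ltnW->. Qed.

Lemma letter_j u v a b : letter_at (scan (scene u (disp v a b))) j = onth u (v j + b).
Proof.
rewrite letter_scene; last by case/andP: jK => /ltnW/ltnW->.
rewrite /disp (eq_sym j) (negPf ij) eqxx /=.
by case/andP: jK; case: (j) => [|[|]].
Qed.

(** The machine loop has no fuel, so it agrees with [star] only if the fuel covers what is left of
    both words; then [star] too stops because [goes] fails. *)
Lemma runs_star ml mr p u v n a b :
  exists a' b', [/\ a <= a', b <= b',
    v i + a <= size u -> v i + a' <= size u,
    v j + b <= size u -> v j + b' <= size u &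
    star ml mr p n (drop (v i + a) u) (drop (v j + b) u) =
      (drop (v i + a') u, drop (v j + b') u) /\
    ((size u - (v i + a)) + (size u - (v j + b)) <= n ->
    runs (loop (goes_frag ml mr p)) (scene u (disp v a b)) (scene u (disp v a' b')) true
      (2 * n + 2))].
Proof.
elim: n a b => [|n IH] a b.
  exists a, b; split=> //; split=> // full; apply: runs_loop_stop.
  have := runs_read_only (fun r => goes ml mr p (letter_at r i) (letter_at r j))
    (fun r => let b := goes ml mr p (letter_at r i) (letter_at r j) in
              walk (ml && b) (mr && b)) u (disp v a b).
  rewrite letter_i letter_j disp_walk !onth_default; try lia.
  by rewrite /goes /= !implybF; case: ml; case: mr; rewrite !(andbF, andbT) ?addn0.
rewrite /= !ohead_drop !adv_drop.
have := runs_read_only (fun r => goes ml mr p (letter_at r i) (letter_at r j))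
    (fun r => let b := goes ml mr p (letter_at r i) (letter_at r j) in
              walk (ml && b) (mr && b)) u (disp v a b).
rewrite letter_i letter_j disp_walk -/(goes_frag ml mr p).
case: ifP => g run; last first.
  exists a, b; split=> //; split=> // _.
  move: run; rewrite !andbF !addn0 => /runs_loop_stop.
  by apply: halts_mono; lia.
case/and4P: (g) => _ gi gj go; rewrite !andbT in run.
have Ei : ml && onth u (v i + a) = ml by case: (ml) gi => //= ->.
have Ej : mr && onth u (v j + b) = mr by case: (mr) gj => //= ->.
rewrite !onthTE in gi gj.
have [a' [b' [aa bb ia jb [E run']]]] := IH (a + ml) (b + mr).
exists a', b'; split; try lia.
  rewrite Ei Ej -!addnA; split=> // full.
have -> : 2 * n.+1 + 2 = (1 + (2 * n + 2)).+1 by lia.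
apply: (runs_loop_next run); apply: run'; move: gi gj go full.
by case: (ml); case: (mr) => //=; lia.
Qed.

Lemma runs_pat ps u v a b :
  v i + a <= size u -> v j + b <= size u ->
  exists a' b', [/\ v i + a' <= size u, v j + b' <= size u &
    runs (pat_frag ps) (scene u (disp v a b)) (scene u (disp v a' b'))
      (pmatch ps (drop (v i + a) u) (drop (v j + b) u))
      ((size ps).+1 * (4 * size u + 5))].
Proof.
elim: ps a b => [|[ml mr p|ml mr p] ps IH] a b ia jb.
- by exists a, b; split=> //; apply: halts_mono (runs_const _ _ _); lia.
- have := runs_read_only (fun r => p (letter_at r i) (letter_at r j))
    (fun r => walk (ml && isSome (letter_at r i)) (mr && isSome (letter_at r j)))
    u (disp v a b).
  rewrite letter_i letter_j disp_walk -/(item_frag ml mr p) /= !ohead_drop !adv_drop.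
  have ia' : v i + (a + (ml && onth u (v i + a))) <= size u.
    by rewrite onthTE; case: ml => /=; lia.
  have jb' : v j + (b + (mr && onth u (v j + b))) <= size u.
    by rewrite onthTE; case: mr => /=; lia.
  case: (p _ _) => run.
    have [a' [b' [ia2 jb2 run']]] := IH _ _ ia' jb'.
    exists a', b'; split=> //; rewrite -!addnA.
    by apply: halts_mono (runs_branch run run'); lia.
  do 2 eexists; split; [exact: ia' | exact: jb' |].
  by apply: halts_mono (runs_branch run (runs_const _ _ _)); lia.
- rewrite /= !size_drop.
  have [a1 [b1 [_ _ ia1 jb1 [-> run]]]] :=
    runs_star ml mr p u v (size u - (v i + a) + (size u - (v j + b))) a b.
  have [a' [b' [ia2 jb2 run']]] := IH _ _ (ia1 ia) (jb1 jb).
  exists a', b'; split=> //.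
  by apply: halts_mono (runs_branch (run (leqnn _)) run'); lia.
Qed.

Definition restore (b : bool) : frag K G :=
  branch (back 1 (pred1 i)) (branch (back 2 (pred1 j)) (const b) (const b)) (const b).

Lemma runs_restore x u v a b :
  v i + a <= size u -> v j + b <= size u -> v 1 = 0 -> v 2 = 0 ->
  runs (restore x) (scene u (disp v a b)) (scene u (fun k => v k)) x (8 * size u + 20).
Proof.
move=> ia jb v1 v2; have [i1 i2] : i != 1 /\ i != 2 by split; apply/eqP; lia.
have [j1 j2] : j != 1 /\ j != 2 by split; apply/eqP; lia.
have r1 : runs (back 1 (pred1 i)) (scene u (disp v a b)) (scene u (disp v 0 b)) true
    (4 * size u + 4).
  have := @runs_back 1 (pred1 i) u (disp v a b) a.
  rewrite /= {1}eq_sym i1 /disp /= orbT v1 add0n => /(_ _ isT erefl) H.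
  apply: (@halts_mono _ _ _ _ _ _ _ (4 * a + 4)); first by lia.
  have {H} := H ltac:(lia) ltac:(lia); congr runs; congr scene; apply/funext => k.
  by case: (k == i); case: (k == 1) => //=; lia.
have r2 : runs (back 2 (pred1 j)) (scene u (disp v 0 b)) (scene u (fun k => v k)) true
    (4 * size u + 4).
  have := @runs_back 2 (pred1 j) u (disp v 0 b) b.
  rewrite /= {1}eq_sym j2 /disp /= (eq_sym 2 i) (negPf i2) /= orbT v2 add0n => /(_ _ isT erefl) H.
  apply: (@halts_mono _ _ _ _ _ _ _ (4 * b + 4)); first by lia.
  have {H} := H ltac:(lia) ltac:(lia); congr runs; congr scene; apply/funext => k.
  have [->|ki] := eqVneq k i; first by rewrite (negPf i2) (negPf ij) /= ; lia.
  have [->|k1] := eqVneq k 1; first by rewrite (eq_sym 1 j) (negPf j1) /=; lia.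
  by case: (k == j); case: (k == 2) => //=; lia.
by apply: halts_mono (runs_branch r1 (runs_branch r2 (runs_const x u _))); lia.
Qed.

End Pattern.

Definition rewound (i : nat) (b : bool) : frag K G :=
  branch (back i pred0) (const b) (const b).

Lemma runs_rewound i b u v :
  0 < i <= K -> v i <= size u ->
  runs (rewound i b) (scene u (fun k => v k)) (scene u (fun k => vset v i 0 k)) b
    (4 * size u + 6).
Proof.
move=> iK iu; have := @runs_back i pred0 u (fun k => v k) (v i) iK isT erefl iu.
move=> r; have := runs_branch r (runs_const b u _) (C := const b).
have -> : (fun k => if (k == i) || pred0 k then ((v k)%:Z - (v i)%:Z)%R else v k) =
    (fun k => vset v i 0 k : int).
  by apply/funext => k; rewrite orbF /vset; case: eqP => [->|] //; lia.
by apply: halts_mono; lia.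
Qed.

(** The search loop of the [Ex] case stops on success as well as at the end of the word, and its
    outcome does not tell which. So [g] is evaluated once more at the position reached, before the
    head is rewound. *)
Fixpoint fo_frag (f : fo B) : frag K G :=
  match f with
  | Pat ps i j => branch (pat_frag i j ps) (restore i j true) (restore i j false)
  | Neg g => branch (fo_frag g) (const false) (const true)
  | Conj g h => branch (fo_frag g) (fo_frag h) (const false)
  | Ex i g =>
      branch (loop (branch (fo_frag g) (const false)
          (read_only (fun r => isSome (letter_at r i))
             (fun r k => if letter_at r i is Some _ then
                           if k == i then MRight else MStay else MStay))))
        (branch (fo_frag g) (rewound i true) (rewound i false)) (const false)
  end.

Fixpoint fo_time (f : fo B) (n : nat) : nat :=
  match f with
  | Pat ps i j => (size ps).+1 * (4 * n + 5) + (8 * n + 21)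
  | Neg g => fo_time g n + 2
  | Conj g h => fo_time g n + fo_time h n + 2
  | Ex i g => (n + 2) * (fo_time g n + 5) + fo_time g n + 4 * n + 10
  end.

Lemma runs_fo f u v :
  wf K f -> (forall k, v k <= size u) -> v 1 = 0 -> v 2 = 0 ->
  (forall k, k \in bound f -> v k = 0) ->
  runs (fo_frag f) (scene u (fun k => v k)) (scene u (fun k => v k)) (sem f u v)
    (fo_time f (size u)).
Proof.
elim: f v => [ps i j|g IH|g IHg h IHh|i g IH] v /=.
- move=> /and3P[ij iK jK] vu v1 v2 _.
  have [|| a [b [ia jb run]]] := @runs_pat i j ij iK jK ps u v 0 0; rewrite ?addn0 //.
  have E : disp i j v 0 0 = (fun k => v k : int).
    by apply/funext => k; rewrite /disp !if_same addn0.
  rewrite E !addn0 in run; set x := pmatch _ _ _ in run *.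
  have run2 : runs (if x then restore i j true else restore i j false)
      (scene u (disp i j v a b)) (scene u (fun k => v k)) x (8 * size u + 20).
    by case: x {run}; apply: runs_restore.
  by apply: halts_mono (runs_branch run run2); lia.
- move=> wg vu v1 v2 vb; have run := IH v wg vu v1 v2 vb.
  have run2 : runs (if sem g u v then const false else const true)
      (scene u (fun k => v k)) (scene u (fun k => v k)) (~~ sem g u v) 1.
    by case: (sem g u v); apply: runs_const.
  by apply: halts_mono (runs_branch run run2); lia.
- move=> /andP[wg wh] vu v1 v2 vb.
  have run : runs _ _ _ _ _ := IHg v wg vu v1 v2 _.
  have {}run := run ltac:(by move=> k kb; apply: vb; rewrite mem_cat kb).
  have run2 : runs _ _ _ _ _ := IHh v wh vu v1 v2 _.
  have {}run2 := run2 ltac:(by move=> k kb; apply: vb; rewrite mem_cat kb orbT).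
  have run3 : runs (if sem g u v then fo_frag h else const false)
      (scene u (fun k => v k)) (scene u (fun k => v k)) (sem g u v && sem h u v)
      (fo_time h (size u)).+1.
    case: (sem g u v); first exact: halts_mono run2.
    exact: halts_mono (runs_const _ _ _).
  by apply: halts_mono (runs_branch run run3); lia.
- move=> /and3P[iK ig wg] vu v1 v2 vb.
  have i0 : v i = 0 by apply: vb; rewrite inE eqxx.
  have iK' : 0 < i <= K by lia.
  have run x : x <= size u ->
      runs (fo_frag g) (scene u (fun k => vset v i x k)) (scene u (fun k => vset v i x k))
        (sem g u (vset v i x)) (fo_time g (size u)).
    move=> xu; apply: IH => //.
    + by move=> k; rewrite /vset; case: eqP.
    + by rewrite /vset; case: eqP => //; lia.
    + by rewrite /vset; case: eqP => //; lia.
    + move=> k kg; rewrite /vset; case: eqP => [ki|_]; first by rewrite -ki kg in ig.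
      by apply: vb; rewrite inE kg orbT.
  set search := loop _.
  (* The search stops at [x'], the first witness from [x] on or else the end of the word; in both
     cases the value of [g] at [x'] decides the existential formula. *)
  have find n x : n + x = size u -> exists x', [/\ x' <= size u,
      sem g u (vset v i x') = has (fun y => sem g u (vset v i y)) (iota x n.+1) &
      runs search (scene u (fun k => vset v i x k)) (scene u (fun k => vset v i x' k))
        true (n.+1 * (fo_time g (size u) + 5))].
    elim: n x => [|n IHn] x xu.
      exists x; split; [lia | by rewrite /= orbF |].
      have r := run x ltac:(lia); have r2 : runs (if sem g u (vset v i x) then const false else
        (read_only (fun r => isSome (letter_at r i))
             (fun r k => if letter_at r i is Some _ then
                           if k == i then MRight else MStay else MStay)))
        (scene u (fun k => vset v i x k)) (scene u (fun k => vset v i x k)) false 1.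
        case: (sem _ _ _); first exact: runs_const.
        have := runs_read_only (fun r => isSome (letter_at r i))
             (fun r k => if letter_at r i is Some _ then
                           if k == i then MRight else MStay else MStay) u
             (fun k => vset v i x k).
        rewrite letter_scene // /vset eqxx /= onth_default; last by lia.
        by congr runs; congr scene; apply/funext => k; rewrite GRing.addr0.
      by apply: halts_mono (runs_loop_stop (runs_branch r r2)); lia.
    have r := run x ltac:(lia); case E: (sem g u (vset v i x)).
      exists x; split; [lia | by rewrite /= E |].
      rewrite E in r.
      have r2 : runs (if true then const false else
        (read_only (fun r => isSome (letter_at r i))
             (fun r k => if letter_at r i is Some _ then
                           if k == i then MRight else MStay else MStay)))
        (scene u (fun k => vset v i x k)) (scene u (fun k => vset v i x k)) false 1
        := runs_const _ _ _.
      by apply: halts_mono (runs_loop_stop (runs_branch r r2)); lia.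
    have [x' [xu' sx' r']] := IHn x.+1 ltac:(lia).
    exists x'; split=> //; first by rewrite sx' [RHS]/= E.
    rewrite E in r.
    have r2 : runs (if false then const false else
        (read_only (fun r => isSome (letter_at r i))
             (fun r k => if letter_at r i is Some _ then
                           if k == i then MRight else MStay else MStay)))
        (scene u (fun k => vset v i x k)) (scene u (fun k => vset v i x.+1 k)) true 1.
      have := runs_read_only (fun r => isSome (letter_at r i))
             (fun r k => if letter_at r i is Some _ then
                           if k == i then MRight else MStay else MStay) u
             (fun k => vset v i x k).
      rewrite letter_scene //.
      have -> : vset v i x i = x by rewrite /vset eqxx.
      rewrite /=.
      case F: onth => [c|]; last by have := onthTE u x; rewrite F /=; lia.
      congr runs; congr scene; apply/funext => k; rewrite /vset.
      by case: eqP => //= _; rewrite ?GRing.addr0 //; lia.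
    by apply: halts_mono (runs_loop_next (runs_branch r r2) r'); lia.
  have [x [xu sx rs]] := find (size u) 0 (addn0 _).
  have E : (fun k => vset v i 0 k : int) = (fun k => v k : int).
    by apply/funext => k; rewrite /vset; case: eqP => // ->; rewrite i0.
  rewrite E in rs; rewrite -[X in runs _ _ _ X _]/(has (fun y => sem g u (vset v i y)) (iota 0 (size u).+1)) -sx.
  set b := sem g u (vset v i x).
  have r2 : runs (if b then rewound i true else rewound i false)
      (scene u (fun k => vset v i x k)) (scene u (fun k => v k)) b (4 * size u + 6).
    have F : (fun k => vset (vset v i x) i 0 k : int) = (fun k => v k : int).
      by apply/funext => k; rewrite /vset; case: eqP => // ->; rewrite i0.
    rewrite -F; case: b; apply: runs_rewound => //; by rewrite /vset eqxx.
  have r3 := runs_branch (run x xu) r2.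
  by apply: halts_mono (runs_branch (b1 := true) rs r3); lia.
Qed.

End Compilation.

(** * Polynomial time bounds *)

Section PolynomialBounds.
Import GRing.Theory.

Definition poly_bounded (f : nat -> nat) : Prop :=
  exists p : {poly nat}, forall n, f n <= p.[n]%R.

Lemma poly_bounded_const c : poly_bounded (fun=> c).
Proof. by exists (c%:P)%R => n; rewrite hornerC. Qed.

Lemma poly_bounded_id : poly_bounded id.
Proof. by exists 'X%R => n; rewrite hornerX. Qed.

Lemma poly_bounded_add f g :
  poly_bounded f -> poly_bounded g -> poly_bounded (fun n => f n + g n).
Proof.
move=> [p hp] [r hr]; exists (p + r)%R => n.
by rewrite hornerD; apply: leq_add.
Qed.

Lemma poly_bounded_mul f g :
  poly_bounded f -> poly_bounded g -> poly_bounded (fun n => f n * g n).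
Proof.
move=> [p hp] [r hr]; exists (p * r)%R => n.
by rewrite hornerM; apply: leq_mul.
Qed.

Lemma poly_bounded_fo_time (B : finType) (f : fo B) : poly_bounded (fo_time f).
Proof.
have C := poly_bounded_const; have I := poly_bounded_id.
have D := poly_bounded_add; have M := poly_bounded_mul.
elim: f => [ps i j|g IH|g IHg h IHh|i g IH].
- exact: D (M _ _ (C _) (D _ _ (M _ _ (C 4) I) (C 5))) (D _ _ (M _ _ (C 8) I) (C 21)).
- exact: D IH (C 2).
- exact: D (D _ _ IHg IHh) (C 2).
- exact: D (D _ _ (D _ _ (M _ _ (D _ _ I (C 2)) (D _ _ IH (C 5))) IH) (M _ _ (C 4) I)) (C 10).
Qed.

(** The formula is evaluated on the decoded word, which may be shorter than the input in terms of
    which the bound is stated. *)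
Lemma fo_time_mono (B : finType) (f : fo B) m n : m <= n -> fo_time f m <= fo_time f n.
Proof.
move=> mn; elim: f => [ps i j|g IH|g IHg h IHh|i g IH] /=.
- by rewrite !leq_add // ?leq_mul // ?leq_add // leq_mul.
- by rewrite leq_add2r.
- by rewrite leq_add2r leq_add.
- by rewrite !leq_add // ?leq_mul // leq_add.
Qed.

End PolynomialBounds.

(** * Fragments as Turing machines *)

Section Simulation.
Variables (K : nat) (R G : finType) (inp : R -> G) (A : frag K G).

Definition machine_of : machine R :=
  {| tm_tapes := K; tm_state := fst_type A; tm_alphabet := G; tm_input := inp;
     tm_start := fini A; tm_verdict := @fout K G A; tm_delta := @fdel K G A |}.

Definition start_tapes (w : seq R) : tapes K G :=
  fun i => (look (if i == ord0 then map inp w else [::]), 0%R).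

Lemma simulation n w :
  let c := iter n (@tm_step R machine_of) (tm_init machine_of w) in
  let s := iter n (@fstep K G A) (fini A, start_tapes w) in
  cf_state c = s.1 /\ forall i, tape_repr (s.2 i) (cf_tapes c i).
Proof.
elim: n => [|n [IH1 IH2]] /=; first by split=> // i; apply: tape_repr_word.
set c := iter n _ _ in IH1 IH2 *; set s := iter n _ _ in IH1 IH2 *.
rewrite /tm_step /fstep /= IH1; case: (fout s.1) => [b|]; first by [].
have -> : [ffun i => Defs.thead (cf_tapes c i)] = scan s.2.
  by apply/ffunP => i; rewrite !ffunE; apply: tape_repr_head.
by split=> //= i; apply: tape_repr_act.
Qed.

Lemma verdict_runs w c b t n :
  runs A (start_tapes w) c b t -> t <= n -> verdict_after machine_of n w = Some b.
Proof.
move=> r le; have [q [Eq hq]] := halts_mono le r.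
have [E _] := simulation n w.
by rewrite /verdict_after E Eq.
Qed.

End Simulation.

(** * Certificates as colourings of the input word *)

Section Certificates.
Variables (S T : finType) (t0 : T).
Let R : finType := option (S + bool)%type.
Let B : finType := (S * T)%type.
Let G : finType := (R + B)%type.

Definition colour0 : T := nth t0 (enum T) 0.
Definition next_colour (t : T) : T := nth t0 (enum T) (index t (enum T)).+1.

Lemma iter_next_colour k :
  k < #|T| -> iter k next_colour colour0 = nth t0 (enum T) k.
Proof.
elim: k => // k IH lt; rewrite iterS IH; last exact: ltnW.
by rewrite /next_colour index_uniq -?cardE ?enum_uniq // ltnW.
Qed.

(** At [x = size u] this appends a letter, which is how the word is first copied to the work
    tapes. *)
Definition put (u : seq (S * T)) (x : nat) (b : S * T) : seq (S * T) := take x u ++ b :: drop x.+1 u.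

Lemma look_put (u : seq (S * T)) x b :
  x <= size u ->
  upd (look (map (@inr R B) u)) x (Some (inr b)) = look (map (@inr R B) (put u x b)).
Proof.
move=> xu; apply/funext => -[n|n] //; rewrite /upd /look !onth_map /put onth_cat.
rewrite size_takel //; have -> : (Posz n == Posz x) = (n == x) by [].
case: ltngtP => [lt|gt|->]; last by rewrite subnn.
  by rewrite !onthE map_take nth_take.
by rewrite -(subnSK gt) /= !onthE map_drop nth_drop; congr (omap _ (nth _ _ _)); lia.
Qed.

(* A certificate lists, for each letter of the word, as many bits [true] as it
   takes to step to its colour, and then a bit [false]. *)
Definition feed (s : seq (S * T) * nat) (r : option (S + bool)) : seq (S * T) * nat :=
  let: (u, x) := s in
  match r with
  | Some (inl a) => (put u x (a, colour0), x.+1)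
  | None => (u, 0)
  | Some (inr true) =>
      (if onth u x is Some b then put u x (b.1, next_colour b.2) else u, x)
  | Some (inr false) => (u, if onth u x is Some _ then x.+1 else x)
  end.

Definition decode (z : seq (option (S + bool))) : seq (S * T) := (foldl feed ([::], 0) z).1.

Lemma feed_size u x r :
  x <= size u -> (feed (u, x) r).2 <= size (feed (u, x) r).1 /\
  size u <= size (feed (u, x) r).1 <= (size u).+1.
Proof.
move=> xu; case: r => [[a|[]]|] /=.
- rewrite /put size_cat /= size_takel // size_drop; lia.
- have := onthTE u x; case: onth => [b|] /= ltx; last by lia.
  by rewrite /put size_cat /= size_takel // size_drop; lia.
- have := onthTE u x; case: onth => [b|] /= ltx; lia.
- lia.
Qed.

Section Machine.
Variables (K : nat) (f : fo B).
Hypotheses (K1 : 0 < K) (wff : wf K f).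

Definition shift_colour (g : G) : G :=
  match g with inr b => inr (b.1, next_colour b.2) | inl r => inl r end.

Definition feed_frag : frag K G :=
  act (fun r : reads K G => isSome (r ord0)) (fun r i =>
    if i == ord0 then (r i, if r ord0 is Some _ then MRight else MStay) else
    match r ord0 with
    | Some (inl (Some (inl a))) => (Some (inr (a, colour0)), MRight)
    | Some (inl (Some (inr true))) => (omap shift_colour (r i), MStay)
    | Some (inl (Some (inr false))) => (r i, if r i is Some _ then MRight else MStay)
    | _ => (r i, MStay)
    end).

Definition skip_frag : frag K G :=
  act (fun=> true) (fun r i => (r i, if i == ord0 then MRight else MStay)).

Definition rewind_frag : frag K G := @back K R B 1 (fun i => 1 < i).

(** Only the separator needs a loop of its own, as it sends the work heads back to their first cell;
    every other letter takes one step. At the end of the input [feed_frag] yields [false], which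
    ends the decoding. *)
Definition decode_body : frag K G :=
  branch (act (fun r : reads K G => r ord0 == Some (inl None)) (@keep K G))
    (branch rewind_frag skip_frag skip_frag) feed_frag.

Definition decide_frag : frag K G :=
  branch (loop decode_body) (branch rewind_frag (@fo_frag K R B f) skip_frag) skip_frag.

Variable z : seq (option (S + bool)).
Let c0 : int -> option G := look (map inl z).
Let st (p : nat) (s : seq (S * T) * nat) : tapes K G := @scene K R B c0 p s.1 (fun=> s.2).

Lemma scan_st0 p s : scan (st p s) ord0 = omap inl (onth z p).
Proof. by rewrite /scan ffunE /st /scene eqxx /= onth_map. Qed.

Lemma scan_st p s i : i != ord0 -> scan (st p s) i = omap inr (onth s.1 s.2).
Proof. by move=> /negPf i0; rewrite /scan ffunE /st /scene i0 /= onth_map. Qed.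

Lemma runs_rewind p s :
  s.2 <= size s.1 -> runs rewind_frag (st p s) (st p (s.1, 0)) true (4 * size s.1 + 4).
Proof.
move=> su; have := @runs_back K R B c0 p 1 (fun i => 1 < i) s.1 (fun=> s.2) s.2.
move=> /(_ _ isT erefl su) r.
apply: (@halts_mono _ _ _ _ _ _ _ (4 * s.2 + 4)); first by lia.
have {r} := r ltac:(lia); congr runs; apply/funext => i; rewrite /st /scene.
case: eqP => // /eqP i0; have -> : (nat_of_ord i == 1) || (1 < i) = true.
  by rewrite -val_eqE /= in i0; lia.
by rewrite GRing.subrr.
Qed.

Lemma runs_skip p s : runs skip_frag (st p s) (st p.+1 s) true 1.
Proof.
have := runs_act (fun=> true)
  (fun r i => (r i, if i == ord0 then MRight else MStay)) (st p s).
congr runs; apply/funext => i; rewrite /tact /aact ffunE /= upd_same /st /scene.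
by case: eqP => _ /=; congr (_, _); lia.
Qed.

Lemma runs_feed p s r :
  onth z p = Some r -> r != None -> s.2 <= size s.1 ->
  runs feed_frag (st p s) (st p.+1 (feed s r)) true 1.
Proof.
move=> zr rN su.
have := runs_act (fun r : reads K G => isSome (r ord0)) (fun r i =>
    if i == ord0 then (r i, if r ord0 is Some _ then MRight else MStay) else
    match r ord0 with
    | Some (inl (Some (inl a))) => (Some (inr (a, colour0)), MRight)
    | Some (inl (Some (inr true))) => (omap shift_colour (r i), MStay)
    | Some (inl (Some (inr false))) => (r i, if r i is Some _ then MRight else MStay)
    | _ => (r i, MStay)
    end) (st p s).
rewrite -/feed_frag scan_st0 zr [isSome _]/=; congr runs; apply/funext => i.
rewrite /tact /aact /=.
have [->|i0] := eqVneq i ord0.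
  by rewrite scan_st0 zr /st /scene eqxx /= -[Some (inl r)]/(omap inl (Some r)) -zr
    -onth_map upd_same; congr (_, _); lia.
rewrite scan_st // /st /scene (negPf i0) /=.
case: s su => u x /= xu; case: r zr rN => [[a|[]]|] //= zr _.
- by rewrite look_put //; congr (_, _); lia.
- case E: onth => [b|] /=; rewrite GRing.addr0; first by rewrite look_put.
  congr (_, _); have := upd_same (look (map (@inr R B) u)) x.
  by rewrite {2}/look onth_map E.
- case E: onth => [b|] /=; have := upd_same (look (map (@inr R B) u)) x;
  rewrite {2}/look onth_map E /= => ->; congr (_, _); lia.
Qed.

(** The invariant [size s.1 <= p] bounds the decoded word by the input read so far, and with it the
    cost of a rewind. *)
Lemma runs_decode n p s :
  n + p = size z -> s.2 <= size s.1 -> size s.1 <= p ->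
  exists x, x <= size (foldl feed s (drop p z)).1 <= size z /\
  runs (loop decode_body) (st p s) (st (size z) ((foldl feed s (drop p z)).1, x)) true
    (n.+1 * (4 * size z + 15)).
Proof.
elim: n p s => [|n IH] p s np su sp.
  exists s.2; rewrite drop_oversize; last by lia.
  rewrite /= su; split; first by lia.
  have Ep : onth z p = None by apply: onth_default; lia.
  have r1 : runs (act (fun r : reads K G => r ord0 == Some (inl None)) (@keep K G))
      (st p s) (st p s) false 1.
    have := runs_act (fun r : reads K G => r ord0 == Some (inl None)) (@keep K G) (st p s).
    by rewrite tact_keep scan_st0 Ep.
  have r2 : runs feed_frag (st p s) (st p s) false 1.
    have := runs_act (fun r : reads K G => isSome (r ord0)) (fun r i =>
      if i == ord0 then (r i, if r ord0 is Some _ then MRight else MStay) else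
      match r ord0 with
      | Some (inl (Some (inl a))) => (Some (inr (a, colour0)), MRight)
      | Some (inl (Some (inr true))) => (omap shift_colour (r i), MStay)
      | Some (inl (Some (inr false))) => (r i, if r i is Some _ then MRight else MStay)
      | _ => (r i, MStay)
      end) (st p s).
    rewrite -/feed_frag scan_st0 Ep /=; congr runs.
    rewrite -[RHS]tact_keep; congr tact; apply/funext => i.
    by rewrite /keep; case: eqP.
  have -> : st (size z) (s.1, s.2) = st p s by rewrite -np; case: (s).
  by apply: halts_mono (runs_loop_stop (runs_branch r1 r2)); lia.
have [r zr] : exists r, onth z p = Some r.
  by have := onthTE z p; case: onth => [r|] /=; [exists r | lia].
have -> : drop p z = r :: drop p.+1 z.
  have lt : p < size z by lia.
  by rewrite (drop_nth r lt); congr cons; exact: onth_nth.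
have [su' /andP[_ sp']] : (feed s r).2 <= size (feed s r).1 /\
    size s.1 <= size (feed s r).1 <= (size s.1).+1.
  by case: (s) su => u x; apply: feed_size.
have [x [xs rn]] := IH p.+1 (feed s r) (etrans (addnS n p) np) su'
  (leq_trans sp' (sp : _ < p.+1)).
exists x; split=> //=.
have r1 : runs (act (fun r : reads K G => r ord0 == Some (inl None)) (@keep K G))
    (st p s) (st p s) (r == None) 1.
  have := runs_act (fun r : reads K G => r ord0 == Some (inl None)) (@keep K G) (st p s).
  rewrite tact_keep scan_st0 zr /=; congr runs.
have r2 : runs (if r == None then branch rewind_frag skip_frag skip_frag else feed_frag)
    (st p s) (st p.+1 (feed s r)) true (4 * size z + 10).
  case: eqP zr => [->|/eqP rN] zr.
    have := runs_branch (runs_rewind p su) (runs_skip _ _) (C := skip_frag).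
    by case: (s) sp => u y /= uy; apply: halts_mono; lia.
  by apply: halts_mono (runs_feed zr rN su); lia.
by apply: halts_mono (runs_loop_next (runs_branch r1 r2) rn); lia.
Qed.

Definition decide_time (n : nat) : nat :=
  n.+1 * (4 * n + 15) + (4 * n + fo_time f n + 10).

Lemma runs_decide :
  exists c, runs decide_frag (@start_tapes K R G (@inl R B) z) c
    (sem f (decode z) (fun=> 0)) (decide_time (size z)).
Proof.
have [x [/andP[xs sz] r]] := @runs_decode (size z) 0 ([::], 0) (addn0 _) isT isT.
rewrite drop0 -/(decode z) in xs sz r.
have E : st 0 ([::], 0) = @start_tapes K R G (@inl R B) z.
  by apply/funext => i; rewrite /st /scene /start_tapes; case: eqP.
have r1 := @runs_rewind (size z) (decode z, x) xs.
have r2 := @runs_fo K R B c0 (size z) f (decode z) (fun=> 0) wff (fun=> leq0n _) erefl erefl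
  (fun _ _ => erefl).
eexists; rewrite -E.
apply: halts_mono (runs_branch (b1 := true) r (runs_branch (b1 := true) r1 r2)).
have := fo_time_mono f sz; rewrite /decide_time /=; lia.
Qed.

End Machine.

(** [decode] is total, so inputs that are not a word, a separator and bits also receive a verdict,
    as [in_P] demands. *)
Lemma in_P_fo K (f : fo B) :
  0 < K -> wf K f -> in_P [set z : seq (option (S + bool)) | sem f (decode z) (fun=> 0)].
Proof.
move=> K1 wff; have [p hp] : poly_bounded (decide_time f).
  have C := poly_bounded_const; have I := poly_bounded_id.
  have D := poly_bounded_add; have M := poly_bounded_mul.
  have L := poly_bounded_fo_time f.
  exact: D (M _ _ (D _ _ (C 1) I) (D _ _ (M _ _ (C 4) I) (C 15)))
    (D _ _ (D _ _ (M _ _ (C 4) I) L) (C 10)).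
exists (machine_of (@inl R B) (decide_frag K f)), p => z.
exists (sem f (decode z) (fun=> 0)); split=> //.
have [c r] := runs_decide K1 wff z.
exact: (verdict_runs r (hp _)).
Qed.

Lemma decode_word (w : seq S) :
  foldl feed ([::], 0) [seq Some (inl a) | a <- w] =
  ([seq (a, colour0) | a <- w], size w).
Proof.
elim/last_ind: w => //= w a IH.
rewrite !map_rcons foldl_rcons IH /= size_rcons /put take_oversize ?size_map //.
by rewrite drop_oversize ?size_map ?cats1.
Qed.

Definition certificate (ts : seq T) : seq bool :=
  flatten [seq rcons (nseq (index t (enum T)) true) false | t <- ts].

Lemma decode_certificate (v : seq (S * T)) (w : seq S) (ts : seq T) :
  size w = size ts ->
  foldl feed (v ++ [seq (a, colour0) | a <- w], size v)
    [seq Some (inr b) | b <- certificate ts] = (v ++ zip w ts, size v + size ts).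
Proof.
elim: ts w v => [|t ts IH] [|a w] v //=; first by rewrite addn0.
move=> [E]; rewrite /certificate /= map_cat foldl_cat.
have H k : foldl feed (v ++ (a, colour0) :: [seq (a, colour0) | a <- w], size v)
    [seq Some (inr b) | b <- nseq k true] =
    (v ++ (a, iter k next_colour colour0) :: [seq (a, colour0) | a <- w], size v).
  elim: k => // k IHk.
  rewrite -[k.+1]addn1 nseqD map_cat foldl_cat IHk /= onth_cat ltnn subnn /=.
  by rewrite /put take_size_cat // drop_cat ltnNge leqnSn /= subSnn /= drop0 addn1.
rewrite map_rcons foldl_rcons H /= onth_cat ltnn subnn /=.
rewrite iter_next_colour; last by rewrite cardE index_mem mem_enum.
rewrite nth_index ?mem_enum // -[RHS]/(v ++ (a, t) :: zip w ts, _) -!cat_rcons.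
by have := IH w (rcons v (a, t)) E; rewrite size_rcons addSnnS => <-.
Qed.

Lemma size_certificate ts : size (certificate ts) <= (#|T|).+1 * size ts.
Proof.
elim: ts => //= t ts IH; rewrite /certificate /= size_cat size_rcons size_nseq mulnS.
by rewrite leq_add // cardE ltnS index_size.
Qed.

Lemma map_fst_put (u : seq (S * T)) x b c : onth u x = Some c ->
  c.1 = b.1 -> [seq p.1 | p <- put u x b] = [seq p.1 | p <- u].
Proof.
move=> E cb; have lt : x < size u by rewrite -onthTE E.
rewrite /put map_cat /= -cb -[X in _ = map _ X](cat_take_drop x) map_cat.
have Ec : nth c u x = c by exact: onth_nth E.
by rewrite (drop_nth c lt) map_cons Ec.
Qed.

(** Soundness has to cope with every bit string, not only with the values of [certificate]: bits can
    change colours but never letters. *)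
Lemma decode_bits (s : seq (S * T) * nat) (c : seq bool) :
  [seq p.1 | p <- (foldl feed s [seq Some (inr b) | b <- c]).1] = [seq p.1 | p <- s.1].
Proof.
elim: c s => //= b c IH [u x]; rewrite IH.
by case: b => //=; case E: onth => [d|] //=; rewrite (map_fst_put E).
Qed.

(** The interface between machines and logic: from here on it suffices to describe a language by a
    formula about coloured words. *)
Theorem in_NP_fo K (f : fo B) (L : set (seq S)) :
  0 < K -> wf K f ->
  (forall w, L w <-> exists2 ts : seq T,
     size ts = size w & sem f (zip w ts) (fun=> 0)) ->
  in_NP L.
Proof.
move=> K1 wff HL.
exists [set z : seq (option (S + bool)) | sem f (decode z) (fun=> 0)]%classic.
(* Each letter costs one bit [false] and at most [#|T|] bits [true]. *)
exists (((#|T|).+1)%:P * 'X)%R; split; first exact: in_P_fo K1 wff.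
move=> w; rewrite HL; split=> [[ts Ets sm]|[c [_ sm]]].
  exists (certificate ts); split.
    by rewrite hornerM hornerC hornerX -Ets; apply: size_certificate.
  rewrite /= /decode /with_certificate foldl_cat decode_word /=.
  by have := decode_certificate [::] (esym Ets) => /= ->.
move: sm; rewrite /= /decode /with_certificate foldl_cat decode_word /=.
set u := (foldl _ _ _).1 => sm.
have Eu : unzip1 u = w.
  by rewrite /u /unzip1 decode_bits -map_comp map_id.
exists (unzip2 u); first by rewrite -Eu !size_map.
by rewrite -{1}Eu zip_unzip.
Qed.

End Certificates.

(** * Words and their local patterns *)

Section LetterPatterns.
Implicit Types (w s t : seq letter) (x y : option letter) (bs : seq bool).

Definition is_bit x : bool := if x is Some (LBit _) then true else false.
Definition is_bit_of b x : bool := if x is Some (LBit b') then b == b' else false.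
Definition is_sep x : bool := if x is Some LSep then true else false.
Definition is_infty x : bool := if x is Some LInfty then true else false.
Definition is_concept x : bool := if x is Some LConcept then true else false.
Definition is_role x : bool := if x is Some LRole then true else false.
Definition is_entry x : bool := is_concept x || is_role x.
Definition is_end x : bool := if x is Some _ then is_entry x else true.
Definition same_bit x y : bool := if x is Some (LBit b) then is_bit_of b y else false.

Definition nbits (n : nat) : seq bool :=
  if bin_of_nat n is BinNums.Npos m then pos_bits m else [::].

Lemma binaryE n : binary n = map LBit (nbits n).
Proof. by rewrite /binary /nbits; case: bin_of_nat. Qed.

Lemma pos_bits_inj : injective pos_bits.
Proof.
elim=> [p IH|p IH|] [p'|p'|] //= [].
- by move/IH ->.
- by case: p {IH}.
- by move/IH ->.
- by case: p'.
Qed.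

Lemma nbits_inj : injective nbits.
Proof.
move=> m n; rewrite /nbits => E; apply: (can_inj bin_of_natK).
case: (bin_of_nat m) (bin_of_nat n) E => [|p] [|p'] //.
- by case: p'.
- by case: p.
- by move/pos_bits_inj ->.
Qed.

Lemma nbits0 : nbits 0 = [::]. Proof. by []. Qed.

Lemma last_pos_bits b p : last b (pos_bits p) = true.
Proof. by elim: p b => //= p IH b; rewrite IH. Qed.

Lemma last_nbits n : last true (nbits n) = true.
Proof. by rewrite /nbits; case: bin_of_nat => // p; apply: last_pos_bits. Qed.

(** With the least significant bit first, absence of leading zeros means that the last bit is
    [true]; the default [true] of [last] admits the empty word, which denotes 0. *)
Lemma nbits_onto bs : last true bs -> exists n, nbits n = bs.
Proof.
move=> lb; have [->|ne] := eqVneq bs [::]; first by exists 0.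
suff [p <-] : exists p, pos_bits p = bs.
  exists (nat_of_bin (BinNums.Npos p)); rewrite /nbits.
  by have -> := nat_of_binK (BinNums.Npos p).
elim: bs ne lb => // b [|b' bs] IH _ lb.
  by exists BinNums.xH; move: lb => /= ->.
have [|//|p Ep] := IH; first by [].
by case: b lb => _; [exists (BinNums.xI p) | exists (BinNums.xO p)]; rewrite /= Ep.
Qed.

Fixpoint bit_prefix w : seq bool :=
  if w is LBit b :: w' then b :: bit_prefix w' else [::].

Fixpoint after_bits w : seq letter :=
  if w is LBit b :: w' then after_bits w' else w.

Lemma after_bitsE w : w = map LBit (bit_prefix w) ++ after_bits w.
Proof. by elim: w => //= -[b||||] w IH //=; rewrite -IH. Qed.

Lemma after_bits_head w : ~~ is_bit (ohead (after_bits w)).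
Proof. by elim: w => //= -[]. Qed.

Lemma after_bits_cat bs w : ~~ is_bit (ohead w) -> after_bits (map LBit bs ++ w) = w.
Proof. by move=> h; elim: bs => //=; case: w h => // -[]. Qed.

(* [true] is the left head. *)
Definition on (side : bool) x y := if side then x else y.

Definition one (side : bool) (p : pred (option letter)) : item letter :=
  One side (~~ side) (fun x y => p (on side x y)).
Definition here (side : bool) (p : pred (option letter)) : item letter :=
  One false false (fun x y => p (on side x y)).
Definition bits (side : bool) : item letter :=
  Star side (~~ side) (fun x y => is_bit (on side x y)).
Definition same_bits : item letter := Star true true same_bit.
Definition both_here (p : option letter -> option letter -> bool) : item letter :=
  One false false p.

Lemma star_bits_left n s t : size s <= n ->
  star true false (fun x y => is_bit (on true x y)) n s t = (after_bits s, t).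
Proof.
by elim: n s => [|n IH] [|[b||||] s] //= h; rewrite IH.
Qed.

Lemma star_bits_right n s t : size t <= n ->
  star false true (fun x y => is_bit (on false x y)) n s t = (s, after_bits t).
Proof.
by elim: n t => [|n IH] [|[b||||] t] //= h; rewrite IH.
Qed.

(** The greedy run over equal bits passes the longest common prefix; the numerals agree exactly if
    both heads then stand on their separators. *)
Lemma star_same n bs bs' s t : size bs <= n ->
  let st := star true true same_bit n
              (map LBit bs ++ LSep :: s) (map LBit bs' ++ LSep :: t) in
  is_sep (ohead st.1) && is_sep (ohead st.2) = (bs == bs').
Proof.
elim: n bs bs' => [|n IH] [|b bs] [|b' bs'] //= len; rewrite /goes //= ?andbT.
by have [->|ne] := eqVneq b b'; rewrite ?eqseq_cons ?eqxx /= ?IH // (negPf ne).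
Qed.

Lemma pmatch_same bs bs' s t :
  pmatch [:: same_bits; both_here (fun x y => is_sep x && is_sep y)]
    (map LBit bs ++ LSep :: s) (map LBit bs' ++ LSep :: t) = (bs == bs').
Proof.
by rewrite /= andbT star_same // !size_cat size_map /= -!addnA leq_addr.
Qed.

End LetterPatterns.

Local Open Scope classical_set_scope.
Local Open Scope card_scope.

(** * Pointed interpretations and their colours *)

Notation elt I := (NI + other I)%type.

Lemma ext_dom I C : ext I C `<=` dom I.
Proof.
elim: C => [A|a|||C IHC D IHD|C IHC D IHD|C IHC|r C IHC|r C IHC] x //=.
- exact: Cint_sub.
- by case.
- by case=> /IHC.
- by case=> [/IHC|/IHD].
- by case.
- by case.
- by case.
Qed.

(** [ecard] extracts its value by choice from a proof of finiteness, so its invariance under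
    bijections has to be established. *)
Lemma ecard_card_eq (U V : Type) (A : set U) (D : set V) :
  A #= D -> ecard A = ecard D.
Proof.
move=> AD; rewrite /ecard; case: pselect => [fA|nA]; case: pselect => [fD|nD] //.
- congr Fin; case: cid => n An /=; case: cid => m Dm /=.
  by apply/card_eq_II/(card_eq_trans _ Dm)/(card_eq_trans _ AD); rewrite card_eq_sym.
- by case: nD; case: fA => n An; exists n; apply: card_eq_trans An; rewrite card_eq_sym.
- by case: nA; case: fD => n Dn; exists n; apply: card_eq_trans AD Dn.
Qed.

Fixpoint subconcepts (C : concept) : seq concept :=
  C :: match C with
       | CAnd D E | COr D E => subconcepts D ++ subconcepts E
       | CNot D | CEx _ D | CAll _ D => subconcepts D
       | _ => [::]
       end.

Lemma subconcepts_refl C : C \in subconcepts C.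
Proof. by case: C => *; rewrite /= mem_head. Qed.

Lemma subconcepts_trans C D :
  D \in subconcepts C -> {subset subconcepts D <= subconcepts C}.
Proof.
elim: C => [A|a|||C IHC E IHE|C IHC E IHE|C IHC|r C IHC|r C IHC] /=;
  rewrite ?mem_seq1 ?[D \in _ :: _]in_cons; try by move=> /eqP ->.
all: case/predU1P => [-> //|]; rewrite ?mem_cat => h x hx; rewrite inE ?mem_cat.
- by case/orP: h => [/IHC/(_ _ hx)|/IHE/(_ _ hx)] ->; rewrite ?orbT.
- by case/orP: h => [/IHC/(_ _ hx)|/IHE/(_ _ hx)] ->; rewrite ?orbT.
- by rewrite (IHC h _ hx) orbT.
- by rewrite (IHC h _ hx) orbT.
- by rewrite (IHC h _ hx) orbT.
Qed.

Lemma nominal_inds a C : CNom a \in subconcepts C -> a \in concept_inds C.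
Proof.
elim: C => [A|b|||C IHC E IHE|C IHC E IHE|C IHC|r C IHC|r C IHC] /=;
  rewrite ?mem_seq1 ?[CNom a \in _ :: _]in_cons; try by move=> /eqP.
all: try (case/predU1P => [//|]; rewrite ?mem_cat).
- by move=> /eqP[->].
- by case/orP => [/IHC|/IHE] ->; rewrite ?orbT.
- by case/orP => [/IHC|/IHE] ->; rewrite ?orbT.
- exact: IHC.
- exact: IHC.
- exact: IHC.
Qed.

(* [M] bounds the number of special elements of an interpretation. *)
Inductive fact (M : nat) : Type :=
  | FCost of nat
  | FSlot of 'I_M
  | FExt of concept & 'I_M
  | FRole of NR & 'I_M & 'I_M
  | FMatch of seq (option ('I_M + bool))
  | LExt of concept
  | LSlot of 'I_M
  | LLoop of NR
  | LFrom of NR & 'I_M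
  | LTo of NR & 'I_M.
Arguments FCost {M}.
Arguments LExt {M}.
Arguments LLoop {M}.

Lemma fact_comparable M : comparable (fact M).
Proof. by move=> x y; rewrite /decidable; decide equality; exact: eq_comparable. Qed.
HB.instance Definition _ M := hasDecEq.Build (fact M) (compareP (@fact_comparable M)).

Section Colours.
Variables (T : wtbox) (q : bcq) (k : nat).

Definition relevant_concepts : seq concept :=
  flatten [seq subconcepts C | C <-
    flatten [seq (let: Defs.Sub C D := p.1 in [:: C; D]) | p <- T] ++
    flatten [seq (if u is QC A _ then [:: CAtom A] else [::]) | u <- q]].

Definition relevant_roles : seq NR :=
  flatten [seq (match C with CEx r _ | CAll r _ => [:: r] | _ => [::] end)
          | C <- relevant_concepts] ++
  flatten [seq (if u is QR r _ _ then [:: r] else [::]) | u <- q].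

Definition relevant_inds : seq NI :=
  undup (flatten [seq inclusion_inds p.1 | p <- T] ++
         flatten [seq term_inds t | t <- bcq_terms q]).

Local Notation cl := relevant_concepts.
Local Notation rr := relevant_roles.
Local Notation nm := relevant_inds.
Local Notation ts := (bcq_terms q).
Local Notation nt := (size ts).

Lemma cl_closed C D : C \in cl -> D \in subconcepts C -> D \in cl.
Proof.
move=> /flattenP[l /mapP[E hE ->] CE] DC; apply/flattenP.
by exists (subconcepts E); [apply: map_f | apply: subconcepts_trans DC].
Qed.

Lemma cl_tbox p B C : p \in T -> p.1 = Defs.Sub B C -> B \in cl /\ C \in cl.
Proof.
move=> pT Ep; have H E : E \in [:: B; C] -> E \in cl.
  move=> hE; apply/flattenP; exists (subconcepts E); last exact: subconcepts_refl.
  apply: map_f; rewrite mem_cat; apply/orP; left; apply/flattenP; exists [:: B; C] => //.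
  by apply/mapP; exists p; rewrite // Ep.
by split; apply: H; rewrite !inE eqxx ?orbT.
Qed.

Lemma cl_query A t : QC A t \in q -> CAtom A \in cl.
Proof.
move=> uq; apply/flattenP; exists (subconcepts (CAtom A)); last exact: subconcepts_refl.
apply: map_f; rewrite mem_cat; apply/orP; right; apply/flattenP.
by exists [:: CAtom A]; rewrite ?inE //; apply/mapP; exists (QC A t).
Qed.

Lemma cl_nominal a : CNom a \in cl -> a \in nm.
Proof.
move=> /flattenP[l /mapP[E hE ->] /nominal_inds aE]; rewrite mem_undup mem_cat.
move: hE; rewrite mem_cat => /orP[] /flattenP[l' /mapP[p hp ->]].
  case Ep: p.1 => [C D] hE; apply/orP; left; apply/flattenP.
  exists (inclusion_inds p.1); first exact: map_f.
  by rewrite Ep /= mem_cat; move: hE; rewrite !inE => /orP[] /eqP <-; rewrite aE ?orbT.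
by case: p {hp} => // A t; rewrite inE => /eqP E0; rewrite E0 in aE.
Qed.

Lemma rr_ex r C : CEx r C \in cl -> r \in rr.
Proof.
move=> h; rewrite mem_cat; apply/orP; left; apply/flattenP.
by exists [:: r]; rewrite ?inE //; apply/mapP; exists (CEx r C).
Qed.

Lemma rr_all r C : CAll r C \in cl -> r \in rr.
Proof.
move=> h; rewrite mem_cat; apply/orP; left; apply/flattenP.
by exists [:: r]; rewrite ?inE //; apply/mapP; exists (CAll r C).
Qed.

Lemma rr_query r t t' : QR r t t' \in q -> r \in rr.
Proof.
move=> h; rewrite mem_cat; apply/orP; right; apply/flattenP.
by exists [:: r]; rewrite ?inE //; apply/mapP; exists (QR r t t').
Qed.

Lemma atom_term u t : u \in q -> t \in atom_terms u -> t \in ts.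
Proof. by move=> uq tu; apply/flattenP; exists (atom_terms u) => //; apply: map_f. Qed.

(* Enough room for the named individuals, the violators and a match of the query. *)
Definition slots : nat := size nm + k + nt.

Local Notation slot := 'I_slots.

Record pointed : Type := PointedInterp {
  carrier : interp;
  sg : slot -> option (elt carrier);
  pt : elt carrier }.

Definition tcost (I : interp) : enat :=
  \big[eadd/Fin 0]_(p <- T) emul p.2 (ecard (vio I p.1)).

(** The first slots are reserved for the names of the TBox and the query, in the order of [nm], so
    that a slot number means the same name in every interpretation. *)
Record good (x : pointed) : Prop := Good {
  good_pt : dom (carrier x) (pt x);
  good_dom : forall j e, sg x j = Some e -> dom (carrier x) e;
  good_inj : forall i j e, sg x i = Some e -> sg x j = Some e -> i = j;
  good_vio : forall p e, p \in T -> vio (carrier x) p.1 e -> exists j, sg x j = Some e;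
  good_named : forall j : slot, j < size nm -> sg x j = Some (inl (nth 0 nm j)) }.

(* Where a piece of a match sends a term: nowhere, to a special element, or into
   the rest of the interpretation, at the point if the flag is [true]. *)
Definition place : Type := option (slot + bool).

Definition place_of (A : Type) (p : seq (option A)) (t : term) : option A :=
  nth None p (index t ts).

Definition places_ok (x : pointed) (p : term -> place) (h : term -> elt (carrier x)) :=
  forall t, t \in ts ->
    match p t with
    | None => True
    | Some (inl j) => sg x j = Some (h t)
    | Some (inr true) => h t = pt x
    | Some (inr false) => dom (carrier x) (h t)
    end.

(** Only atoms whose terms are all placed have to hold; an atom joining two different copies is
    accounted for by an ABox edge instead. *)
Definition partial_match (x : pointed) (p : term -> place) : Prop :=
  exists2 h : term -> elt (carrier x), places_ok p h &
    forall u, u \in q -> (forall t, t \in atom_terms u -> p t <> None) -> sat_atom h u.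

Local Notation fact := (fact slots).

Definition holds (f : fact) (x : pointed) : Prop :=
  let I := carrier x in
  match f with
  | FCost c => tcost I = Fin c
  | FSlot j => sg x j <> None
  | FExt C j => exists2 e, sg x j = Some e & ext I C e
  | FRole r i j => exists e e', [/\ sg x i = Some e, sg x j = Some e' & Rint I r (e, e')]
  | FMatch p => partial_match x (place_of p)
  | LExt C => ext I C (pt x)
  | LSlot j => sg x j = Some (pt x)
  | LLoop r => Rint I r (pt x, pt x)
  | LFrom r j => exists2 e, sg x j = Some e & Rint I r (e, pt x)
  | LTo r j => exists2 e, sg x j = Some e & Rint I r (pt x, e)
  end.

(** These facts do not depend on the point; for [FMatch] this means that no term is sent to it.
    Copies that share their special elements have to agree on them. *)
Definition global (f : fact) : bool :=
  match f with
  | FCost _ | FSlot _ | FExt _ _ | FRole _ _ _ => true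
  | FMatch p => Some (inr true) \notin p
  | _ => false
  end.

(** Costs are listed only up to [k], and places only as tuples of length [nt]; this makes the list,
    hence the set of colours, finite. *)
Definition facts : seq fact :=
  [seq FCost c | c <- iota 0 k.+1] ++
  [seq FSlot j | j <- enum 'I_slots] ++
  [seq FExt C j | C <- cl, j <- enum 'I_slots] ++
  [seq FRole rj.1 rj.2 j | rj <- [seq (r, i) | r <- rr, i <- enum 'I_slots],
                           j <- enum 'I_slots] ++
  [seq FMatch (val p) | p <- enum {: nt.-tuple (option ('I_slots + bool))}] ++
  [seq LExt C | C <- cl] ++
  [seq LSlot j | j <- enum 'I_slots] ++
  [seq LLoop r | r <- rr] ++
  [seq LFrom r j | r <- rr, j <- enum 'I_slots] ++
  [seq LTo r j | r <- rr, j <- enum 'I_slots].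

Lemma mem_facts (f : fact) :
  match f with
  | FCost c => c <= k
  | FSlot _ | LSlot _ => true
  | FExt C _ | LExt C => C \in cl
  | FRole r _ _ | LLoop r | LFrom r _ | LTo r _ => r \in rr
  | FMatch p => size p == nt
  end -> f \in facts.
Proof.
have en j : j \in enum 'I_slots by rewrite mem_enum.
rewrite /facts !mem_cat; case: f => [c|j|C j|r i j|p|C|j|r|r j|r j] hf.
- by rewrite map_f // mem_iota.
- by rewrite map_f ?orbT.
- by rewrite allpairs_f ?orbT.
- have hi : (r, i) \in [seq (r, i) | r <- rr, i <- enum 'I_slots].
    exact: allpairs_f (fun r i => (r, i)) _ _ _ _ hf (en i).
  by rewrite (allpairs_f (fun rj j => FRole rj.1 rj.2 j) hi (en j)) ?orbT.
- suff -> : FMatch p \in [seq FMatch (val p) | p <- enum {: nt.-tuple (option ('I_slots + bool))}].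
    by rewrite !orbT.
  by apply/mapP; exists (Tuple hf); rewrite ?mem_enum.
- by rewrite (map_f LExt hf) ?orbT.
- by rewrite (map_f (@LSlot _) (en j)) ?orbT.
- by rewrite (map_f LLoop hf) ?orbT.
- by rewrite (allpairs_f (@LFrom _) hf (en j)) ?orbT.
- by rewrite (allpairs_f (@LTo _) hf (en j)) ?orbT.
Qed.

Definition colour : finType := (size facts).-tuple bool.

Definition colour_of (x : pointed) : colour :=
  map_tuple (fun f => `[< holds f x >]) (in_tuple facts).

Lemma colour_of_eq x y f :
  colour_of x = colour_of y -> f \in facts -> holds f x <-> holds f y.
Proof.
move=> E ff; have E' : [seq `[< holds f x >] | f <- facts] =
  [seq `[< holds f y >] | f <- facts] := congr1 val E.
have /= h := (eq_in_map _ _ _).2 E' f ff.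
by split=> [/asboolP|/asboolP] hf; apply/asboolP; [rewrite -h | rewrite h].
Qed.

Definition same_globals (x y : pointed) : Prop :=
  forall f, f \in facts -> global f -> holds f x <-> holds f y.

End Colours.

(** * Amalgams *)

Section Spreads.
Variables (T : wtbox) (q : bcq) (k : nat).
Local Notation ts := (bcq_terms q).
Local Notation nt := (size ts).
Local Notation nm := (relevant_inds T q).
Local Notation slot := 'I_(slots T q k).

(* Where a match sends a term in an amalgam: to a special element, or into one of
   finitely many copies, at its point if the flag is [true]. *)
Definition spread : Type := seq (option (slot + 'I_nt * bool)).

Definition project (b : 'I_nt) (x : option (slot + 'I_nt * bool)) : option (slot + bool) :=
  match x with
  | Some (inl j) => Some (inl j)
  | Some (inr bf) => if bf.1 == b then Some (inr bf.2) else None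
  | None => None
  end.

Definition piece (d : spread) (b : 'I_nt) : seq (option (slot + bool)) :=
  map (project b) d.

(** A piece that avoids the point is a global fact and can be checked in any copy; only a piece that
    hits the point has to be tied to an individual of the ABox. *)
Definition has_point (d : spread) (b : 'I_nt) : bool := Some (inr (b, true)) \in d.

Definition well_placed (A : Type) (d : seq (option (slot + A))) : Prop :=
  forall a, TInd a \in ts ->
    exists j : slot, place_of q d (TInd a) = Some (inl j) /\ val j = index a nm.

Definition valid_spread (d : spread) : Prop :=
  [/\ size d = nt, forall t, t \in ts -> place_of q d t <> None & well_placed d].

(** A role atom between ordinary elements of different copies can only come from an ABox edge, and
    such edges join points. *)
Definition cross_atoms (d : spread) (E : NR -> 'I_nt -> 'I_nt -> Prop) : Prop :=
  forall r t t' b b' (f f' : bool), QR r t t' \in q ->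
    place_of q d t = Some (inr (b, f)) -> place_of q d t' = Some (inr (b', f')) ->
    b != b' -> [/\ f, f' & E r b b'].

Lemma place_of_piece d b t : place_of q (piece d b) t = project b (place_of q d t).
Proof.
rewrite /place_of /piece; have [lt|ge] := ltnP (index t ts) (size d).
  by rewrite (nth_map None).
by rewrite !nth_default ?size_map.
Qed.

Lemma piece_global d b : has_point d b = false -> Some (inr true) \notin piece d b.
Proof.
move=> hb; apply: contraFN hb => /mapP[y yd]; rewrite /has_point.
case: y yd => [[j|[b' g]]|] //= yd; case: eqP => // bb [gt].
by rewrite -bb gt.
Qed.

Lemma mem_relevant_inds a : TInd a \in ts -> a \in nm.
Proof.
move=> h; rewrite mem_undup mem_cat; apply/orP; right; apply/flattenP.
by exists [:: a]; rewrite ?inE //; apply/mapP; exists (TInd a).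
Qed.

End Spreads.

Section Amalgam.
Variables (T : wtbox) (q : bcq) (k : nat).

Local Notation cl := (relevant_concepts T q).
Local Notation rr := (relevant_roles T q).
Local Notation nm := (relevant_inds T q).
Local Notation ts := (bcq_terms q).
Local Notation nt := (size ts).
Local Notation slot := 'I_(slots T q k).

(* What is required of an assignment [col] of pointed interpretations to the
   names: [names] are the names of the input, [kept] the assertions that are to
   be satisfied. *)
Record coherent (names : pred NI) (kept : set assertion) (col : NI -> pointed T q k) :
    Prop := Coherent {
  coh_good : forall a, good (col a);
  coh_globals : forall a b, same_globals (col a) (col b);
  coh_named : forall a (j : slot), a \in nm -> val j = index a nm ->
    sg (col a) j = Some (pt (col a));
  coh_inj : forall a b j, names a -> names b ->
    sg (col a) j = Some (pt (col a)) -> sg (col b) j = Some (pt (col b)) -> a = b;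
  coh_concept : forall A a, kept (Defs.AC A a) -> CAtom A \in cl ->
    holds (LExt (CAtom A)) (col a);
  coh_names : forall r a b, kept (AR r a b) -> names a /\ names b;
  coh_from : forall r a b j, kept (AR r a b) -> r \in rr ->
    sg (col a) j = Some (pt (col a)) -> holds (LFrom r j) (col b);
  coh_to : forall r a b j, kept (AR r a b) -> r \in rr ->
    sg (col b) j = Some (pt (col b)) -> holds (LTo r j) (col a);
  coh_loop : forall r a, kept (AR r a a) -> r \in rr -> holds (LLoop r) (col a);
  coh_ex : forall r a b C, kept (AR r a b) -> CEx r C \in cl ->
    holds (LExt C) (col b) -> holds (LExt (CEx r C)) (col a);
  coh_all : forall r a b C, kept (AR r a b) -> CAll r C \in cl ->
    holds (LExt (CAll r C)) (col a) -> holds (LExt C) (col b) }.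

Variables (names : pred NI) (kept : set assertion) (col : NI -> pointed T q k).
Hypothesis coh : coherent names kept col.
Hypothesis nm_names : {subset nm <= names}.

Local Notation I_ a := (carrier (col a)).

(* One copy of [col a] for every name [a], all sharing their special elements. *)
Let X : Type := (slot + {a : NI & elt (I_ a)})%type.

(** A copy contributes only its ordinary elements. Which slots are in use is a global fact, so copy
    0 decides it for all copies. *)
Definition inX (x : X) : Prop :=
  match x with
  | inl j => sg (col 0) j <> None
  | inr s => dom (I_ (tag s)) (tagged s) /\ forall j, sg (col (tag s)) j <> Some (tagged s)
  end.

(** What [x] looks like from copy [a]: a special element is visible in every copy, an ordinary one
    only in its own. *)
Definition view (a : NI) (x : X) (e : elt (I_ a)) : Prop :=
  match x with
  | inl j => sg (col a) j = Some e
  | inr s => s = existT _ a e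
  end.

Definition roleX (r : NR) (x y : X) : Prop :=
  (exists a e e', [/\ view x e, view y e' & Rint (I_ a) r (e, e')]) \/
  (exists a b, [/\ kept (AR r a b), x = inr (existT _ a (pt (col a))) &
                   y = inr (existT _ b (pt (col b)))]).

Lemma view_tagged a s (e : elt (I_ a)) : view (inr s) e -> tag s = a.
Proof. by move=> /= ->. Qed.

Lemma view_point a s (e : elt (I_ a)) :
  view (inr s) e -> tagged s = pt (col (tag s)) -> e = pt (col a).
Proof. by move=> /= ->. Qed.

Lemma view_fun a x (e e' : elt (I_ a)) : view x e -> view x e' -> e = e'.
Proof.
case: x => [j|s] /=; first by move=> -> [].
by move=> ->; apply: (@eq_from_Tagged _ (fun a => elt (I_ a))).
Qed.

Definition seen (a : NI) (x : X) : elt (I_ a) :=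
  if pselect (exists e, @view a x e) is left h then projT1 (cid h) else pt (col a).

Lemma seenP a x (e : elt (I_ a)) : view x e -> seen a x = e.
Proof.
move=> ve; rewrite /seen; case: pselect => [h|[]]; last by exists e.
by case: cid => e' /= /view_fun; apply.
Qed.

Lemma view_special a j : inX (inl j) -> exists e, @view a (inl j) e.
Proof.
move=> /= jX; have /(coh_globals coh 0 a (f := FSlot j)) : FSlot j \in facts T q k.
  exact: mem_facts.
by move=> /(_ isT) [/(_ jX)] /=; case: (sg (col a) j) => // e _ _; exists e.
Qed.

Lemma view_exists x : inX x -> exists a e, @view a x e.
Proof.
case: x => [j|[a e]] hx; last by exists a, e.
by exists 0; apply: view_special.
Qed.

Lemma view_dom a x (e : elt (I_ a)) : inX x -> view x e -> dom (I_ a) e.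
Proof.
case: x => [j|s] /=; first by move=> _; apply: good_dom (coh_good coh a) _ _.
by move=> [+ _] Es; rewrite Es.
Qed.

Lemma special_inX a j : sg (col a) j <> None -> inX (inl j).
Proof.
move=> /= jX; have /(coh_globals coh a 0 (f := FSlot j)) : FSlot j \in facts T q k.
  exact: mem_facts.
by move=> /(_ isT) [/(_ jX)].
Qed.

Lemma view_lift a (e : elt (I_ a)) : dom (I_ a) e -> exists2 x, inX x & view x e.
Proof.
move=> ea; have [[j je]|nj] := pselect (exists j, sg (col a) j = Some e).
  by exists (inl j) => //; apply: (@special_inX a); rewrite je.
by exists (inr (existT _ a e)) => //; split=> //= j je; apply: nj; exists j.
Qed.

(** An element visible in two copies is special unless the copies coincide, and relevant concepts at
    special elements are global facts. *)
Lemma ext_transfer C a b x (e : elt (I_ a)) (e' : elt (I_ b)) :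
  C \in cl -> view x e -> view x e' -> ext (I_ a) C e -> ext (I_ b) C e'.
Proof.
move=> Ccl; case: x => [j|s] /= ve ve' h; last first.
  have ab : a = b by rewrite -(view_tagged (ve : view (inr s) e)) (view_tagged (ve' : view (inr s) e')).
  by subst b; rewrite -(view_fun (ve : view (inr s) e) ve').
have /(coh_globals coh a b (f := FExt C j)) : FExt C j \in facts T q k by exact: mem_facts.
by move=> /(_ isT) [/(_ (ex_intro2 _ _ e ve h))] /= [e2]; rewrite ve' => -[<-].
Qed.

Lemma named_slot a : a \in nm -> exists j : slot, val j = index a nm.
Proof.
move=> an; have lt : index a nm < slots T q k.
  by rewrite /slots -addnA ltn_addr // index_mem.
by exists (Ordinal lt).
Qed.

Definition special (a : NI) : option slot :=
  [pick j | `[< sg (col a) j = Some (pt (col a)) >]].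

Definition locate (a : NI) : X :=
  if special a is Some j then inl j else inr (existT _ a (pt (col a))).

Lemma specialP a j : special a = Some j -> sg (col a) j = Some (pt (col a)).
Proof. by rewrite /special; case: pickP => // i /asboolP h [<-]. Qed.

Lemma specialN a j : special a = None -> sg (col a) j <> Some (pt (col a)).
Proof. by rewrite /special; case: pickP => // /(_ j) /asboolP. Qed.

Lemma locate_inX a : inX (locate a).
Proof.
rewrite /locate; case E: special => [j|].
  by apply: (@special_inX a); rewrite (specialP E).
split; first exact: good_pt (coh_good coh a).
by move=> j; apply: specialN.
Qed.

Lemma locate_view a : view (locate a) (pt (col a)).
Proof. by rewrite /locate; case E: special => [j|] //=; apply: specialP. Qed.

Lemma locate_inj a b : names a -> names b -> locate a = locate b -> a = b.
Proof.
rewrite /locate => na nb; case Ea: special => [i|]; case Eb: special => [j|] //.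
  by move=> [ij]; subst i; apply: (coh_inj coh na nb (specialP Ea) (specialP Eb)).
by move=> [].
Qed.

Lemma locate_named a (j : slot) : a \in nm -> val j = index a nm -> locate a = inl j.
Proof.
move=> an ja; have Ej := coh_named coh an ja.
rewrite /locate; case E: special => [i|]; last by have := specialN E Ej.
by congr inl; apply: good_inj (coh_good coh a) _ _ _ (specialP E) Ej.
Qed.

Definition place_in (z : NI + X) : X := match z with inl a => locate a | inr x => x end.

(** The standard names assumption requires the name [a] itself as an element, so the located points
    of names are replaced by these names and the rest of [X] is kept anonymous. [place_in]
    identifies this domain with the elements satisfying [inX]. *)
Definition amalgam_dom : set (NI + X) :=
  [set z | match z with
           | inl a => names a
           | inr x => inX x /\ forall a, names a -> locate a <> x
           end].

Lemma amalgam_dom_inX z : amalgam_dom z -> inX (place_in z).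
Proof. by case: z => [a _|x []] //=; apply: locate_inX. Qed.

Lemma amalgam_dom_onto x : inX x -> exists2 z, amalgam_dom z & place_in z = x.
Proof.
move=> hx; have [[a na <-]|H] := pselect (exists2 a, names a & locate a = x).
  by exists (inl a).
by exists (inr x) => //; split=> // a na E; apply: H; exists a.
Qed.

Lemma amalgam_dom_inj z z' : amalgam_dom z -> amalgam_dom z' -> place_in z = place_in z' -> z = z'.
Proof.
case: z z' => [a|x] [b|y] //=.
- by move=> na nb /(locate_inj na nb) ->.
- by move=> na [_ H] E; case: (H a na).
- by move=> [_ H] nb E; case: (H b nb).
- by move=> _ _ ->.
Qed.

Lemma amalgam_nonempty : amalgam_dom !=set0.
Proof. by have [z hz _] := amalgam_dom_onto (locate_inX 0); exists z. Qed.

(** Symbols foreign to the TBox and the query hold everywhere, so that every assertion using them is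
    satisfied for free. *)
Definition amalgam_C (A : NC) : set (NI + X) :=
  [set z | amalgam_dom z /\ (CAtom A \in cl ->
    exists a e, @view a (place_in z) e /\ Cint (I_ a) A e)].

Lemma amalgam_C_sub A : amalgam_C A `<=` amalgam_dom.
Proof. by move=> z []. Qed.

Definition amalgam_R (r : NR) : set ((NI + X) * (NI + X)) :=
  [set z | [/\ amalgam_dom z.1, amalgam_dom z.2 &
    r \in rr -> roleX r (place_in z.1) (place_in z.2)]].

Lemma amalgam_R_sub r : amalgam_R r `<=` amalgam_dom `*` amalgam_dom.
Proof. by move=> z []. Qed.

Definition amalgam : interp :=
  {| other := X; dom := amalgam_dom; dom_nonempty := amalgam_nonempty;
     Cint := amalgam_C; Cint_sub := amalgam_C_sub;
     Rint := amalgam_R; Rint_sub := amalgam_R_sub |}.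

(** Edges of the amalgam either lie within one copy, where the induction hypothesis and
    [ext_transfer] apply, or come from the ABox. [coh_ex] and [coh_all] say that the latter change
    no quantified relevant concept at the points they join. *)
Lemma ext_amalgam C : C \in cl -> forall z, amalgam_dom z ->
  forall a (e : elt (I_ a)), view (place_in z) e -> ext amalgam C z <-> ext (I_ a) C e.
Proof.
have sub (D : concept) E : D \in cl -> E \in subconcepts D -> E \in cl by exact: cl_closed.
elim: C => [A|b|||C IHC D IHD|C IHC D IHD|C IHC|r C IHC|r C IHC] Ccl z hz a e ve.
- split=> [[_ /(_ Ccl)] [b [e' [ve' h]]]|h].
    exact: (@ext_transfer (CAtom A) b a _ e' e Ccl ve' ve h).
  by split=> // _; exists a, e.
- have bn := cl_nominal Ccl; have [j jb] := named_slot bn.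
  have Ej x : sg (col x) j = Some (inl b).
    have lt : j < size nm by rewrite -index_mem in bn; rewrite [nat_of_ord j]jb.
    by rewrite (good_named (coh_good coh x) lt) [nat_of_ord j]jb nth_index.
  have Lb := locate_named bn jb.
  have de : dom (I_ a) e by apply: view_dom ve; apply: amalgam_dom_inX.
  split=> /= -[_ E]; split=> //=.
    by move: ve; rewrite E /= Lb /= Ej => -[].
  apply: amalgam_dom_inj => //=; first exact: nm_names.
  rewrite Lb; move: ve (amalgam_dom_inX hz); rewrite E.
  case: (place_in z) => [i|s] /= ve; last by move=> [_ /(_ j)]; rewrite ve /= Ej.
  by move=> _; congr inl; apply: good_inj (coh_good coh a) _ _ _ ve (Ej a).
- by split=> // _; apply: view_dom ve; apply: amalgam_dom_inX.
- by [].
- have [hC hD] : C \in cl /\ D \in cl.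
    by split; apply: (sub _ _ Ccl); rewrite /= in_cons mem_cat subconcepts_refl ?orbT.
  by have := IHC hC z hz a e ve; have := IHD hD z hz a e ve; rewrite /= /setI /=; tauto.
- have [hC hD] : C \in cl /\ D \in cl.
    by split; apply: (sub _ _ Ccl); rewrite /= in_cons mem_cat subconcepts_refl ?orbT.
  by have := IHC hC z hz a e ve; have := IHD hD z hz a e ve; rewrite /= /setU /=; tauto.
- have hC : C \in cl by apply: (sub _ _ Ccl); rewrite /= in_cons subconcepts_refl orbT.
  have de : dom (I_ a) e by apply: view_dom ve; apply: amalgam_dom_inX.
  by have := IHC hC z hz a e ve; rewrite /= /setD /=; tauto.
- have hC : C \in cl by apply: (sub _ _ Ccl); rewrite /= in_cons subconcepts_refl orbT.
  have de : dom (I_ a) e by apply: view_dom ve; apply: amalgam_dom_inX.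
  split=> [/= [_ [z' [[_ hz' /(_ (rr_ex Ccl)) rX] hC']]]|/= [_ [e' [re hC']]]].
    case: rX => [[b [e1 [e2 [v1 v2 r12]]]]|[a1 [b1 [kr E1 E2]]]].
      have h2 := (IHC hC z' hz' b e2 v2).1 hC'.
      apply: (@ext_transfer (CEx r C) b a _ e1 e Ccl v1 ve) => /=; split; last by exists e2.
      by apply: view_dom v1; apply: amalgam_dom_inX.
    have v2 : view (place_in z') (pt (col b1)) by rewrite E2.
    have h2 := (IHC hC z' hz' b1 _ v2).1 hC'.
    apply: (@ext_transfer (CEx r C) a1 a _ (pt (col a1)) e Ccl _ ve); first by rewrite E1.
    exact: (coh_ex coh kr Ccl h2).
  have [_ de'] := Rint_sub re.
  have [x hx vx] := view_lift de'; have [z' hz' Ez'] := amalgam_dom_onto hx.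
  split=> //; exists z'; split; last by apply/(IHC hC z' hz' a e'); rewrite ?Ez'.
  by split=> // _; left; exists a, e, e'; rewrite Ez'.
- have hC : C \in cl by apply: (sub _ _ Ccl); rewrite /= in_cons subconcepts_refl orbT.
  have de : dom (I_ a) e by apply: view_dom ve; apply: amalgam_dom_inX.
  split=> [/= [_ H]|H].
    split=> // e' re; have [_ de'] := Rint_sub re.
    have [x hx vx] := view_lift de'; have [z' hz' Ez'] := amalgam_dom_onto hx.
    rewrite -Ez' in vx; apply/(IHC hC z' hz' a e' vx); apply: H.
    by split=> // _; left; exists a, e, e'.
  split=> //= z' [_ hz' /(_ (rr_all Ccl)) rX].
  case: rX => [[b [e1 [e2 [v1 v2 r12]]]]|[a1 [b1 [kr E1 E2]]]].
    apply/(IHC hC z' hz' b e2 v2).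
    have [_ h] := @ext_transfer (CAll r C) a b _ e e1 Ccl ve v1 H.
    exact: h.
  have v1 : view (place_in z) (pt (col a1)) by rewrite E1.
  have v2 : view (place_in z') (pt (col b1)) by rewrite E2.
  apply/(IHC hC z' hz' b1 _ v2); apply: (coh_all coh kr Ccl).
  exact: (@ext_transfer (CAll r C) a a1 _ e _ Ccl ve v1 H).
Qed.

Lemma vio_amalgam p z a (e : elt (I_ a)) :
  p \in T -> amalgam_dom z -> view (place_in z) e ->
  vio amalgam p.1 z <-> vio (I_ a) p.1 e.
Proof.
case E: p.1 => [B C] pT hz ve; have [hB hC] := cl_tbox q pT E.
have de : dom (I_ a) e by apply: view_dom ve; apply: amalgam_dom_inX.
have := ext_amalgam hB hz ve; have := ext_amalgam hC hz ve.
by rewrite /vio /= /setI /setD /=; tauto.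
Qed.

(** A violator is special in whatever copy shows it, hence visible in copy 0; passing to copy 0 is
    therefore a bijection between the violators. *)
Lemma vio_amalgam_card p : p \in T -> vio amalgam p.1 #= vio (I_ 0) p.1.
Proof.
move=> pT; pose f (z : elt amalgam) : elt (I_ 0) :=
  seen 0 (place_in z).
have vio_dom z : vio amalgam p.1 z -> amalgam_dom z.
  by case: (p.1) => B C [/ext_dom].
have key z : vio amalgam p.1 z -> exists j, place_in z = inl j.
  move=> vz; have hz := vio_dom z vz; have hX := amalgam_dom_inX hz.
  have [a [e ve]] := view_exists hX.
  have [j ej] := good_vio (coh_good coh a) pT ((vio_amalgam pT hz ve).1 vz).
  case E: (place_in z) hX ve => [i|s] /=; first by exists i.
  by move=> [_ H] Es; case: (H j); rewrite Es.
have fv z : vio amalgam p.1 z -> view (place_in z) (f z).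
  move=> vz; have [j Ej] := key z vz; have hX := amalgam_dom_inX (vio_dom z vz).
  by rewrite /f; rewrite Ej in hX *; have [e he] := view_special 0 hX; rewrite (seenP he).
have fi : {in vio amalgam p.1 &, injective f}.
  move=> z z' /set_mem vz /set_mem vz' E; apply: amalgam_dom_inj; [exact: vio_dom.. |].
  have := fv z vz; have := fv z' vz'.
  have [j ->] := key z vz; have [j' ->] := key z' vz'; rewrite E /= => h' h.
  by congr inl; apply: good_inj (coh_good coh 0) _ _ _ h h'.
suff <- : f @` vio amalgam p.1 = vio (I_ 0) p.1 by rewrite card_eq_sym; apply: inj_card_eq.
apply/seteqP; split=> [_ [z vz <-]|e ve].
  by apply/(vio_amalgam pT (vio_dom z vz) (fv z vz)).
have de : dom (I_ 0) e by move: ve; case: (p.1) => B C [/ext_dom].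
have [x hx vx] := view_lift de; have [z hz Ez] := amalgam_dom_onto hx.
rewrite -Ez in vx; have vz : vio amalgam p.1 z by apply/(vio_amalgam pT hz vx).
by exists z => //; apply: view_fun (fv z vz) vx.
Qed.

Lemma tcost_amalgam : tcost T amalgam = tcost T (I_ 0).
Proof.
rewrite /tcost big_seq [RHS]big_seq; apply: eq_bigr => p pT.
by rewrite (ecard_card_eq (vio_amalgam_card pT)).
Qed.

Lemma amalgam_concept A a : names a -> kept (Defs.AC A a) -> sat_assertion amalgam (Defs.AC A a).
Proof.
move=> na ka; split=> //= Acl; exists a, (pt (col a)); split; first exact: locate_view.
exact: (coh_concept coh ka Acl).
Qed.

(** The ABox clause of [roleX] joins ordinary points only. If an end is special, the edge must
    already be present in the copy of the other end, as [coh_from] and [coh_to] provide. *)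
Lemma amalgam_role r a b : kept (AR r a b) -> sat_assertion amalgam (AR r a b).
Proof.
move=> kr; have [na nb] := coh_names coh kr; split=> //= rrr.
rewrite /locate; case Ea: (special a) => [i|]; first last.
  case Eb: (special b) => [j|]; last by right; exists a, b.
  have [e ej re] := coh_to coh kr rrr (specialP Eb).
  by left; exists a, (pt (col a)), e.
have [e ei re] := coh_from coh kr rrr (specialP Ea).
left; exists b, e, (pt (col b)); split=> //.
by case Eb: (special b) => [j|] //=; apply: specialP.
Qed.

Lemma amalgam_match p :
  (forall t, t \in ts -> exists j, place_of q p t = Some (inl j)) ->
  well_placed p -> holds (FMatch p) (col 0) -> sat_bcq amalgam q.
Proof.
move=> spec wp [h0 ok sat0].
have /choice [h hP] : forall t, exists z : elt amalgam,
    (t \in ts -> amalgam_dom z /\ view (place_in z) (h0 t)) /\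
    (forall a, t = TInd a -> z = inl a).
  move=> t; have [tts|tN] := boolP (t \in ts); last first.
    exists (if t is TInd a then inl a else inl 0); by split=> // a ->.
  have [j pj] := spec t tts; have := ok t tts; rewrite pj => /= sj.
  have jX : inX (inl j) by apply: (@special_inX 0); rewrite sj.
  case: t tts pj sj => [x|a] tts pj sj.
    by have [z hz Ez] := amalgam_dom_onto jX; exists z; split=> // _; rewrite Ez.
  have an := mem_relevant_inds T tts; exists (inl a); split=> [_|b [->] //].
  split; first exact: nm_names.
  have [i [pi ia]] := wp a tts; move: pi; rewrite pj => -[ij]; subst i.
  by rewrite /= (locate_named an ia).
exists h; split=> [a|t tts|u uq]; first by have [_] := hP (TInd a); apply.
  by have [/(_ tts) []] := hP t.
have loc t : t \in atom_terms u -> amalgam_dom (h t) /\ view (place_in (h t)) (h0 t).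
  by move=> tu; have [H _] := hP t; apply/H/(atom_term uq tu).
have := sat0 u uq _; case: u uq loc => [A t|r t t'] uq loc sat.
  have [|hz v] := loc t; first by rewrite inE.
  split=> // _; exists 0, (h0 t); split=> //; apply: sat => t0.
  by rewrite inE => /eqP ->; have [|j ->] := spec t; first by apply: (atom_term uq); rewrite inE.
have [|hz v] := loc t; first by rewrite inE eqxx.
have [|hz' v'] := loc t'; first by rewrite !inE eqxx orbT.
split=> //= _; left; exists 0, (h0 t), (h0 t'); split=> //; apply: sat => t0 t0u.
by have [|j ->] := spec t0; first exact: (atom_term uq).
Qed.

(** The terms of a match are grouped by the copy that contains them, and each group is read as a
    piece in its copy. At most [nt] copies are met, so ['I_nt] can index the groups. *)
Lemma amalgam_spread (inds : pred NI) :
  (forall r a b, kept (AR r a b) -> inds a /\ inds b) -> sat_bcq amalgam q ->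
  exists (d : spread T q k) (f : 'I_nt -> NI), [/\ valid_spread d,
    forall b, if has_point d b then inds (f b) /\ holds (FMatch (piece d b)) (col (f b))
              else holds (FMatch (piece d b)) (col 0) &
    cross_atoms d (fun r b b' => kept (AR r (f b) (f b')))].
Proof.
move=> kinds [h [hind hdom hsat]].
pose x t : X := place_in (h t).
pose copy (y : X) : option NI := if y is inr s then Some (tag s) else None.
(* A copy is numbered by the first term that falls into it. *)
pose block a : option 'I_nt := insub (find (fun t => copy (x t) == Some a) ts).
(* Points are flagged only for names in [inds]. Copies of other names may count as not hit at their
   point, since an unflagged place can be any element of the domain and kept edges join names in
   [inds]. *)
pose at_pt (s : {a : NI & elt (I_ a)}) : bool :=
  `[< tagged s = pt (col (tag s)) >] && inds (tag s).
pose go t : option (slot + 'I_nt * bool) :=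
  match x t with
  | inl j => Some (inl j)
  | inr s => omap (fun b => inr (b, at_pt s)) (block (tag s))
  end.
pose d : spread T q k := map go ts.
pose f (b : 'I_nt) : NI := odflt 0 (copy (x (nth (TVar 0) ts b))).
have dE t : t \in ts -> place_of q d t = go t.
  move=> tts; rewrite /place_of /d (nth_map (TVar 0)) ?index_mem //.
  by rewrite nth_index.
have xX t : t \in ts -> inX (x t) by move=> tts; apply/amalgam_dom_inX/hdom.
have blockP a t : t \in ts -> copy (x t) = Some a ->
    exists2 b, block a = Some b & f b = a.
  move=> tts ct; have hs : has (fun t => copy (x t) == Some a) ts.
    by apply/hasP; exists t => //; apply/eqP.
  have lt := hs; rewrite has_find in lt; exists (Ordinal lt).
    by rewrite /block insubT.
  by rewrite /f /= (eqP (nth_find (TVar 0) hs)).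
have key b t : t \in ts -> project b (go t) <> None ->
    view (x t) (seen (f b) (x t)).
  move=> tts; have xt := xX t tts; rewrite /go.
  case E: (x t) xt => [j|s] xt.
    by move=> _; have [e he] := view_special (f b) xt; rewrite (seenP he).
  have [b' -> fb'] : exists2 b', block (tag s) = Some b' & f b' = tag s.
    by apply: (blockP _ t) => //; rewrite E.
  rewrite /=; case: eqP => // bb _; subst b'.
  have v : @view (f b) (inr s) (eq_rect _ (fun a => elt (I_ a)) (tagged s) _ (esym fb')).
    by case: s {E xt} fb' => a e /= fb'; case: _ / (esym fb').
  by rewrite (seenP v).
have pieceP b : holds (FMatch (piece d b)) (col (f b)).
  exists (fun t => seen (f b) (x t)) => [t tts|u uq].
    rewrite place_of_piece dE //; have := key b t tts; rewrite /go.
    case E: (x t) => [j|s]; first by move=> /(_ ltac:(by [])).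
    have [b' -> fb'] : exists2 b', block (tag s) = Some b' & f b' = tag s.
      by apply: (blockP _ t) => //; rewrite E.
    rewrite /=; case: eqP => // bb; subst b' => /(_ ltac:(by [])) v.
    case A: (at_pt s).
      by move: A => /andP[/asboolP A _]; apply: view_point v A.
    have sX : inX (inr s) by rewrite -E; apply: xX.
    exact: view_dom sX v.
  move=> loc; have {}loc t : t \in atom_terms u -> [/\ inX (x t), amalgam_dom (h t) & view (x t) (seen (f b) (x t))].
    move=> tu; have tts := atom_term uq tu.
    split; [exact: xX | exact: hdom |].
    by apply: key => //; have := loc t tu; rewrite place_of_piece dE.
  case: u uq loc (hsat u uq) => [A t|r t t'] uq loc.
    have Acl := cl_query T uq.
    have [|tX _ v] := loc t; first by rewrite inE.
    move=> [_ /(_ Acl) [a [e [ve Ae]]]].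
    exact: (@ext_transfer (CAtom A) a (f b) _ e _ Acl ve v Ae).
  have rrr := rr_query T uq.
  have [|tX _ v] := loc t; first by rewrite inE eqxx.
  have [|tX' _ v'] := loc t'; first by rewrite !inE eqxx orbT.
  move=> [_ _ /(_ rrr) rX]; change (Rint (I_ (f b)) r (seen (f b) (x t), seen (f b) (x t'))).
  case: rX => [[a [e [e' [ve ve' re]]]]|[a [a' [ka Et Et']]]].
    have {}ve : view (x t) e := ve; have {}ve' : view (x t') e' := ve'.
    have same a0 : a = a0 -> forall w w', view (x t) w -> view (x t') w' ->
        Rint (I_ a0) r (w, w').
      move=> <- w w' vw vw'.
      by rewrite (view_fun vw ve) (view_fun vw' ve').
    case Et: (x t) ve v => [i|s] ve v; last first.
      apply: (same (f b)); [|by rewrite Et|by []].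
      by rewrite -(view_tagged ve) -(view_tagged v).
    case Et': (x t') ve' v' => [j|s] ve' v'; last first.
      apply: (same (f b)); [|by rewrite Et|by rewrite Et'].
      by rewrite -(view_tagged ve') -(view_tagged v').
    have /(coh_globals coh a (f b) (f := FRole r i j)) : FRole r i j \in facts T q k.
      exact: mem_facts.
    move=> /(_ isT) [+ _] => /(_ (ex_intro _ e (ex_intro _ e' (And3 ve ve' re)))).
    move=> [w [w' [vw vw' rw]]].
    by rewrite (view_fun v vw) (view_fun v' vw').
  (* Both ends of this ABox edge lie in the copy of one name, so the edge is a loop at its point. *)
  rewrite -/(x t) -/(x t') in Et Et'; rewrite Et Et' in v v' *.
  have fa := view_tagged v; have fa' := view_tagged v'; rewrite /= in fa fa'.
  subst a a'; rewrite (seenP (e := pt (col (f b)))) //.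
  exact: (coh_loop coh ka rrr).
exists d, f; split.
- split; first by rewrite size_map.
    move=> t tts; rewrite dE // /go; case E: (x t) => [j|s] //.
    have [b -> _] : exists2 b, block (tag s) = Some b & f b = tag s.
      by apply: (blockP _ t) => //; rewrite E.
    by [].
  move=> a ats; have an := mem_relevant_inds T ats.
  have [j ja] := named_slot an; exists j; split=> //.
  by rewrite dE // /go /x hind /= (locate_named an ja).
- move=> b; case: ifP => [/mapP[t tts go_t]|hb].
    split; last exact: pieceP.
    move: go_t; rewrite /go; case E: (x t) => [j|s] // go_t.
    have [b' Eb fb'] : exists2 b', block (tag s) = Some b' & f b' = tag s.
      by apply: (blockP _ t) => //; rewrite E.
    by move: go_t; rewrite Eb /= => -[bb' /esym/andP[_ H]]; rewrite bb' fb'.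
  have mf : FMatch (piece d b) \in facts T q k by apply: mem_facts; rewrite !size_map.
  exact: (coh_globals coh (f b) 0 mf (piece_global hb)).1.
- move=> r t t' b b' g g' rq.
  have tts : t \in ts by apply: (atom_term rq); rewrite inE eqxx.
  have tts' : t' \in ts by apply: (atom_term rq); rewrite !inE eqxx orbT.
  rewrite !dE // /go => go_t go_t' bb.
  have [_ _ /(_ (rr_query T rq))] := hsat _ rq.
  rewrite -/(x t) -/(x t') => rX.
  case Et: (x t) go_t rX => [//|s]; have [b1 Eb1 fb1] : exists2 b', block (tag s) = Some b' & f b' = tag s.
    by apply: (blockP _ t) => //; rewrite Et.
  rewrite Eb1 => -[Eb Eg]; case Et': (x t') go_t' => [//|s'].
  have [b2 Eb2 fb2] : exists2 b', block (tag s') = Some b' & f b' = tag s'.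
    by apply: (blockP _ t') => //; rewrite Et'.
  rewrite Eb2 /= => -[Eb' Eg'] [[a [e [e' [ve ve' _]]]]|[a [a' [ka [Es] [Es']]]]].
    have ss : tag s = tag s' by rewrite (view_tagged ve) (view_tagged ve').
    case/negP: bb; rewrite -Eb -Eb'; apply/eqP.
    by move: Eb1; rewrite ss Eb2 => -[].
  have [ia ia'] := kinds _ _ _ ka.
  subst s s'; rewrite /= in fb1 fb2.
  by rewrite -Eb -Eb' -Eg -Eg' fb1 fb2 /at_pt /= ia ia' !andbT; split=> //; apply/asboolP.
Qed.

End Amalgam.

(** * Certificates *)

Definition enat_val (x : enat) : nat := if x is Fin n then n else 0.

Lemma emul_fin m n : emul (Fin m) (Fin n) = Fin (m * n).
Proof. by case: m. Qed.

Lemma big_eadd_sum (A : Type) (s : seq A) (P : pred A) (F : A -> enat) (G : A -> nat) :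
  all (fun p => P p ==> (F p == Fin (G p))) s ->
  \big[eadd/Fin 0]_(p <- s | P p) F p = Fin (\sum_(p <- s | P p) G p).
Proof.
elim: s => [|p s IH] /=; first by rewrite !big_nil.
by rewrite !big_cons; case: (P p) => /andP[+ /IH ->] //= => /eqP ->.
Qed.

Lemma big_eadd_fin (A : Type) (s : seq A) (P : pred A) (F : A -> enat) n :
  \big[eadd/Fin 0]_(p <- s | P p) F p = Fin n ->
  all (fun p => P p ==> (F p == Fin (enat_val (F p)))) s /\
  n = \sum_(p <- s | P p) enat_val (F p).
Proof.
elim: s n => [|p s IH] n; first by rewrite !big_nil => -[<-].
rewrite !big_cons /=; case: ifP => _ /=; last exact: IH.
case: (F p) => // m; rewrite eqxx; case: (\big[_/_]_(_ <- _ | _) _) IH => // l IH [<-].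
by have [-> <-] := IH l erefl.
Qed.

Lemma ecard_list (U : Type) (A : set U) n :
  ecard A = Fin n -> exists2 l : seq U, size l = n & forall e, A e -> exists i, onth l i = Some e.
Proof.
rewrite /ecard; case: pselect => // fA [<-]; case: cid => m /= {fA}.
elim: m A => [|m IH] A.
  by rewrite II0 card_eq0 => /eqP ->; exists [::].
move=> /eq_cardSP[x Ax /IH [l <- lP]]; exists (x :: l) => // e Ae.
have [->|ex] := pselect (e = x); first by exists 0.
by have [|i Ei] := lP e; [split | exists i.+1].
Qed.

Section Certificates.
Variables (T : wtbox) (q : bcq) (k : nat).

Local Notation cl := (relevant_concepts T q).
Local Notation rr := (relevant_roles T q).
Local Notation nm := (relevant_inds T q).
Local Notation ts := (bcq_terms q).
Local Notation nt := (size ts).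
Local Notation slot := 'I_(slots T q k).
Local Notation pointed := (pointed T q k).
Local Notation colour := (colour T q k).

(** Names must keep their positions while violators and match elements are appended. One element can
    play several of these parts, so repetitions are skipped to keep the slots injective. *)
Lemma enumerate (U : Type) (nmd : seq U) (extra : seq U) :
  (forall i j e, onth nmd i = Some e -> onth nmd j = Some e -> i = j) ->
  exists2 S : seq U, size S <= size nmd + size extra &
    [/\ forall i, i < size nmd -> onth S i = onth nmd i,
        forall i j e, onth S i = Some e -> onth S j = Some e -> i = j &
        forall e i, onth extra i = Some e -> exists j, onth S j = Some e].
Proof.
elim: extra nmd => [|e0 l IH] nmd inj.
  by exists nmd; rewrite ?addn0 //; split=> // e [].
have [[i Ei]|Ne] := pselect (exists i, onth nmd i = Some e0).
  have [S sz [pre Sinj ex]] := IH nmd inj.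
  exists S; first by apply: leq_trans sz _; rewrite leq_add2l /=.
  split=> // e [[<-]|j /ex //]; exists i.
  by rewrite pre // -onthTE Ei.
have inj' i j e : onth (rcons nmd e0) i = Some e -> onth (rcons nmd e0) j = Some e -> i = j.
  rewrite -cats1 !onth_cat.
  case: ltnP => li; case: ltnP => lj.
  - exact: inj.
  - by move=> Ei /onth1P[_ E0]; case: Ne; exists i; rewrite E0.
  - by move=> /onth1P[_ E0] Ej; case: Ne; exists j; rewrite E0.
  - by move=> /onth1P[+ _] /onth1P[+ _]; lia.
have [S sz [pre Sinj ex]] := IH _ inj'.
rewrite size_rcons addSnnS in sz; exists S => //; split=> //.
  move=> i lt; rewrite pre; last by rewrite size_rcons ltnW.
  by rewrite -cats1 onth_cat lt.
move=> e [[<-]|j /ex //]; exists (size nmd).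
by rewrite pre ?size_rcons // -cats1 onth_cat ltnn subnn.
Qed.

Hypothesis wT : weighting T.

(** A finite positive weight charges at least one for each violator, and an infinite weight
    tolerates none. *)
Lemma violators I c :
  tcost T I = Fin c ->
  exists2 l, size l <= c & forall p e, p \in T -> vio I p.1 e -> exists i, onth l i = Some e.
Proof.
have : all (fun p => epos p.2) T by case/andP: wT.
rewrite /tcost; elim: (T) c => [|p T' IH] c /=; first by move=> _ _; exists [::].
move=> /andP[pp pT]; rewrite big_cons.
case E: (emul _ _) => [m|] //; case F: (\big[_/_]_(_ <- _) _) => [n|] //= [<-].
have [l ln lP] := IH n pT F.
have [l' lm l'P] : exists2 l', size l' <= m & forall e, vio I p.1 e -> exists i, onth l' i = Some e.
  case G: (ecard (vio I p.1)) E => [d|].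
    have [l' <- l'P] := ecard_list G.
    case: (p.2) pp => [w|] wp; last first.
      by case: l' l'P {G} => [|y l'] l'P //= _; exists [::].
    rewrite emul_fin => -[<-]; exists l' => //.
    by rewrite leq_pmull // lt0n; apply: contra wp => /eqP ->.
  by move: pp; rewrite /epos; case: (p.2) => [[|w]|] //; rewrite eqxx.
exists (l' ++ l); first by rewrite size_cat leq_add.
move=> p' e; rewrite inE => /orP[/eqP->|p'T] ve.
  have [i Ei] := l'P e ve; exists i; rewrite onth_cat -onthTE Ei //.
have [i Ei] := lP p' e p'T ve; exists (size l' + i).
by rewrite onth_cat ltnNge leq_addr addKn.
Qed.

(** If no term of a piece is sent to the point, the same map witnesses the piece for every other
    point. *)
Lemma same_globals_pt I sg x y :
  same_globals (@PointedInterp T q k I sg x) (@PointedInterp T q k I sg y).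
Proof.
have half x' y' f : global f -> holds f (@PointedInterp T q k I sg x') -> holds f (@PointedInterp T q k I sg y').
  case: f => //= p np [h ok sat]; exists h => // t tts.
  have := ok t tts; case E: (place_of q p t) => [[j|[]]|] //= _.
  have : Some (inr true) \in p; last by rewrite (negPf np).
  by rewrite -E mem_nth // ltnNge; apply/negP => le; move: E; rewrite /place_of nth_default.
by move=> f ff gf; split; apply: half.
Qed.

Section Entries.
Variables (s : wabox).

Definition entry0 : assertion * enat := (Defs.AC 0 0, Fin 1).
Definition fact_at (i : nat) : assertion := (nth entry0 s i).1.
Definition weight_at (i : nat) : enat := (nth entry0 s i).2.

Definition argument (f : assertion) (b : bool) : option NI :=
  match f, b with
  | Defs.AC _ a, false => Some a
  | Defs.AC _ _, true => None
  | AR _ a _, false => Some a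
  | AR _ _ b, true => Some b
  end.

(** An occurrence is an entry with an argument position. Hues belong to occurrences because a
    certificate colours positions of the word, not names; [cert_same] reconciles the occurrences of
    one name. *)
Definition occurs (o : nat * bool) (a : NI) : Prop :=
  o.1 < size s /\ argument (fact_at o.1) o.2 = Some a.

(* An entry carries a set of cost units, as many as its weight if it is violated,
   and the colours of its individuals. *)
Variables (units : nat -> {set 'I_k}) (hue : nat * bool -> pointed).

Definition satisfied (i : nat) : Prop := i < size s /\ units i = finset.set0.

(** The demands of an edge from the point of [x] to the point of [y]: a special end forces the edge
    into the other copy, and quantified concepts must respect the new neighbour. *)
Record role_fits (r : NR) (x y : pointed) : Prop := RoleFits {
  fit_from : forall j, sg x j = Some (pt x) -> holds (LFrom r j) y;
  fit_to : forall j, sg y j = Some (pt y) -> holds (LTo r j) x;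
  fit_ex : forall C, CEx r C \in cl -> holds (LExt C) y -> holds (LExt (CEx r C)) x;
  fit_all : forall C, CAll r C \in cl -> holds (LExt (CAll r C)) x -> holds (LExt C) y }.

(** There are finitely many spreads, and each involves [nt] occurrences, so this condition is
    first-order over the entries. The base [x0] stands in for copies not hit at their point. *)
Definition no_match (x0 : pointed) : Prop :=
  forall (d : spread T q k) (o : 'I_nt -> nat * bool), valid_spread d -> ~
    ((forall b, if has_point d b
        then (exists a, occurs (o b) a) /\ holds (FMatch (piece d b)) (hue (o b))
        else holds (FMatch (piece d b)) x0) /\
     cross_atoms d (fun r b b' => exists z a a', [/\ satisfied z,
        fact_at z = AR r a a', occurs (o b) a & occurs (o b') a'])).

(** Slots were set aside for a match, so all terms can sit on special elements and no entry has to
    be mentioned. *)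
Definition some_match (x0 : pointed) : Prop :=
  exists p : seq (option (slot + bool)),
    [/\ size p = nt, Some (inr true) \notin p,
        forall t, t \in ts -> exists j, place_of q p t = Some (inl j),
        well_placed p & holds (FMatch p) x0].

Record certified (x0 : pointed) (c : nat) (matched : bool) : Prop := Certified {
  cert_base : good x0;
  cert_good : forall o a, occurs o a -> good (hue o) /\ same_globals (hue o) x0;
  cert_same : forall o o' a, occurs o a -> occurs o' a -> hue o = hue o';
  cert_named : forall o a (j : slot), occurs o a -> j < size nm ->
    (sg (hue o) j = Some (pt (hue o)) <-> a = nth 0 nm j);
  cert_inj : forall o o' a a' j, occurs o a -> occurs o' a' ->
    sg (hue o) j = Some (pt (hue o)) -> sg (hue o') j = Some (pt (hue o')) -> a = a';
  cert_concept : forall i A a, satisfied i -> fact_at i = Defs.AC A a -> CAtom A \in cl ->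
    holds (LExt (CAtom A)) (hue (i, false));
  cert_role : forall i r a b, satisfied i -> fact_at i = AR r a b -> r \in rr ->
    role_fits r (hue (i, false)) (hue (i, true));
  cert_loop : forall i r a, satisfied i -> fact_at i = AR r a a -> r \in rr ->
    holds (LLoop r) (hue (i, false));
  cert_disjoint : forall i j x, i < size s -> j < size s -> x \in units i -> x \in units j -> i = j;
  cert_weight : forall i, i < size s -> units i != finset.set0 -> weight_at i = Fin #|units i|;
  cert_tcost : tcost T (carrier x0) = Fin c;
  cert_cost : c <= k /\ forall i x, i < size s -> x \in units i -> x < k - c;
  cert_match : if matched then some_match x0 else no_match x0 }.

End Entries.

End Certificates.

Lemma sum_card_disjoint (k m n : nat) (U : nat -> {set 'I_k}) :
  (forall i j x, i < m -> j < m -> x \in U i -> x \in U j -> i = j) ->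
  (forall i x, i < m -> x \in U i -> x < n) ->
  \sum_(0 <= i < m) #|U i| <= n.
Proof.
elim: m n U => [|m IH] n U disj bnd; first by rewrite big_geq.
(* The bound is generalised to any set [V] containing all units, from which the induction removes
   the last block. *)
suff : forall V : {set 'I_k}, (forall x, x \in V -> x < n) ->
    (forall i x, i < m.+1 -> x \in U i -> x \in V) -> \sum_(0 <= i < m.+1) #|U i| <= #|V|.
  move=> /(_ (finset (fun x : 'I_k => x < n))) H; apply: leq_trans (H _ _) _.
  - by move=> x; rewrite inE.
  - by move=> i x im xi; rewrite inE; apply: bnd xi.
  - have [kn|nk] := leqP k n.
      by apply: leq_trans kn; rewrite -[X in _ <= X]card_ord; apply: max_card.
    pose W := finset.imset (widen_ord (ltnW nk)) (mem 'I_n).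
    have W_n : #|W| <= n by apply: leq_trans (leq_imset_card _ _) _; rewrite card_ord.
    apply: leq_trans W_n; apply: subset_leq_card; apply/fintype.subsetP => x; rewrite finset.inE => lt.
    by apply/imsetP; exists (Ordinal lt) => //; apply: val_inj.
move=> V _; elim: m.+1 V disj {IH bnd} => [|l IH] V disj sub; first by rewrite big_geq.
rewrite big_nat_recr //=.
have dV : \sum_(0 <= i < l) #|U i| <= #|finset.setD V (U l)|.
  apply: IH => [i j x il jl|i x il xi]; first by apply: disj; exact: ltnW.
  rewrite finset.inE (sub i x (ltnW il) xi) andbT; apply/negP => xl.
  have E := disj i l x (ltnW il) (ltnSn l) xi xl.
  by rewrite E ltnn in il.
apply: leq_trans (leq_add dV (leqnn _)) _.
rewrite cardsD addnC -leq_subRL; last first.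
  by apply: subset_leq_card; apply/fintype.subsetP => x; apply: sub.
by apply: leq_sub2l; rewrite (finset.setIidPr _) //; apply/fintype.subsetP => x; apply: sub.
Qed.

(** The interval from 0 to the total weight is cut at the partial sums [S i]. *)
Lemma disjoint_blocks (k n m : nat) (w : nat -> nat) :
  \sum_(0 <= i < m) w i <= n -> n <= k ->
  exists U : nat -> {set 'I_k},
    [/\ forall i, i < m -> #|U i| = w i,
        forall i j x, i < m -> j < m -> x \in U i -> x \in U j -> i = j &
        forall i x, i < m -> x \in U i -> x < n].
Proof.
move=> wn nk; pose S i := \sum_(0 <= j < i) w j.
have SS i : S i.+1 = S i + w i by rewrite /S big_nat_recr.
have mono i j : i <= j -> S i <= S j.
  by move=> /subnK <-; elim: (j - i) => // d IH; rewrite addSn SS (leq_trans IH) ?leq_addr.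
have Sn i : i < m -> S i.+1 <= n by move=> im; apply: leq_trans (mono _ m im) wn.
exists (fun i => finset (fun x : 'I_k => S i <= x < S i.+1)); split.
- move=> i im; have lt (y : 'I_(w i)) : S i + y < k.
    by apply: leq_trans nk; apply: leq_trans (Sn i im); rewrite SS ltn_add2l.
  rewrite -[RHS]card_ord -(card_imset predT (f := fun y => Ordinal (lt y))); last first.
    by move=> y z [/addnI /val_inj].
  apply: eq_card => x; rewrite finset.inE; apply/idP/imsetP => [/andP[l h]|[y _ ->] /=].
    have hy : x - S i < w i by rewrite ltn_subLR // -SS.
    by exists (Ordinal hy) => //; apply: val_inj; rewrite /= subnKC.
  by rewrite SS leq_addr ltn_add2l ltn_ord.
- move=> i j x _ _; rewrite !finset.inE => /andP[a b] /andP[c d].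
  case: (ltngtP i j) => // h; have := mono _ _ h; lia.
- by move=> i x im; rewrite finset.inE => /andP[_ lt]; apply: leq_trans lt (Sn i im).
Qed.

(** * Soundness of certificates *)

Section Correctness.
Variables (T : wtbox) (q : bcq) (k : nat).

Local Notation cl := (relevant_concepts T q).
Local Notation rr := (relevant_roles T q).
Local Notation nm := (relevant_inds T q).
Local Notation ts := (bcq_terms q).
Local Notation nt := (size ts).
Local Notation slot := 'I_(slots T q k).
Local Notation pointed := (pointed T q k).

Lemma mem_nth_slot a : a \in nm -> exists j : slot, val j < size nm /\ nth 0 nm j = a.
Proof.
move=> an; have [j ja] := named_slot k an.
by exists j; rewrite /= in ja; rewrite /= ja index_mem nth_index.
Qed.

(** Apart from goodness and the agreement of hues, the conditions see hues only through the listed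
    facts. An annotation can thus store colours instead of interpretations. *)
Lemma certified_recolour s units hue hue' x0 x0' c m :
  @certified T q k s units hue x0 c m ->
  (forall o a, occurs s o a -> good (hue' o) /\ colour_of (hue' o) = colour_of (hue o)) ->
  (forall o o' a, occurs s o a -> occurs s o' a -> hue' o = hue' o') ->
  good x0' -> colour_of x0' = colour_of x0 ->
  @certified T q k s units hue' x0' c m.
Proof.
move=> H col same gx0 cx0.
have E o a f : occurs s o a -> f \in facts T q k -> holds f (hue' o) <-> holds f (hue o).
  by move=> /col[_ e]; apply: colour_of_eq.
have E0 f : f \in facts T q k -> holds f x0' <-> holds f x0 by apply: colour_of_eq.
have slotE o a j : occurs s o a ->
    sg (hue' o) j = Some (pt (hue' o)) <-> sg (hue o) j = Some (pt (hue o)).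
  by move=> oa; apply: (E o a (LSlot j) oa); apply: mem_facts.
have sat1 i r a b : satisfied s units i -> fact_at s i = AR r a b ->
    occurs s (i, false) a /\ occurs s (i, true) b.
  by move=> [im _] Ei; rewrite /occurs /= Ei.
split.
- exact: gx0.
- move=> o a oa; have [g' e'] := col o a oa; have [g sgl] := cert_good H oa.
  split=> // f ff gf; rewrite (E o a f oa ff) (E0 f ff); exact: sgl.
- exact: same.
- by move=> o a j oa jn; rewrite (slotE o a j oa); apply: cert_named H _ _ _ oa jn.
- move=> o o' a a' j oa oa' /(slotE o a j oa) h /(slotE o' a' j oa') h'.
  exact: cert_inj H _ _ _ _ _ oa oa' h h'.
- move=> i A a si Ei Acl; have oa : occurs s (i, false) a.
    by split; [case: si | rewrite /= Ei].
  apply/(E _ _ _ oa); first exact: mem_facts.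
  exact: cert_concept H _ _ _ si Ei Acl.
- move=> i r a b si Ei rrr; have [oa ob] := sat1 _ _ _ _ si Ei.
  have [f1 f2 f3 f4] := cert_role H si Ei rrr; split.
  + move=> j /(slotE _ _ _ oa) /f1 h; apply/(E _ _ _ ob) => //; exact: mem_facts.
  + move=> j /(slotE _ _ _ ob) /f2 h; apply/(E _ _ _ oa) => //; exact: mem_facts.
  + move=> C Ccl hC; have Dcl : C \in cl.
      by apply: cl_closed Ccl _; rewrite /= in_cons subconcepts_refl orbT.
    apply/(E _ _ _ oa); first exact: mem_facts.
    apply: f3 => //; apply/(E _ _ _ ob) => //; exact: mem_facts.
  + move=> C Ccl hC; have Dcl : C \in cl.
      by apply: cl_closed Ccl _; rewrite /= in_cons subconcepts_refl orbT.
    apply/(E _ _ _ ob); first exact: mem_facts.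
    apply: f4 => //; apply/(E _ _ _ oa) => //; exact: mem_facts.
- move=> i r a si Ei rrr; have [oa ob] := sat1 _ _ _ _ si Ei.
  apply/(E _ _ _ oa); first exact: mem_facts.
  exact: cert_loop H _ _ _ si Ei rrr.
- exact: cert_disjoint H.
- exact: cert_weight H.
- have cf : FCost c \in facts T q k by apply: mem_facts; case: (cert_cost H).
  by apply/(E0 _ cf); apply: cert_tcost H.
- exact: cert_cost H.
- have := cert_match H; case: m {H} => [[p [szp np spec wp hp]]|nomatch].
    by exists p; split=> //; apply/E0 => //; apply: mem_facts; apply/eqP.
  move=> d o vd [ok cross]; apply: (nomatch d o vd); split=> // b.
  have mf : FMatch (piece d b) \in facts T q k.
    by apply: mem_facts; rewrite size_map; case: vd => ->.
  have := ok b; case: ifP => _; last by move=> h; apply/E0.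
  by move=> [[a oa] h]; split; [exists a | apply/(E _ _ _ oa)].
Qed.

Section Sound.
Variables (s : wabox) (units : nat -> {set 'I_k}) (hue : nat * bool -> pointed).
Variables (x0 : pointed) (c : nat) (m : bool).
Hypothesis H : certified s units hue x0 c m.

Definition abox_inds : seq NI := flatten [seq assertion_inds p.1 | p <- s].

Lemma abox_indsP a : a \in abox_inds <-> exists o, occurs s o a.
Proof.
split=> [/flattenP[l /mapP[p ps ->] ap]|[[i b] [/= im ia]]].
  have lt := ps; rewrite -index_mem in lt; have E := nth_index entry0 ps.
  move: ap; rewrite -E -/(fact_at s (index p s)); case F: (fact_at s _) => [A x|r x y] /=.
    by rewrite inE => /eqP ->; exists (index p s, false); rewrite /occurs /= F.
  rewrite !inE => /orP[] /eqP ->; [exists (index p s, false) | exists (index p s, true)];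
  by rewrite /occurs /= F.
apply/flattenP; exists (assertion_inds (fact_at s i)).
  by apply/mapP; exists (nth entry0 s i); rewrite ?mem_nth.
by case: (fact_at s i) b ia => [A x|r x y] [] //= [->]; rewrite !inE eqxx ?orbT.
Qed.

(** A name of the TBox or the query without occurrence is already interpreted in [x0], which is
    repointed at it. The remaining names receive [x0] itself, because the amalgam takes a copy for
    every name. *)
Definition assign (a : NI) : pointed :=
  if pselect (exists o, occurs s o a) is left h then hue (projT1 (cid h)) else
  if a \in nm then PointedInterp (sg x0) (inl a) else x0.

Lemma assign_occurs o a : occurs s o a -> assign a = hue o.
Proof.
move=> oa; rewrite /assign; case: pselect => [h|[]]; last by exists o.
by case: cid => o' o'a /=; apply: cert_same H _ _ _ o'a oa.
Qed.

Lemma assign_named a : ~ (exists o, occurs s o a) -> a \in nm ->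
  assign a = PointedInterp (sg x0) (inl a).
Proof. by move=> no an; rewrite /assign; case: pselect => // _; rewrite an. Qed.

Let names : pred NI := fun a => (a \in nm) || (a \in abox_inds).
Let kept : set assertion := [set f | exists2 i, satisfied s units i & fact_at s i = f].

Lemma assign_globals a : same_globals (assign a) x0.
Proof.
have [[o oa]|no] := pselect (exists o, occurs s o a).
  by rewrite (assign_occurs oa); case: (cert_good H oa).
have [an|/negPf an] := boolP (a \in nm); last first.
  by rewrite /assign; case: pselect => // _; rewrite an.
by rewrite (assign_named no an); case: (x0) => I sg' p; apply: same_globals_pt.
Qed.

Lemma assign_good a : good (assign a).
Proof.
have [[o oa]|no] := pselect (exists o, occurs s o a).
  by rewrite (assign_occurs oa); case: (cert_good H oa).
have g0 := cert_base H.
have [an|/negPf an] := boolP (a \in nm); last first.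
  by rewrite /assign; case: pselect => // _; rewrite an.
rewrite (assign_named no an); split=> /=; try by case: g0.
have [j [jn <-]] := mem_nth_slot an.
exact: (good_dom g0 (good_named g0 jn)).
Qed.

Lemma assign_slot a (j : slot) : a \in nm -> val j = index a nm ->
  sg (assign a) j = Some (pt (assign a)).
Proof.
move=> an ja; have jn : j < size nm by rewrite [nat_of_ord j]ja index_mem.
have aj : a = nth 0 nm j by rewrite [nat_of_ord j]ja nth_index.
have [[o oa]|no] := pselect (exists o, occurs s o a).
  by rewrite (assign_occurs oa); apply/(cert_named H oa jn).
by rewrite (assign_named no an) /= (good_named (cert_base H) jn) -aj.
Qed.

Lemma certified_coherent : coherent names kept assign.
Proof.
have nameE a j : a \in nm -> sg (assign a) j = Some (pt (assign a)) -> val j = index a nm.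
  move=> an h; have [i ia] := named_slot k an.
  by rewrite -ia; congr val; apply: good_inj (assign_good a) _ _ _ h (assign_slot an ia).
have namedE a b j : a \in nm -> names b -> sg (assign a) j = Some (pt (assign a)) ->
    sg (assign b) j = Some (pt (assign b)) -> a = b.
  move=> an nb ha hb; have ja := nameE a j an ha.
  have jn : j < size nm by rewrite [nat_of_ord j]ja index_mem.
  have aj : a = nth 0 nm j by rewrite [nat_of_ord j]ja nth_index.
  case/orP: nb => [bn|/abox_indsP[o ob]].
    by rewrite aj [nat_of_ord j](nameE b j bn hb) nth_index.
  by rewrite aj; symmetry; apply/(cert_named H ob jn); rewrite -(assign_occurs ob).
have occ i r a b : satisfied s units i -> fact_at s i = AR r a b ->
    occurs s (i, false) a /\ occurs s (i, true) b.
  by move=> [im _] Ei; rewrite /occurs /= Ei.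
split.
- exact: assign_good.
- move=> a b f ff gf; have := assign_globals a ff gf; have := assign_globals b ff gf; tauto.
- exact: assign_slot.
- move=> a b j na nb ha hb; case/orP: (na) => [an|/abox_indsP[o oa]].
    exact: namedE an nb ha hb.
  case/orP: (nb) => [bn|/abox_indsP[o' ob]].
    by symmetry; apply: namedE bn na hb ha.
  rewrite (assign_occurs oa) in ha; rewrite (assign_occurs ob) in hb.
  exact: cert_inj H _ _ _ _ _ oa ob ha hb.
- move=> A a [i si Ei] Acl; have oa : occurs s (i, false) a.
    by split; [case: si | rewrite /= Ei].
  by rewrite (assign_occurs oa); apply: cert_concept H _ _ _ si Ei Acl.
- move=> r a b [i si Ei]; have [oa ob] := occ _ _ _ _ si Ei.
  by split; apply/orP; right; apply/abox_indsP; [exists (i, false) | exists (i, true)].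
- move=> r a b j [i si Ei] rrr; have [oa ob] := occ _ _ _ _ si Ei.
  by rewrite (assign_occurs oa) (assign_occurs ob); apply: fit_from (cert_role H si Ei rrr) _.
- move=> r a b j [i si Ei] rrr; have [oa ob] := occ _ _ _ _ si Ei.
  by rewrite (assign_occurs oa) (assign_occurs ob); apply: fit_to (cert_role H si Ei rrr) _.
- move=> r a [i si Ei] rrr; have [oa _] := occ _ _ _ _ si Ei.
  by rewrite (assign_occurs oa); apply: cert_loop H _ _ _ si Ei rrr.
- move=> r a b C [i si Ei] Ccl; have [oa ob] := occ _ _ _ _ si Ei.
  rewrite (assign_occurs oa) (assign_occurs ob).
  exact: (fit_ex (cert_role H si Ei (rr_ex Ccl)) Ccl).
- move=> r a b C [i si Ei] Ccl; have [oa ob] := occ _ _ _ _ si Ei.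
  rewrite (assign_occurs oa) (assign_occurs ob).
  exact: (fit_all (cert_role H si Ei (rr_all Ccl)) Ccl).
Qed.

Lemma certified_sound K : tbox K = T -> abox K = s ->
  exists I, [/\ interprets I K q, ele_int (cost K I) k &
    if m then sat_bcq I q else ~ sat_bcq I q].
Proof.
move=> KT Ks; have nmn : {subset nm <= names} by move=> a an; apply/orP; left.
exists (amalgam certified_coherent); split.
- move=> a; rewrite /input_inds KT Ks !mem_cat => h.
  change (names a); rewrite /names mem_undup mem_cat.
  by case/or3P: h => ->; rewrite ?orbT.
- rewrite /cost KT Ks -/(tcost T _) (tcost_amalgam certified_coherent nmn).
  have ck : FCost c \in facts T q k by apply: mem_facts; case: (cert_cost H).
  have [_ /(_ (cert_tcost H)) /= ->] := assign_globals 0 ck isT.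
  pose I := amalgam certified_coherent.
  rewrite (big_nth entry0).
  (* Only this direction matters: an entry with units may happen to be satisfied, which merely
     lowers the cost. *)
  have bad i : i < size s -> ~ sat_assertion I (fact_at s i) -> units i != finset.set0.
    move=> im ns; apply/eqP => ui; apply: ns.
    have ki : kept (fact_at s i) by exists i.
    case E: (fact_at s i) ki => [A a|r a b] ki; last exact: amalgam_role.
    apply: amalgam_concept ki; apply/orP; right; apply/abox_indsP; exists (i, false).
    by rewrite /occurs /= E.
  rewrite (big_eadd_sum (G := fun i => #|units i|)); last first.
    apply/allP => i; rewrite mem_index_iota => /= im; apply/implyP => /asboolP ns.
    by apply/eqP/(cert_weight H im)/bad.
  have [ck' cx] := cert_cost H.
  have := sum_card_disjoint (cert_disjoint H) cx.
  move=> le; have : \sum_(0 <= i < size s | `[< ~ sat_assertion I (nth entry0 s i).1 >]) #|units i| <= k - c.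
    by apply: leq_trans le; rewrite big_mkcond leq_sum // => i _; case: ifP.
  by rewrite /= -/I; lia.
- have hm := cert_match H; case: (m) hm => [[p [szp np spec wp hp]]|nomatch].
    apply: (amalgam_match certified_coherent nmn spec wp).
    have mf : FMatch p \in facts T q k by apply: mem_facts; apply/eqP.
    exact: (assign_globals 0 mf np).2.
  move=> /(amalgam_spread (inds := fun a => a \in abox_inds)) [].
    move=> r a b [i [im _] Ei]; split; apply/abox_indsP;
    by [exists (i, false); rewrite /occurs /= Ei | exists (i, true); rewrite /occurs /= Ei].
  move=> d [f [vd pieces cross]].
  (* [no_match] expects an occurrence for every block; a block not hit at its point gets a dummy
     one. *)
  have /choice [o oP] : forall b, exists o, has_point d b -> occurs s o (f b).
    move=> b; have := pieces b; case: ifP => [_ [/abox_indsP[o ob] _]|_ _]; last by exists (0, false).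
    by exists o.
  apply: (nomatch d o vd); split.
    move=> b; have := pieces b; case: ifP => [hb [_ hf]|hb hf].
      have ob := oP b hb; split; first by exists (f b).
      by rewrite -(assign_occurs ob).
    have mf : FMatch (piece d b) \in facts T q k.
      by apply: mem_facts; rewrite size_map; case: vd => ->.
    exact: (assign_globals 0 mf (piece_global hb)).1.
  move=> r t t' b b' g g' rq pt pt' bb.
  have [hg hg' [z sz Ez]] := cross r t t' b b' g g' rq pt pt' bb.
  have point b0 t0 : place_of q d t0 = Some (inr (b0, true)) -> has_point d b0.
    move=> E0; rewrite /has_point -E0 mem_nth // ltnNge; apply/negP => le.
    by move: E0; rewrite /place_of nth_default.
  rewrite hg in pt; rewrite hg' in pt'.
  split=> //; exists z, (f b), (f b'); split=> //; [exact/oP/(point b t) | exact/oP/(point b' t')].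
Qed.

End Sound.
End Correctness.

(** * Completeness of certificates *)

Section Complete.
Variables (T : wtbox) (q : bcq) (k : nat).

Local Notation cl := (relevant_concepts T q).
Local Notation rr := (relevant_roles T q).
Local Notation nm := (relevant_inds T q).
Local Notation ts := (bcq_terms q).
Local Notation nt := (size ts).
Local Notation slot := 'I_(slots T q k).
Local Notation pointed := (pointed T q k).

Variables (I : interp) (sg : slot -> option (elt I)).

Definition at_point (p : elt I) : pointed := PointedInterp sg p.

(** All hues are [I] itself with different points, so the pieces are partial matches in one
    interpretation. They agree on special elements, and the cross atoms are satisfied assertions;
    glued together they would match the query in [I]. *)
Lemma no_match_complete s units (hue : nat * bool -> pointed) p0 :
  (forall o a, occurs s o a -> hue o = at_point (inl a)) ->
  (forall i, satisfied s units i -> sat_assertion I (fact_at s i)) ->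
  (forall o a, occurs s o a -> dom I (inl a)) -> dom I p0 ->
  (forall j e, sg j = Some e -> dom I e) ->
  (forall j : slot, j < size nm -> sg j = Some (inl (nth 0 nm j))) ->
  ~ sat_bcq I q -> no_match s units hue (at_point p0).
Proof.
move=> hueE sat domO dp0 domS named nsat d o [szd total wp] [pieces cross]; apply: nsat.
have /choice [g gP] : forall b, exists h : term -> elt I, exists p : elt I,
    [/\ (has_point d b -> exists2 a, occurs s (o b) a & p = inl a), dom I p,
        places_ok (x := at_point p) (place_of q (piece d b)) h &
        forall u, u \in q ->
          (forall t, t \in atom_terms u -> place_of q (piece d b) t <> None) -> sat_atom h u].
  move=> b; have := pieces b; case: ifP => [_ [[a oa]]|_].
    rewrite (hueE _ _ oa) => -[h ok hs]; exists h, (inl a).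
    by split=> // [_|]; [exists a | exact: domO oa].
  by move=> [h ok hs]; exists h, p0.
pose h t : elt I :=
  if t \in ts then
    match place_of q d t with
    | Some (inl j) => odflt p0 (sg j)
    | Some (inr bf) => g bf.1 t
    | None => p0
    end
  else if t is TInd a then inl a else p0.
have named_at a : TInd a \in ts -> exists2 j, place_of q d (TInd a) = Some (inl j) & sg j = Some (inl a).
  move=> ats; have [j [pj ja]] := wp a ats; exists j => //.
  have an := mem_relevant_inds T ats.
  by rewrite named [nat_of_ord j]ja ?nth_index ?index_mem.
have agree b t : t \in ts -> project b (place_of q d t) <> None -> h t = g b t.
  move=> tts; rewrite /h tts; have [p [_ _ ok _]] := gP b.
  have := ok t tts; rewrite place_of_piece.
  case: (place_of q d t) => [[j|[b' f]]|] //=; first by move=> ->.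
  by case: eqP => // ->.
exists h; split.
- move=> a; rewrite /h; case: ifP => // /named_at[j -> ->] //.
- move=> t tts; have := total t tts; case E: (place_of q d t) => [[j|[b f]]|] // _.
    rewrite /h tts E; case F: (sg j) => [e|] //=.
    exact: domS F.
  have [p [_ dp ok _]] := gP b.
  rewrite (agree b) ?E //=; last by rewrite eqxx.
  by have := ok t tts; rewrite place_of_piece E /= eqxx; case: (f) => // ->.
- move=> u uq.
  have good_block b :
      (forall t, t \in atom_terms u -> project b (place_of q d t) <> None) -> sat_atom h u.
    move=> ib; have [p [_ _ _ hs]] := gP b.
    have su : sat_atom (g b) u.
      by apply: hs => // t tu; rewrite place_of_piece; apply: ib.
    have E t : t \in atom_terms u -> h t = g b t.
      by move=> tu; apply: agree (ib t tu); apply: atom_term tu.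
    case: u uq su E {ib hs} => [A t|r t t'] uq /= su E.
      by rewrite E ?inE.
    by rewrite !E // !inE eqxx ?orbT.
  have [t0 t0u] : exists t, t \in atom_terms u.
    by case: (u) => [A t|r t t']; exists t; rewrite inE eqxx.
  (* An atom with special terms only is covered by every block, and a block exists because the atom
     has a term. *)
  have nt0 : 0 < nt by have := atom_term uq t0u; case: (ts).
  case: u uq {t0 t0u} good_block => [A t|r t t'] uq good_block.
    have tts : t \in ts by apply: (atom_term uq); rewrite inE.
    have := total t tts; case E: (place_of q d t) => [[j|[b f]]|] // _.
      by apply: (good_block (Ordinal nt0)) => t0; rewrite inE => /eqP ->; rewrite E.
    by apply: (good_block b) => t0; rewrite inE => /eqP ->; rewrite E /= eqxx.
  have tts : t \in ts by apply: (atom_term uq); rewrite inE eqxx.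
  have tts' : t' \in ts by apply: (atom_term uq); rewrite !inE eqxx orbT.
  have := total t tts; have := total t' tts'.
  case E: (place_of q d t) => [[j|[b f]]|] //; case E': (place_of q d t') => [[j'|[b' f']]|] // _ _.
  + apply: (good_block (Ordinal nt0)) => t0; rewrite !inE => /orP[] /eqP ->; by rewrite ?E ?E'.
  + apply: (good_block b') => t0; rewrite !inE => /orP[] /eqP ->; by rewrite ?E ?E' //= eqxx.
  + apply: (good_block b) => t0; rewrite !inE => /orP[] /eqP ->; by rewrite ?E ?E' //= eqxx.
  have [bb|bb] := eqVneq b b'.
    apply: (good_block b) => t0; rewrite !inE => /orP[] /eqP ->; by rewrite ?E ?E' ?bb //= eqxx.
  have [ft ft' [z [a [a' [sz Ez oa oa']]]]] := cross r t t' b b' f f' uq E E' bb.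
  have pointE b0 t0 a0 : t0 \in ts -> place_of q d t0 = Some (inr (b0, true)) ->
      occurs s (o b0) a0 -> h t0 = inl a0.
    move=> t0ts E0 oa0; have hb : has_point d b0.
      rewrite /has_point -E0 mem_nth // ltnNge; apply/negP => le.
      by move: E0; rewrite /place_of nth_default.
    have [p [/(_ hb) [a1 oa1 pa1] _ ok _]] := gP b0.
    rewrite (agree b0) ?E0 //=; last by rewrite eqxx.
    have := ok t0 t0ts; rewrite place_of_piece E0 /= eqxx /= => ->.
    by rewrite pa1; case: oa0 => _; case: oa1 => _ -> [->].
  rewrite /= (pointE b t a) -?ft // (pointE b' t' a') -?ft' //.
  by have := sat z sz; rewrite Ez.
Qed.

End Complete.

Section Completeness.
Variables (T : wtbox) (q : bcq) (k : nat).

Local Notation nm := (relevant_inds T q).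
Local Notation ts := (bcq_terms q).
Local Notation nt := (size ts).
Local Notation slot := 'I_(slots T q k).

Theorem certified_complete K I (m : bool) :
  tbox K = T -> interprets I K q -> ele_int (cost K I) k ->
  (if m then sat_bcq I q else ~ sat_bcq I q) ->
  exists units hue x0 c, @certified T q k (abox K) units hue x0 c m.
Proof.
move=> KT int le hm; have wT : weighting T by rewrite -KT; apply: tbox_weighting.
set s := abox K; have /andP[_ /all_nthP ws] := abox_weighting K.
have {le} [c [w [Ec Ew cw]]] : exists c w, [/\ tcost T I = Fin c,
    \big[eadd/Fin 0]_(p <- s | `[< ~ sat_assertion I p.1 >]) p.2 = Fin w & c + w <= k].
  move: le; rewrite /cost KT -/(tcost T I) -/s; case: (tcost T I) => [c|] //.
  by case: (\big[_/_]_(_ <- _ | _) _) => [w|] //= h; exists c, w.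
have [l lc lP] := violators wT Ec.
have [e [en eP]] : exists e : seq (elt I), size e <= nt /\ (m -> exists h : term -> elt I,
    [/\ forall a, h (TInd a) = inl a, forall t, t \in ts -> dom I (h t),
        forall u, u \in q -> sat_atom h u & e = map h ts]).
  case: m hm => [[h [h1 h2 h3]]|_]; last by exists [::].
  by exists (map h ts); rewrite size_map; split=> // _; exists h.
have ninj i j (x : elt I) : onth (map (@inl NI (other I)) nm) i = Some x ->
    onth (map (@inl NI (other I)) nm) j = Some x -> i = j.
  rewrite !onth_map; case Ei: (onth nm i) => [a|] //= [<-]; case Ej: (onth nm j) => [b|] //= [ab].
  subst b; have li : i < size nm by rewrite -onthTE Ei.
  have lj : j < size nm by rewrite -onthTE Ej.
  apply/eqP; rewrite -(nth_uniq 0 li lj) ?undup_uniq //.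
  have -> : nth 0 nm i = a by exact: onth_nth Ei.
  by have -> : nth 0 nm j = a by exact: onth_nth Ej.
have [S szS [pre Sinj ex]] := enumerate (l ++ e) ninj.
rewrite size_map size_cat in szS; rewrite size_map in pre.
have sz : size S <= slots T q k by rewrite /slots; lia.
(* The lists behind [S] are only known to cover the required elements, so anything outside the
   domain is filtered out. *)
pose sg (j : slot) : option (elt I) :=
  if onth S j is Some x then if `[< dom I x >] then Some x else None else None.
have sgE j x : sg j = Some x <-> onth S j = Some x /\ dom I x.
  rewrite /sg; case: (onth S j) => [y|]; last by split=> // -[].
  by case: asboolP => dy; split; try (by move=> [<-]); try (by move=> [[<-]]); try (by move=> []).
have sg_ex i x : onth S i = Some x -> dom I x -> exists j, sg j = Some x.
  move=> Ei dx; have lt : i < slots T q k by apply: leq_trans sz; rewrite -onthTE Ei.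
  by exists (Ordinal lt); apply/sgE.
have dnm a : a \in nm -> dom I (inl a).
  move=> an; apply: int; rewrite /input_inds KT !mem_cat.
  by move: an; rewrite mem_undup mem_cat => /orP[] ->; rewrite ?orbT.
have named (j : slot) : j < size nm -> sg j = Some (inl (nth 0 nm j)).
  move=> jn; apply/sgE; split; last by apply/dnm/mem_nth.
  by rewrite pre // onth_map -[in RHS](odflt_onth 0) ; have := onthTE nm j; rewrite jn; case: onth.
have vioS p x : p \in T -> vio I p.1 x -> exists j, sg j = Some x.
  move=> pT vx; have [i Ei] := lP p x pT vx.
  have [|j Ej] := ex x i; first by rewrite onth_cat -onthTE Ei.
  by apply: sg_ex Ej _; move: vx; case: (p.1) => B C [/ext_dom].
have gd p : dom I p -> good (@at_point T q k I sg p).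
  move=> dp; split=> //= => [j x /sgE[]|i j x /sgE[Ei _] /sgE[Ej _]] //.
  exact/val_inj/(Sinj _ _ _ Ei Ej).
have occ_dom o a : occurs s o a -> dom I (inl a).
  move=> oa; apply: int; rewrite /input_inds !mem_cat.
  suff -> : a \in abox_inds s by rewrite orbT.
  by apply/abox_indsP; exists o.
have [p0 dp0] := dom_nonempty I.
pose hue (o : nat * bool) : pointed T q k :=
  if argument (fact_at s o.1) o.2 is Some a then at_point sg (inl a) else at_point sg p0.
have hueE o a : occurs s o a -> hue o = at_point sg (inl a).
  by move=> [_ oa]; rewrite /hue oa.
pose bad i := `[< ~ sat_assertion I (fact_at s i) >].
pose wt i := if bad i then enat_val (weight_at s i) else 0.
have [allfin wE] := big_eadd_fin Ew.
have finP i : i < size s -> bad i -> weight_at s i = Fin (enat_val (weight_at s i)).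
  move=> im bi; have := allP allfin (nth entry0 s i) (mem_nth _ im).
  by move: bi; rewrite /bad /fact_at => -> /= /eqP.
have wsum : \sum_(0 <= i < size s) wt i <= k - c.
  suff -> : \sum_(0 <= i < size s) wt i = w by lia.
  by rewrite wE [RHS](big_nth entry0) [RHS]big_mkcond.
have [units [uw udisj ubnd]] := disjoint_blocks wsum (leq_subr c k).
(* A violated entry would carry as many units as its weight, which is positive. *)
have satE i : satisfied s units i -> sat_assertion I (fact_at s i).
  move=> [im ui]; apply: contrapT => ns; have bi : bad i by apply/asboolP.
  have := uw i im; rewrite ui cards0 /wt bi => w0.
  have /= := ws entry0 i im; rewrite -/(weight_at s i) (finP i im bi) -w0.
  by rewrite /epos eqxx.
exists units, hue, (at_point sg p0), c; split.
- exact: gd.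
- move=> o a oa; rewrite (hueE _ _ oa); split; first by apply: gd; apply: occ_dom oa.
  exact: same_globals_pt.
- by move=> o o' a oa oa'; rewrite (hueE _ _ oa) (hueE _ _ oa').
- move=> o a j oa jn; rewrite (hueE _ _ oa) /= named //.
  by split=> [[->]|->].
- move=> o o' a a' j oa oa'; rewrite (hueE _ _ oa) (hueE _ _ oa') /= => -> [].
  by [].
- move=> i A a si Ei _; have oa : occurs s (i, false) a.
    by split; [case: si | rewrite /= Ei].
  by rewrite (hueE _ _ oa); have := satE i si; rewrite Ei.
- move=> i r a b si Ei rrr; have [im _] := si.
  have oa : occurs s (i, false) a by rewrite /occurs /= Ei.
  have ob : occurs s (i, true) b by rewrite /occurs /= Ei.
  have := satE i si; rewrite Ei (hueE _ _ oa) (hueE _ _ ob) /= => rab.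
  split=> /= [j sj|j sj|C _ hC|C _ [_ hC]].
  + by exists (inl a).
  + by exists (inl b).
  + by split; [exact: occ_dom oa | exists (inl b)].
  + exact: hC.
- move=> i r a si Ei rrr; have [im _] := si.
  have oa : occurs s (i, false) a by rewrite /occurs /= Ei.
  by have := satE i si; rewrite Ei (hueE _ _ oa).
- exact: udisj.
- move=> i im ui; rewrite uw // /wt; case: ifP => bi; first exact: finP.
  by move: ui; rewrite -cards_eq0 uw // /wt bi.
- exact: Ec.
- by split; [lia | exact: ubnd].
case: m hm eP => [_ /(_ isT) [h [h1 h2 h3 Ee]]|hm _]; last first.
  by apply: no_match_complete => // j x /sgE[].
have slotP t : t \in ts -> exists j, sg j = Some (h t).
  move=> tts; have eI : onth e (index t ts) = Some (h t).
    rewrite Ee onth_map; have := onthTE ts (index t ts).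
    rewrite index_mem tts; case E: onth => [t'|] //= _.
    have <- : nth t ts (index t ts) = t' by exact: onth_nth E.
    by rewrite nth_index.
  have [|j Ej] := ex (h t) (size l + index t ts).
    by rewrite onth_cat ltnNge leq_addr /= addKn.
  by have [i Ei] := sg_ex j (h t) Ej (h2 t tts); exists i.
pose go t : option (slot + bool) :=
  if [pick j | `[< sg j = Some (h t) >]] is Some j then Some (inl j) else None.
have goP t : t \in ts -> exists2 j, go t = Some (inl j) & sg j = Some (h t).
  move=> /slotP[j Ej]; rewrite /go; case: pickP => [i /asboolP Ei|/(_ j) /asboolP //].
  by exists i.
have goE t : t \in ts -> place_of q (map go ts) t = go t.
  by move=> tts; rewrite /place_of (nth_map t) ?index_mem // nth_index.
exists (map go ts); split.
- by rewrite size_map.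
- by apply/mapP => -[t /goP[j -> _]].
- by move=> t tts; rewrite goE //; have [j -> _] := goP t tts; exists j.
- move=> a ats; rewrite goE //; have [j -> Ej] := goP _ ats; exists j; split=> //.
  have an := mem_relevant_inds T ats; have [i ia] := named_slot k an.
  have Ei : sg i = Some (inl a).
    by rewrite named [nat_of_ord i]ia ?nth_index ?index_mem.
  rewrite -ia; move: Ej => /sgE[Ej _]; move: Ei => /sgE[Ei _]; rewrite h1 in Ej.
  exact: Sinj Ej Ei.
exists h => [t tts|u uq _]; last exact: h3.
by rewrite goE //; have [j -> Ej] := goP t tts.
Qed.

End Completeness.

(** * Encodings of weighted ABoxes *)

Section EntryWords.
Implicit Types (w s t rest : seq letter) (f : assertion) (x : enat).

Definition enc_entry (p : assertion * enat) : seq letter :=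
  enc_assertion p.1 ++ LSep :: enc_weight p.2.

Definition fields f : seq nat :=
  match f with Defs.AC A a => [:: A; a] | AR r a b => [:: r; a; b] end.

Definition opener f : letter := if f is AR _ _ _ then LRole else LConcept.

(** A uniform shape for both kinds of entries: after the opening letter come the fields, each closed
    by a separator, and then the weight. Patterns can skip fields without knowing the kind. *)
Fixpoint tail_enc (fs : seq nat) x : seq letter :=
  if fs is n :: fs' then map LBit (nbits n) ++ LSep :: tail_enc fs' x else enc_weight x.

Lemma enc_entryE f x : enc_entry (f, x) = opener f :: tail_enc (fields f) x.
Proof. by case: f => [A a|r a b]; rewrite /enc_entry /= !binaryE -!catA /= -?catA. Qed.

Lemma is_entry_opener f : is_entry (Some (opener f)).
Proof. by case: f. Qed.

Definition sep_fields (side : bool) (n : nat) : seq (item letter) :=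
  flatten (nseq n [:: bits side; one side is_sep]).

Definition to_field (side : bool) (n : nat) : seq (item letter) :=
  one side is_entry :: sep_fields side n.

Lemma pmatch_sep_fields_left n ps fs x rest t : n <= size fs ->
  pmatch (sep_fields true n ++ ps) (tail_enc fs x ++ rest) t =
  pmatch ps (tail_enc (drop n fs) x ++ rest) t.
Proof.
elim: n fs => [|n IH] [|m fs] //= le.
rewrite star_bits_left ?leq_addr // -catA /= after_bits_cat //=.
exact: IH.
Qed.

Lemma pmatch_sep_fields_right n ps fs x rest s : n <= size fs ->
  pmatch (sep_fields false n ++ ps) s (tail_enc fs x ++ rest) =
  pmatch ps s (tail_enc (drop n fs) x ++ rest).
Proof.
elim: n fs => [|n IH] [|m fs] //= le.
rewrite star_bits_right ?leq_addl // -catA /= after_bits_cat //=.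
exact: IH.
Qed.

Lemma pmatch_to_field_left n ps f x rest t : n <= size (fields f) ->
  pmatch (to_field true n ++ ps) (enc_entry (f, x) ++ rest) t =
  pmatch ps (tail_enc (drop n (fields f)) x ++ rest) t.
Proof.
by move=> le; rewrite enc_entryE /= is_entry_opener; apply: pmatch_sep_fields_left.
Qed.

Lemma pmatch_to_field_right n ps f x rest s : n <= size (fields f) ->
  pmatch (to_field false n ++ ps) s (enc_entry (f, x) ++ rest) =
  pmatch ps s (tail_enc (drop n (fields f)) x ++ rest).
Proof.
by move=> le; rewrite enc_entryE /= is_entry_opener; apply: pmatch_sep_fields_right.
Qed.

Definition number (n : nat) (p : pred (option letter)) : seq (item letter) :=
  rcons [seq one true (is_bit_of b) | b <- nbits n] (here true p).

(** The closing test must reject bits, otherwise the pattern would also match numerals that extend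
    the one sought. *)
Lemma pmatch_number n bs p s t :
  (forall b, p (Some (LBit b)) = false) -> ~~ is_bit (ohead s) ->
  pmatch (number n p) (map LBit bs ++ s) t = (nbits n == bs) && p (ohead s).
Proof.
rewrite /number => pb hs; elim: (nbits n) bs => [|b l IH] [|b' bs] /=.
- by rewrite andbT.
- by rewrite pb.
- by case: s hs {IH} => //= -[].
- by rewrite IH eqseq_cons andbA.
Qed.

Definition field_is (n m : nat) : seq (item letter) := to_field true n ++ number m is_sep.

Lemma pmatch_field_is n m f x rest t : n < size (fields f) ->
  pmatch (field_is n m) (enc_entry (f, x) ++ rest) t = (nth 0 (fields f) n == m).
Proof.
move=> lt; rewrite pmatch_to_field_left; last exact: ltnW.
rewrite (drop_nth 0 lt) /= -catA /= pmatch_number //= andbT (inj_eq nbits_inj).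
exact: eq_sym.
Qed.

Definition field_eq (n n' : nat) : seq (item letter) :=
  to_field true n ++ to_field false n' ++
  [:: same_bits; both_here (fun y z => is_sep y && is_sep z)].

Lemma pmatch_field_eq n n' f x rest f' x' rest' :
  n < size (fields f) -> n' < size (fields f') ->
  pmatch (field_eq n n') (enc_entry (f, x) ++ rest) (enc_entry (f', x') ++ rest') =
  (nth 0 (fields f) n == nth 0 (fields f') n').
Proof.
move=> lt lt'; rewrite pmatch_to_field_left; last exact: ltnW.
rewrite pmatch_to_field_right; last exact: ltnW.
rewrite (drop_nth 0 lt) (drop_nth 0 lt') -[tail_enc (_ :: _) _]/(map LBit _ ++ LSep :: _).
rewrite -[X in pmatch _ _ (X ++ _)]/(map LBit _ ++ LSep :: _) -!catA !cat_cons pmatch_same.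
exact: inj_eq nbits_inj _ _.
Qed.

Definition weight_is (n m : nat) : seq (item letter) :=
  to_field true n ++ number m (fun y => ~~ is_bit y).

(** [LInfty] is not a bit, so an infinite weight reads like the empty numeral, that is, like 0;
    hence [0 < m]. *)
Lemma pmatch_weight_is m f x rest t : 0 < m -> is_end (ohead rest) ->
  pmatch (weight_is (size (fields f)) m) (enc_entry (f, x) ++ rest) t = (x == Fin m).
Proof.
move=> m0 er; rewrite pmatch_to_field_left // drop_size /=.
have hr : ~~ is_bit (ohead rest) by case: rest er => //= -[].
case: x => [n|] /=.
  rewrite binaryE pmatch_number // hr andbT (inj_eq nbits_inj) eq_sym.
  by apply/eqP/eqP => [->|[]].
rewrite -[LInfty :: rest]/(map LBit [::] ++ LInfty :: rest) pmatch_number //= andbT -nbits0.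
rewrite (inj_eq nbits_inj); case: m m0 => // m _; symmetry; exact/eqP.
Qed.

Definition offset (s : wabox) (i : nat) : nat := size (enc_wabox (take i s)).

Lemma enc_wabox_cons p (s : wabox) : enc_wabox (p :: s) = enc_entry p ++ enc_wabox s.
Proof. by []. Qed.

Lemma enc_wabox_cat (s s' : wabox) : enc_wabox (s ++ s') = enc_wabox s ++ enc_wabox s'.
Proof. by rewrite /enc_wabox map_cat flatten_cat. Qed.

Lemma drop_offset (s : wabox) i : drop (offset s i) (enc_wabox s) = enc_wabox (drop i s).
Proof. by rewrite -{2}(cat_take_drop i s) enc_wabox_cat drop_size_cat. Qed.

Lemma offset_size (s : wabox) i : offset s i <= size (enc_wabox s).
Proof. by rewrite -{2}(cat_take_drop i s) enc_wabox_cat size_cat leq_addr. Qed.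

Lemma offset_inj (s : wabox) i j :
  i < size s -> j < size s -> offset s i = offset s j -> i = j.
Proof.
have lt a b : a < b -> b < size s -> offset s a < offset s b.
  move=> ab bs; rewrite /offset -(cat_take_drop a (take b s)) enc_wabox_cat size_cat take_takel; last exact: ltnW.
  have : 0 < size (drop a (take b s)) by rewrite size_drop size_takel ?subn_gt0 // ltnW.
  case: (drop _ _) => // p l _; rewrite enc_wabox_cons size_cat.
  by case: p => f x; rewrite enc_entryE /=; lia.
move=> is_ js E; case: (ltngtP i j) => // h; first by have := lt _ _ h js; rewrite E ltnn.
by have := lt _ _ h is_; rewrite E ltnn.
Qed.

Lemma is_end_wabox (s : wabox) : is_end (ohead (enc_wabox s)).
Proof. by case: s => // -[[]]. Qed.

Lemma tail_enc_no_entry fs x : all (fun a => ~~ is_entry (Some a)) (tail_enc fs x).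
Proof.
elim: fs => [|n fs IH] /=; first by case: x => //= n; rewrite binaryE all_map; apply/allP.
by rewrite all_cat /= IH andbT all_map; apply/allP.
Qed.

(** The opening letters occur nowhere inside an entry, so entries can be quantified over by
    quantifying over positions that carry one. *)
Lemma entry_offset (s : wabox) y :
  is_entry (onth (enc_wabox s) y) -> exists2 i, i < size s & y = offset s i.
Proof.
elim: s y => [|[f x] s IH] y; first by rewrite onth0n.
rewrite enc_wabox_cons onth_cat; case: ltnP => [lt|ge].
  case: y lt => [|y] lt; first by exists 0.
  move: lt; rewrite enc_entryE /= ltnS => lt.
  have := allP (tail_enc_no_entry (fields f) x) (nth LSep (tail_enc (fields f) x) y) (mem_nth _ lt).
  rewrite -(odflt_onth LSep); have := onthTE (tail_enc (fields f) x) y; rewrite lt.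
  by case: onth => //= a _ /negPf ->.
move=> /IH[i li Ei]; exists i.+1 => //.
by rewrite /offset /= enc_wabox_cons size_cat -/(offset s i) -Ei subnKC.
Qed.

Lemma onth_offset (s : wabox) i : i < size s ->
  onth (enc_wabox s) (offset s i) = Some (opener (fact_at s i)).
Proof.
move=> lt; rewrite -ohead_drop drop_offset (drop_nth entry0 lt) enc_wabox_cons.
by rewrite /fact_at; case: (nth _ _ _) => f x; rewrite enc_entryE.
Qed.

Lemma drop_offset_nth (s : wabox) i : i < size s ->
  drop (offset s i) (enc_wabox s) =
  enc_entry (fact_at s i, weight_at s i) ++ enc_wabox (drop i.+1 s).
Proof.
move=> lt; rewrite drop_offset (drop_nth entry0 lt) enc_wabox_cons.
by rewrite /fact_at /weight_at; case: (nth _ _ _).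
Qed.

(* The local conditions that characterise the words [enc_wabox s]. *)
Definition entry_pattern (c : pred (option letter)) (n : nat) (finite : bool) :
    seq (item letter) :=
  one true c :: sep_fields true n ++
  (if finite then [:: one true is_bit; bits true; here true is_end]
   else [:: one true is_infty; here true is_end]).

(** With the least significant bit first, a bit [false] not followed by a bit is a leading zero. *)
Definition trailing_zero : seq (item letter) :=
  [:: one true (is_bit_of false); here true (fun y => ~~ is_bit y)].

Record locally_valid w : Prop := LocallyValid {
  valid_start : is_end (ohead w);
  valid_concept : forall y, y <= size w -> is_concept (onth w y) ->
    pmatch (entry_pattern is_concept 2 true) (drop y w) w ||
    pmatch (entry_pattern is_concept 2 false) (drop y w) w;
  valid_role : forall y, y <= size w -> is_role (onth w y) ->
    pmatch (entry_pattern is_role 3 true) (drop y w) w ||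
    pmatch (entry_pattern is_role 3 false) (drop y w) w;
  valid_bits : forall y, y <= size w -> ~~ pmatch trailing_zero (drop y w) w }.

Lemma entry_pattern_enc f x rest t (c : pred (option letter)) :
  c (Some (opener f)) -> epos x -> is_end (ohead rest) ->
  pmatch (entry_pattern c (size (fields f)) true) (enc_entry (f, x) ++ rest) t ||
  pmatch (entry_pattern c (size (fields f)) false) (enc_entry (f, x) ++ rest) t.
Proof.
move=> cf px er; rewrite enc_entryE /= cf /= !pmatch_sep_fields_left // drop_size.
case: x px => [n|] px; last by rewrite /= er.
rewrite /= binaryE; apply/orP; left; case E: (nbits n) => [|b bs] /=.
  by move: px; rewrite /epos (nbits_inj (E : nbits n = nbits 0)) eqxx.
rewrite star_bits_left ?leq_addr // after_bits_cat ?er //.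
by case: rest er => //= -[].
Qed.

Lemma last_false_split bs w : ~~ last true bs ->
  exists l, map LBit bs ++ w = l ++ LBit false :: w.
Proof.
case/lastP: bs => // bs b; rewrite last_rcons => /negPf ->.
by exists (map LBit bs); rewrite map_rcons cat_rcons.
Qed.

Lemma enc_locally_valid (s : wabox) :
  all (fun p => epos p.2) s -> locally_valid (enc_wabox s).
Proof.
move=> ps; split.
- exact: is_end_wabox.
- move=> y _ hy; have [|i li Ei] := @entry_offset s y; first by rewrite /is_entry hy.
  move: hy; rewrite Ei onth_offset // drop_offset_nth // => hf.
  have := @entry_pattern_enc (fact_at s i) (weight_at s i) (enc_wabox (drop i.+1 s)) (enc_wabox s) is_concept hf.
  move=> /(_ (all_nthP entry0 ps i li) (is_end_wabox _)).
  by case: (fact_at s i) hf.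
- move=> y _ hy; have [|i li Ei] := @entry_offset s y; first by rewrite /is_entry hy orbT.
  move: hy; rewrite Ei onth_offset // drop_offset_nth // => hf.
  have := @entry_pattern_enc (fact_at s i) (weight_at s i) (enc_wabox (drop i.+1 s)) (enc_wabox s) is_role hf.
  move=> /(_ (all_nthP entry0 ps i li) (is_end_wabox _)).
  by case: (fact_at s i) hf.
- have step bs w t y : last true bs -> (forall z, ~~ pmatch trailing_zero (drop z w) t) ->
      ~~ pmatch trailing_zero (drop y (map LBit bs ++ w)) t.
    move=> + hw; elim: bs y => [|b bs IH] y /=; first by move=> _; apply: hw.
    case: y => [|y] lb; last first.
      by apply: IH; case: (bs) lb.
    case: bs lb {IH} => [|b' bs] /=; first by move=> ->.
    by rewrite !andbF.
  have skip a w t y : ~~ is_bit_of false (Some a) ->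
      (forall z, ~~ pmatch trailing_zero (drop z w) t) ->
      ~~ pmatch trailing_zero (drop y (a :: w)) t.
    by move=> ha hw; case: y => [|y]; [case: a ha => //= -[] | apply: hw].
  suff H t y : ~~ pmatch trailing_zero (drop y (enc_wabox s)) t by move=> y _.
  elim: s y {ps} => [|[f x] s IH] y //.
  rewrite enc_wabox_cons enc_entryE cat_cons; apply: (skip _ _ t); first by case: (f).
  elim: (fields f) => [|n fs IHf] z /=.
    case: x => [n|]; last exact: (skip _ _ t).
    by rewrite /= binaryE; apply: (step _ _ t); [rewrite last_nbits | exact: IH].
  by rewrite -catA; apply: (step _ _ t); [rewrite last_nbits | move=> z'; apply: (skip _ _ t)].
Qed.

Lemma sep_fields_inv n ps w t :
  (forall l r, w = l ++ LBit false :: r -> is_bit (ohead r)) ->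
  pmatch (sep_fields true n ++ ps) w t ->
  exists fs rest, [/\ size fs = n,
    forall x, w = flatten [seq rcons (map LBit (nbits m)) LSep | m <- fs] ++ rest &
    pmatch ps rest t].
Proof.
elim: n w => [|n IH] w canon; first by exists [::], w.
rewrite /= star_bits_left ?leq_addr //; have Ew := after_bitsE w.
case Ea: (after_bits w) Ew => [|[b||||] w'] //= Ew pm.
have [m Em] : exists m, nbits m = bit_prefix w.
  apply: nbits_onto; apply: contraT => /(last_false_split (LSep :: w'))[l El].
  by have := canon l (LSep :: w'); rewrite -El -Ew => /(_ erefl).
have [|fs [rest [<- Er pr]]] := IH w' _ pm.
  move=> l r El; apply: (canon (map LBit (bit_prefix w) ++ LSep :: l)).
  by rewrite -catA /= -El.
exists (m :: fs), rest; split=> // x.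
by rewrite /= Em cat_rcons -catA {1}Ew (Er x).
Qed.

Lemma tail_encE fs x :
  tail_enc fs x = flatten [seq rcons (map LBit (nbits m)) LSep | m <- fs] ++ enc_weight x.
Proof. by elim: fs => //= n fs ->; rewrite cat_rcons -catA. Qed.

(** A finite weight appears as a nonempty run of bits without leading zero, hence is positive. *)
Lemma entry_inv (c : pred (option letter)) n a w t :
  (forall l r, w = l ++ LBit false :: r -> is_bit (ohead r)) ->
  pmatch (entry_pattern c n true) (a :: w) t ||
  pmatch (entry_pattern c n false) (a :: w) t ->
  exists fs x rest, [/\ size fs = n, epos x, w = tail_enc fs x ++ rest &
                        is_end (ohead rest)].
Proof.
move=> canon.
rewrite /= => /orP[] /andP[_ /(sep_fields_inv canon)[fs [rest [sz /(_ Infty) Ew pm]]]].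
  have Er := after_bitsE rest; move: pm; case: rest Ew Er => [|[b||||] rest] //= Ew [Er].
  rewrite star_bits_left ?leq_addr // andbT => er.
  have lb : last true (b :: bit_prefix rest).
    apply: contraT => /(last_false_split (after_bits rest))[l El].
    have := canon (flatten [seq rcons (map LBit (nbits m)) LSep | m <- fs] ++ l) (after_bits rest).
    rewrite -catA -El /= -Er -Ew => /(_ erefl).
    by rewrite (negPf (after_bits_head rest)).
  have [m Em] := nbits_onto lb.
  exists fs, (Fin m), (after_bits rest); split=> //.
    by rewrite /epos; apply/eqP => -[m0]; rewrite m0 in Em.
  by rewrite tail_encE Ew -catA /= binaryE Em /= -Er.
move: pm; case: rest Ew => [|[b||||] rest] //= Ew; rewrite andbT => er.
exists fs, Infty, rest; split=> //; first exact/eqP.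
by rewrite tail_encE Ew -catA.
Qed.

(** Each entry pattern ends at another opening letter or at the end of the word, so the word can be
    parsed entry by entry from the left. *)
Lemma locally_valid_enc w :
  locally_valid w -> exists2 s : wabox, w = enc_wabox s & all (fun p => epos p.2) s.
Proof.
move=> [v0 vc vr vb].
have canon l r : w = l ++ LBit false :: r -> is_bit (ohead r).
  move=> E; have le : size l <= size w by rewrite E size_cat leq_addr.
  by have := vb _ le; rewrite E drop_size_cat //= andbT negbK.
suff H n y : size w - y <= n -> y <= size w -> is_end (onth w y) ->
    exists2 s : wabox, drop y w = enc_wabox s & all (fun p => epos p.2) s.
  have h0 : is_end (onth w 0) by rewrite -ohead_drop drop0.
  have [s] := H (size w) 0 (leq_subr 0 _) (leq0n _) h0.
  by rewrite drop0; exists s.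
elim: n y => [|n IH] y.
  move=> h ge _; exists [::] => //; rewrite drop_oversize //; lia.
move=> le yw; case Ey: (onth w y) => [a|] // ea; last first.
  exists [::] => //; rewrite drop_oversize //.
  by have := onthTE w y; rewrite Ey /= => /esym/negbT; rewrite -leqNgt.
have Ed : drop y w = a :: drop y.+1 w.
  have lt : y < size w by rewrite -onthTE Ey.
  rewrite (drop_nth a lt); congr cons; exact: onth_nth Ey.
have canon' l r : drop y.+1 w = l ++ LBit false :: r -> is_bit (ohead r).
  by move=> E; apply: (canon (take y.+1 w ++ l)); rewrite -catA -E cat_take_drop.
have fin f x rest : drop y w = enc_entry (f, x) ++ rest -> epos x -> is_end (ohead rest) ->
    exists2 s : wabox, drop y w = enc_wabox s & all (fun p => epos p.2) s.
  move=> E px er; have Er : rest = drop (y + size (enc_entry (f, x))) w.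
    by rewrite addnC -drop_drop E drop_size_cat.
  have sz : 0 < size (enc_entry (f, x)) by rewrite enc_entryE.
  have sw : size (drop y w) = size (enc_entry (f, x)) + size rest by rewrite E size_cat.
  rewrite size_drop in sw.
  have [|||s Es ps] := IH (y + size (enc_entry (f, x))); try lia.
    by rewrite -ohead_drop -Er.
  by exists ((f, x) :: s); rewrite /= ?px // enc_wabox_cons -Es -Er.
case: a Ey ea Ed => // Ey _ Ed.
- have [|fs [x [rest [sz px Eb er]]]] := @entry_inv is_concept 2 LConcept _ w canon'.
    by rewrite -Ed; apply: vc; rewrite ?Ey.
  case: fs sz Eb => [|A [|a [|]]] // _ Eb; apply: (fin (Defs.AC A a) x rest) => //.
  by rewrite enc_entryE Ed /= -Eb.
- have [|fs [x [rest [sz px Eb er]]]] := @entry_inv is_role 3 LRole _ w canon'.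
    by rewrite -Ed; apply: vr; rewrite ?Ey.
  case: fs sz Eb => [|r [|a [|b [|]]]] // _ Eb; apply: (fin (AR r a b) x rest) => //.
  by rewrite enc_entryE Ed /= -Eb.
Qed.

End EntryWords.

(** * The certificate conditions as a formula *)

Section Formulas.
Variable (B : Type).
Implicit Types (f g : fo B) (u : seq B) (v : nat -> nat).

(** The empty pattern; 3 and 4 are the first two admissible variables. *)
Definition fTrue : fo B := Pat [::] 3 4.
Definition fAnd (l : seq (fo B)) : fo B := foldr (@Conj B) fTrue l.
Definition fOr (l : seq (fo B)) : fo B := Neg (fAnd (map (@Neg B) l)).
Definition fImp f g : fo B := Neg (Conj f (Neg g)).
Definition fBool (b : bool) : fo B := if b then fTrue else Neg fTrue.
Definition fAll (i : nat) f : fo B := Neg (Ex i (Neg f)).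
Definition fExs (l : seq nat) f : fo B := foldr (@Ex B) f l.

Lemma sem_And l u v : sem (fAnd l) u v = all (fun f => sem f u v) l.
Proof. by elim: l => //= f l ->. Qed.

Lemma sem_And_map (A : eqType) (f : A -> fo B) (l : seq A) u v :
  sem (fAnd [seq f x | x <- l]) u v <-> forall x, x \in l -> sem (f x) u v.
Proof. by rewrite sem_And all_map; split=> /allP. Qed.

Lemma sem_Or l u v : sem (fOr l) u v = has (fun f => sem f u v) l.
Proof. by rewrite /= sem_And all_map -has_predC; apply: eq_has => f /=; rewrite negbK. Qed.

Lemma sem_Imp f g u v : sem (fImp f g) u v = (sem f u v ==> sem g u v).
Proof. by rewrite /=; case: (sem f u v); rewrite //= negbK. Qed.

Lemma sem_Bool b u v : sem (fBool b) u v = b.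
Proof. by case: b. Qed.

Lemma sem_Ex i f u v :
  sem (Ex i f) u v <-> exists2 x, x <= size u & sem f u (vset v i x).
Proof.
split=> [/hasP[x]|[x xu fx]].
  by rewrite mem_iota ltnS => /andP[_ xu] fx; exists x.
by apply/hasP; exists x => //; rewrite mem_iota ltnS.
Qed.

Lemma sem_All i f u v :
  sem (fAll i f) u v <-> forall x, x <= size u -> sem f u (vset v i x).
Proof.
rewrite -[sem _ _ _]/(~~ sem (Ex i (Neg f)) u v); split=> [h x xu|h].
  by apply: contraNT h => nf; apply/sem_Ex; exists x.
by apply/negP => /sem_Ex[x /h] /= ->.
Qed.

Lemma sem_Exs l f u v :
  sem (fExs l f) u v -> exists w, [/\ sem f u w, forall i, i \notin l -> w i = v i &
    forall i, i \in l -> w i <= size u].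
Proof.
elim: l v => [|i l IH] v; first by exists v.
move=> /sem_Ex[x xu /IH[w [fw wv wu]]]; exists w; split=> // j; rewrite inE.
  by rewrite negb_or => /andP[ji /wv ->]; rewrite /vset (negPf ji).
have [/wu //|/wv ->] := boolP (j \in l); rewrite orbF /vset => /eqP ->.
by rewrite eqxx.
Qed.

Lemma sem_Exs_intro l f u v w : uniq l ->
  (forall i, i \notin l -> w i = v i) -> (forall i, i \in l -> w i <= size u) ->
  sem f u w -> sem (fExs l f) u v.
Proof.
elim: l v => [|i l IH] v /= => [_ wv _ fw|/andP[il ul] wv wu fw].
  by have -> : v = w by apply/funext => i; rewrite wv.
apply/sem_Ex; exists (w i); first by apply: wu; rewrite mem_head.
apply: IH => // [j jl|j jl]; last by apply: wu; rewrite inE jl orbT.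
rewrite /vset; case: eqP => [->|/eqP ji] //.
by apply: wv; rewrite inE negb_or ji.
Qed.

Variable K : nat.
Hypothesis K5 : 4 < K.

(** Tracking a superset [S] of the bound variables makes the freshness condition of [wf] checkable
    connective by connective. *)
Definition scoped (S : seq nat) f : bool := wf K f && all (mem S) (bound f).

Lemma scoped_wf S f : scoped S f -> wf K f.
Proof. by case/andP. Qed.

Lemma scoped_Pat S ps i j : i != j -> 2 < i <= K -> 2 < j <= K -> scoped S (Pat ps i j).
Proof. by move=> h1 h2 h3; rewrite /scoped /= h1 h2 h3. Qed.

Lemma scoped_Neg S f : scoped S f -> scoped S (Neg f).
Proof. by []. Qed.

Lemma scoped_Conj S f g : scoped S f -> scoped S g -> scoped S (Conj f g).
Proof. by rewrite /scoped /= all_cat => /andP[-> ->] /andP[-> ->]. Qed.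

Lemma scoped_True S : scoped S fTrue.
Proof. by apply: scoped_Pat => //; lia. Qed.

Lemma scoped_And S l : all (scoped S) l -> scoped S (fAnd l).
Proof.
elim: l => [_|f l IH] /=; first exact: scoped_True.
by move=> /andP[sf /IH]; apply: scoped_Conj.
Qed.

Lemma scoped_Or S l : all (scoped S) l -> scoped S (fOr l).
Proof. by move=> h; apply/scoped_Neg/scoped_And; rewrite all_map. Qed.

Lemma scoped_Imp S f g : scoped S f -> scoped S g -> scoped S (fImp f g).
Proof. by move=> sf sg; apply: scoped_Conj. Qed.

Lemma scoped_Bool S b : scoped S (fBool b).
Proof. by case: b; [| apply: scoped_Neg]; apply: scoped_True. Qed.

Lemma scoped_Ex S i f : 2 < i <= K -> i \notin S -> scoped S f -> scoped (i :: S) (Ex i f).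
Proof.
move=> iK iS /andP[wff /allP bf]; apply/andP; split=> /=.
  by rewrite iK wff andbT; apply: contra iS => /bf.
by rewrite inE eqxx /=; apply/allP => j /bf /= jS; rewrite inE jS orbT.
Qed.

Lemma scoped_sub S S' f : {subset S <= S'} -> scoped S f -> scoped S' f.
Proof. by move=> sub /andP[wff bf]; rewrite /scoped wff; apply: sub_all bf. Qed.

Lemma scoped_Exs S l f : uniq l -> all (fun i => 2 < i <= K) l ->
  (forall i, i \in l -> i \notin S) -> scoped S f -> scoped (l ++ S) (fExs l f).
Proof.
elim: l => //= i l IH /andP[il ul] /andP[iK lK] lS sf.
apply: scoped_Ex => //; first by rewrite mem_cat negb_or il lS ?mem_head.
by apply: IH => // j jl; apply: lS; rewrite inE jl orbT.
Qed.

End Formulas.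

(** * Entries and their annotations in the logic *)

Section EntryFormulas.
Variables (C : finType) (c0 : C).
Let B : Type := (letter * C)%type.
Implicit Types (u : seq (letter * C)) (v : nat -> nat).

Definition lift_item (a : item letter) : item (letter * C) :=
  match a with
  | One ml mr p => One ml mr (fun x y => p (omap fst x) (omap fst y))
  | Star ml mr p => Star ml mr (fun x y => p (omap fst x) (omap fst y))
  end.

Lemma pmatch_lift ps (s t : seq (letter * C)) :
  pmatch (map lift_item ps) s t = pmatch ps (unzip1 s) (unzip1 t).
Proof.
have ohd (r : seq (letter * C)) : omap fst (ohead r) = ohead (unzip1 r) by case: r.
have advE m (r : seq (letter * C)) : unzip1 (adv m r) = adv m (unzip1 r).
  by case: m; case: r.
elim: ps s t => [|[ml mr p|ml mr p] ps IH] s t //=.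
  by rewrite IH !advE -!ohd.
rewrite IH !size_map.
have -> n r r' : star ml mr p n (unzip1 r) (unzip1 r') =
    (unzip1 (star ml mr (fun x y => p (omap fst x) (omap fst y)) n r r').1,
     unzip1 (star ml mr (fun x y => p (omap fst x) (omap fst y)) n r r').2).
  elim: n r r' => //= n IHn r r'.
  have -> : goes ml mr p (ohead (unzip1 r)) (ohead (unzip1 r')) =
      goes ml mr (fun x y => p (omap fst x) (omap fst y)) (ohead r) (ohead r').
    by case: (r); case: (r').
  case: ifP => // _; rewrite -IHn.
  by case: (ml); case: (mr); case: (r) => [|? ?]; case: (r').
by [].
Qed.

(** Variable 3 is never quantified in what follows: its head rests at position 0 and fills the
    second place of patterns that read with the left head only. *)
Definition W (ps : seq (item letter)) (i : nat) : fo (letter * C) :=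
  Pat (map lift_item ps) i 3.
Definition W2 (ps : seq (item letter)) (i j : nat) : fo (letter * C) :=
  Pat (map lift_item ps) i j.
Definition fColour (P : pred C) (i : nat) : fo (letter * C) :=
  Pat [:: One false false (fun x _ => if x is Some b then P b.2 else false)] i 3.
Definition fColours (P : C -> C -> bool) (i j : nat) : fo (letter * C) :=
  Pat [:: One false false (fun x y => match x, y with
                                      | Some b, Some b' => P b.2 b'.2
                                      | _, _ => false
                                      end)] i j.
(** Two heads advancing in step reach the end together exactly if they started at the same
    position. *)
Definition fSame (i j : nat) : fo (letter * C) :=
  Pat [:: Star true true (fun x y => isSome x && isSome y);
          One false false (fun x y => ~~ isSome x && ~~ isSome y)] i j.

Definition fEach (i : nat) (f : fo (letter * C)) : fo (letter * C) :=
  fAll i (fImp (W [:: here true is_entry] i) f).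
Definition fConcept (i : nat) := W [:: here true is_concept] i.
Definition fRole (i : nat) := W [:: here true is_role] i.
Definition fHas (b : bool) (i : nat) : fo (letter * C) :=
  if b then fRole i else W [:: here true is_entry] i.
(** Field 0 is the concept or role name, so argument [b] is field [b.+1], with [b] read as 0 or
    1. *)
Definition fArg (b : bool) (a : NI) (i : nat) := Conj (fHas b i) (W (field_is b.+1 a) i).
Definition fArgs (b b' : bool) (i j : nat) :=
  fAnd [:: fHas b i; fHas b' j; W2 (field_eq b.+1 b'.+1) i j].
Definition fWeight (m i : nat) : fo (letter * C) :=
  fOr [:: Conj (fConcept i) (W (weight_is 2 m) i); Conj (fRole i) (W (weight_is 3 m) i)].
Definition fFact (i j : nat) : fo (letter * C) :=
  fOr [:: fAnd [:: fConcept i; fConcept j; W2 (field_eq 0 0) i j; W2 (field_eq 1 1) i j];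
          fAnd [:: fRole i; fRole j; W2 (field_eq 0 0) i j; W2 (field_eq 1 1) i j;
                   W2 (field_eq 2 2) i j]].

Lemma star_both (D : Type) n (s t : seq D) :
  size s <= n -> let st := star true true (fun x y => isSome x && isSome y) n s t in
  ~~ isSome (ohead st.1) && ~~ isSome (ohead st.2) = (size s == size t).
Proof. by elim: n s t => [|n IH] [|x s] [|y t] //= le; apply: IH. Qed.

Lemma sem_Same i j u v : v i <= size u -> v j <= size u ->
  sem (fSame i j) u v = (v i == v j).
Proof.
move=> iu ju; rewrite /= andbT star_both ?leq_addr // !size_drop.
by apply/eqP/eqP; lia.
Qed.

Section Words.
Variables (s : wabox) (u : seq (letter * C)).
Hypothesis us : unzip1 u = enc_wabox s.

Definition hue_at (i : nat) : C := odflt c0 (omap snd (onth u (offset s i))).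

Lemma size_u : size u = size (enc_wabox s).
Proof. by rewrite -us size_map. Qed.

Lemma onth_u y : omap fst (onth u y) = onth (enc_wabox s) y.
Proof. by rewrite -us onth_map. Qed.

Lemma sem_W ps i v x : x < size s -> v i = offset s x ->
  sem (W ps i) u v = pmatch ps (enc_entry (fact_at s x, weight_at s x) ++ enc_wabox (drop x.+1 s))
    (drop (v 3) (enc_wabox s)).
Proof.
by move=> xs vi; rewrite /= pmatch_lift /unzip1 !map_drop -/unzip1 us vi drop_offset_nth.
Qed.

Lemma sem_W2 ps i j v x y : x < size s -> v i = offset s x -> y < size s -> v j = offset s y ->
  sem (W2 ps i j) u v =
  pmatch ps (enc_entry (fact_at s x, weight_at s x) ++ enc_wabox (drop x.+1 s))
    (enc_entry (fact_at s y, weight_at s y) ++ enc_wabox (drop y.+1 s)).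
Proof.
by move=> xs vi ys vj; rewrite /= pmatch_lift /unzip1 !map_drop -/unzip1 us vi vj !drop_offset_nth.
Qed.

Lemma sem_here p i v : sem (W [:: here true p] i) u v = p (onth (enc_wabox s) (v i)).
Proof. by rewrite /= andbT ohead_drop onth_u. Qed.

Lemma sem_Concept i v x : x < size s -> v i = offset s x ->
  sem (fConcept i) u v = if fact_at s x is Defs.AC _ _ then true else false.
Proof. by move=> xs vi; rewrite sem_here vi onth_offset //; case: fact_at. Qed.

Lemma sem_Role i v x : x < size s -> v i = offset s x ->
  sem (fRole i) u v = if fact_at s x is AR _ _ _ then true else false.
Proof. by move=> xs vi; rewrite sem_here vi onth_offset //; case: fact_at. Qed.

Lemma sem_Has b i v x : x < size s -> v i = offset s x ->
  sem (fHas b i) u v = isSome (argument (fact_at s x) b).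
Proof.
move=> xs vi; case: b; first by rewrite (sem_Role xs vi); case: fact_at.
by rewrite sem_here vi onth_offset // is_entry_opener; case: fact_at.
Qed.

Lemma argument_field f b a : argument f b = Some a ->
  b.+1 < size (fields f) /\ nth 0 (fields f) b.+1 = a.
Proof. by case: f => [A x|r x y]; case: b => //= -[<-]. Qed.

Lemma sem_Arg b a i v x : x < size s -> v i = offset s x ->
  sem (fArg b a i) u v <-> argument (fact_at s x) b = Some a.
Proof.
move=> xs vi; rewrite -[sem _ _ _]/(sem (fHas b i) u v && sem (W _ i) u v).
rewrite (sem_Has _ xs vi); case E: argument => [a'|]; last by split.
have [lt <-] := argument_field E.
rewrite andTb (sem_W _ xs vi) pmatch_field_is //.
by split=> [/eqP ->|[->]].
Qed.

Lemma sem_Args b b' i j v x y :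
  x < size s -> v i = offset s x -> y < size s -> v j = offset s y ->
  sem (fArgs b b' i j) u v <-> exists a, occurs s (x, b) a /\ occurs s (y, b') a.
Proof.
move=> xs vi ys vj; rewrite sem_And; cbn [all].
rewrite (sem_Has _ xs vi) (sem_Has _ ys vj) andbT /occurs [(x, b).1]/= [(y, b').1]/=.
rewrite [(x, b).2]/= [(y, b').2]/=.
case E: (argument _ b) => [a|]; last by split=> // -[a [[]]].
case E': (argument _ b') => [a'|]; last by split=> // -[a2 [_ []]].
have [lt Ea] := argument_field E; have [lt' Ea'] := argument_field E'.
rewrite !andTb (sem_W2 _ xs vi ys vj) pmatch_field_eq // Ea Ea'.
by split=> [/eqP ->|[a2 [[_ [->]] [_ [->]]]]]; first exists a'.
Qed.

Lemma sem_Weight m i v x : 0 < m -> x < size s -> v i = offset s x ->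
  sem (fWeight m i) u v = (weight_at s x == Fin m).
Proof.
move=> m0 xs vi; rewrite sem_Or; cbn [has]; rewrite orbF.
have semC f g : sem (Conj f g) u v = sem f u v && sem g u v by [].
rewrite !semC (sem_Concept xs vi) (sem_Role xs vi) !(sem_W _ xs vi).
have er := is_end_wabox (drop x.+1 s).
have wE n : size (fields (fact_at s x)) = n ->
    pmatch (weight_is n m) (enc_entry (fact_at s x, weight_at s x) ++ enc_wabox (drop x.+1 s))
      (drop (v 3) (enc_wabox s)) = (weight_at s x == Fin m).
  by move=> <-; apply: pmatch_weight_is.
move: (wE 2) (wE 3); set p2 := pmatch (weight_is 2 m) _ _.
set p3 := pmatch (weight_is 3 m) _ _; move: p2 p3 => p2 p3.
by case: (fact_at s x) => [A a|r a b] h2 h3; rewrite ?orbF /= ?h2 ?h3.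
Qed.

Lemma sem_Fact i j v x y :
  x < size s -> v i = offset s x -> y < size s -> v j = offset s y ->
  sem (fFact i j) u v = (fact_at s x == fact_at s y).
Proof.
move=> xs vi ys vj; rewrite sem_Or; cbn [has]; rewrite !sem_And; cbn [all]; rewrite orbF !andbT.
rewrite !(sem_Concept xs vi) !(sem_Concept ys vj) !(sem_Role xs vi) !(sem_Role ys vj).
rewrite !(sem_W2 _ xs vi ys vj).
have fE n : n < size (fields (fact_at s x)) -> n < size (fields (fact_at s y)) ->
    pmatch (field_eq n n) (enc_entry (fact_at s x, weight_at s x) ++ enc_wabox (drop x.+1 s))
      (enc_entry (fact_at s y, weight_at s y) ++ enc_wabox (drop y.+1 s)) =
    (nth 0 (fields (fact_at s x)) n == nth 0 (fields (fact_at s y)) n).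
  exact: pmatch_field_eq.
move: (fE 0) (fE 1) (fE 2); set p0 := pmatch (field_eq 0 0) _ _.
set p1 := pmatch (field_eq 1 1) _ _; set p2 := pmatch (field_eq 2 2) _ _.
move: p0 p1 p2 => p0 p1 p2.
case: (fact_at s x) => [A a|r a b]; case: (fact_at s y) => [A' a'|r' a' b'] /= h0 h1 h2;
  rewrite ?h0 ?h1 ?h2 // ?andbF ?orbF; symmetry.
- by apply/eqP/andP => [[-> ->]|[/eqP -> /eqP ->]].
- exact/eqP.
- exact/eqP.
- by apply/eqP/and3P => [[-> -> ->]|[/eqP -> /eqP -> /eqP ->]].
Qed.

Lemma sem_Colour P i v x : x < size s -> v i = offset s x ->
  sem (fColour P i) u v = P (hue_at x).
Proof.
move=> xs vi; rewrite /= andbT ohead_drop vi /hue_at.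
by have := onth_u (offset s x); rewrite onth_offset //; case: onth.
Qed.

Lemma sem_Colours P i j v x y :
  x < size s -> v i = offset s x -> y < size s -> v j = offset s y ->
  sem (fColours P i j) u v = P (hue_at x) (hue_at y).
Proof.
move=> xs vi ys vj; rewrite /= andbT !ohead_drop vi vj /hue_at.
have := onth_u (offset s x); have := onth_u (offset s y); rewrite !onth_offset //.
by case: onth => // b' _; case: onth.
Qed.

Lemma sem_entry i v : v i <= size u ->
  sem (W [:: here true is_entry] i) u v <-> exists2 x, x < size s & v i = offset s x.
Proof.
move=> vu; rewrite sem_here; split=> [/entry_offset //|[x xs ->]].
by rewrite onth_offset // is_entry_opener.
Qed.

Lemma sem_Each i f v :
  sem (fEach i f) u v <-> forall x, x < size s -> sem f u (vset v i (offset s x)).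
Proof.
have vi y : vset v i y i = y by rewrite /vset eqxx.
split=> [/sem_All h x xs|h].
  have le : offset s x <= size u by rewrite size_u offset_size.
  have := h _ le; rewrite sem_Imp => /implyP; apply.
  by apply/sem_entry; rewrite vi //; exists x.
apply/sem_All => y yu; rewrite sem_Imp; apply/implyP => /sem_entry.
by rewrite vi => /(_ yu) [x xs ->]; apply: h.
Qed.

End Words.

Definition fBlock (c : pred (option letter)) (n : nat) : fo (letter * C) :=
  fAll 4 (fImp (W [:: here true c] 4)
    (fOr [:: W (entry_pattern c n true) 4; W (entry_pattern c n false) 4])).

Definition fEncoding : fo (letter * C) :=
  fAnd [:: W2 [:: here true is_end] 3 4; fBlock is_concept 2; fBlock is_role 3;
           fAll 4 (Neg (W trailing_zero 4))].

(** That no assertion is listed twice is not a local condition; it takes a comparison of all pairs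
    of entries. *)
Definition fValid : fo (letter * C) :=
  Conj fEncoding (fEach 4 (fEach 5 (fImp (fFact 4 5) (fSame 4 5)))).

Lemma sem_Encoding u : sem fEncoding u (fun=> 0) <-> locally_valid (unzip1 u).
Proof.
have WE ps x : sem (W ps 4) u (vset (fun=> 0) 4 x) = pmatch ps (drop x (unzip1 u)) (unzip1 u).
  by rewrite /= /vset /= pmatch_lift /unzip1 !map_drop drop0.
have hE c w t y : pmatch [:: here true c] (drop y w) t = c (onth w y).
  by rewrite /= andbT ohead_drop.
have blockE c n : sem (fBlock c n) u (fun=> 0) <->
    forall y, y <= size (unzip1 u) -> c (onth (unzip1 u) y) ->
    pmatch (entry_pattern c n true) (drop y (unzip1 u)) (unzip1 u) ||
    pmatch (entry_pattern c n false) (drop y (unzip1 u)) (unzip1 u).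
  rewrite size_map; split=> [/sem_All h y yu cy|h].
    by have := h y yu; rewrite sem_Imp sem_Or; cbn [has]; rewrite !WE orbF hE => /implyP; apply.
  apply/sem_All => y yu; rewrite sem_Imp sem_Or; cbn [has]; rewrite !WE orbF hE; apply/implyP.
  exact: h.
have bitsE : sem (fAll 4 (Neg (W trailing_zero 4))) u (fun=> 0) <->
    forall y, y <= size (unzip1 u) -> ~~ pmatch trailing_zero (drop y (unzip1 u)) (unzip1 u).
  rewrite size_map; split=> [/sem_All h y yu|h].
    by have := h y yu; rewrite -WE.
  by apply/sem_All => y /h; rewrite -WE.
have startE : sem (W2 [:: here true is_end] 3 4) u (fun=> 0) = is_end (ohead (unzip1 u)).
  by rewrite /= andbT !drop0; case: (u).
rewrite sem_And; cbn [all]; rewrite startE andbT; split.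
  by move=> /and4P[h0 /blockE h1 /blockE h2 /bitsE h3].
by move=> [h0 h1 h2 h3]; apply/and4P; split=> //; [apply/blockE|apply/blockE|apply/bitsE].
Qed.

Section Scopes.
Variable K : nat.
Hypothesis K5 : 4 < K.
Implicit Types (i j : nat) (S : seq nat).

Lemma scoped_W S ps i : 3 < i <= K -> scoped K S (W ps i).
Proof. by move=> h; apply: scoped_Pat; lia. Qed.

Lemma scoped_Colour S P i : 3 < i <= K -> scoped K S (fColour P i).
Proof. by move=> h; apply: scoped_Pat; lia. Qed.

Lemma scoped_Colours S P i j : 3 < i < j -> j <= K -> scoped K S (fColours P i j).
Proof. by move=> h h'; apply: scoped_Pat; lia. Qed.

Lemma scoped_W2 S ps i j : 3 < i < j -> j <= K -> scoped K S (W2 ps i j).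
Proof. by move=> h h'; apply: scoped_Pat; lia. Qed.

Lemma scoped_Same S i j : 3 < i < j -> j <= K -> scoped K S (fSame i j).
Proof. by move=> h h'; apply: scoped_Pat; lia. Qed.

Lemma scoped_Concept S i : 3 < i <= K -> scoped K S (fConcept i).
Proof. exact: scoped_W. Qed.

Lemma scoped_Role S i : 3 < i <= K -> scoped K S (fRole i).
Proof. exact: scoped_W. Qed.

Lemma scoped_Has S b i : 3 < i <= K -> scoped K S (fHas b i).
Proof. by move=> h; case: b; apply: scoped_W. Qed.

Lemma scoped_Arg S b a i : 3 < i <= K -> scoped K S (fArg b a i).
Proof. by move=> h; apply: scoped_Conj; [apply: scoped_Has | apply: scoped_W]. Qed.

Lemma scoped_Args S b b' i j : 3 < i < j -> j <= K -> scoped K S (fArgs b b' i j).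
Proof.
move=> h h'; rewrite /fArgs; apply: scoped_And => //; cbn [all].
by rewrite !scoped_Has ?scoped_W2 //; lia.
Qed.

Lemma scoped_Fact S i j : 3 < i < j -> j <= K -> scoped K S (fFact i j).
Proof.
move=> h h'; rewrite /fFact; apply: scoped_Or => //; cbn [all]; rewrite andbT.
apply/andP; split; apply: scoped_And => //; cbn [all];
by rewrite ?scoped_Concept ?scoped_Role ?scoped_W2 //; lia.
Qed.

Lemma scoped_All S i (f : fo (letter * C)) : 2 < i <= K -> i \notin S -> scoped K S f ->
  scoped K (i :: S) (fAll i f).
Proof. by move=> h iS sf; apply/scoped_Neg/scoped_Ex. Qed.

Lemma scoped_Each S i (f : fo (letter * C)) : 3 < i <= K -> i \notin S -> scoped K S f ->
  scoped K (i :: S) (fEach i f).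
Proof.
move=> h iS sf; apply: scoped_All => //; first by lia.
by apply: scoped_Imp => //; apply: scoped_W.
Qed.

Lemma scoped_And_map (A : eqType) S (f : A -> fo (letter * C)) (l : seq A) :
  (forall x, x \in l -> scoped K S (f x)) -> scoped K S (fAnd [seq f x | x <- l]).
Proof. by move=> h; apply: scoped_And => //; rewrite all_map; apply/allP. Qed.

Lemma scoped_Valid : scoped K [:: 4; 5] fValid.
Proof.
have k4 : 3 < 4 <= K by lia.
have k5 : 3 < 5 <= K by lia.
have sub4 (f : fo (letter * C)) : scoped K [:: 4] f -> scoped K [:: 4; 5] f.
  by apply: scoped_sub => i; rewrite !inE => ->.
apply: scoped_Conj; last first.
  apply: scoped_Each => //; apply: scoped_Each => //.
  by apply: scoped_Imp; [apply: scoped_Fact | apply: scoped_Same].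
have block c n : scoped K [:: 4; 5] (fBlock c n).
  apply/sub4/scoped_All => //.
  apply: scoped_Imp => //; first by apply: scoped_W.
  by apply: scoped_Or => //; cbn [all]; rewrite !scoped_W.
rewrite /fEncoding; apply: scoped_And => //; cbn [all]; rewrite !block !andTb andbT; apply/andP; split.
  by apply: scoped_Pat => //; lia.
by apply/sub4/scoped_All => //; apply/scoped_Neg/scoped_W.
Qed.

End Scopes.

Lemma sem_Valid u :
  sem fValid u (fun=> 0) <-> exists2 s : wabox, unzip1 u = enc_wabox s & weighting s.
Proof.
have -> : sem fValid u (fun=> 0) = sem fEncoding u (fun=> 0) &&
    sem (fEach 4 (fEach 5 (fImp (fFact 4 5) (fSame 4 5)))) u (fun=> 0) by [].
have uniqE s : unzip1 u = enc_wabox s ->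
    sem (fEach 4 (fEach 5 (fImp (fFact 4 5) (fSame 4 5)))) u (fun=> 0) <->
    uniq [seq p.1 | p <- s].
  move=> us; have body x y : x < size s -> y < size s ->
      sem (fImp (fFact 4 5) (fSame 4 5)) u
        (vset (vset (fun=> 0) 4 (offset s x)) 5 (offset s y)) =
      ((fact_at s x == fact_at s y) ==> (x == y)).
    move=> xs ys; rewrite sem_Imp (sem_Fact us xs _ ys) // sem_Same;
      try by rewrite /vset /= (size_u us) offset_size.
    by rewrite /vset /=; congr (_ ==> _); apply/eqP/eqP => [/(offset_inj xs ys)|->].
  have nthE x : x < size s -> nth (entry0.1) [seq p.1 | p <- s] x = fact_at s x.
    by move=> xs; rewrite (nth_map entry0).
  split=> [h|un].
    apply/(uniqP (entry0.1)) => x y; rewrite !inE !size_map => xs ys.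
    rewrite !nthE // => E; have /(sem_Each us)/(_ y ys) := (sem_Each us _ _ _).1 h x xs.
    by rewrite body // E eqxx => /eqP.
  apply/(sem_Each us) => x xs; apply/(sem_Each us) => y ys; rewrite body //.
  apply/implyP => /eqP; rewrite -!nthE // => E.
  by rewrite -(nth_uniq (entry0.1) (s := [seq p.1 | p <- s])) ?size_map // E.
split=> [/andP[/sem_Encoding /locally_valid_enc[s us ps] h]|[s us /andP[un ps]]].
  by exists s => //; rewrite /weighting ps andbT; apply: (uniqE s us).1 h.
apply/andP; split; last exact: (uniqE s us).2 un.
by apply/sem_Encoding; rewrite us; apply: enc_locally_valid.
Qed.

End EntryFormulas.

(** * Certified colourings as a formula *)

Section Core.
Variables (T : wtbox) (q : bcq) (k : nat).

Local Notation cl := (relevant_concepts T q).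
Local Notation rr := (relevant_roles T q).
Local Notation nm := (relevant_inds T q).
Local Notation nt := (size (bcq_terms q)).
Local Notation slot := 'I_(slots T q k).
Local Notation pointed := (pointed T q k).
Local Notation colour := (colour T q k).

(* The annotation of an entry: its cost units and the colours of its arguments. *)
Definition annotation : finType := ({set 'I_k} * colour * colour)%type.

Definition tint (b : bool) (x : annotation) : colour := if b then x.2 else x.1.2.

Definition free (x : annotation) : bool := x.1.1 == finset.set0.

Variables (rep : colour -> pointed) (x0 : pointed) (c : nat) (m : bool).

Local Notation F := (fo (letter * annotation)).
Local Notation hued b x := (rep (tint b x)).

Definition spreads : seq (spread T q k) :=
  [seq val d | d <- enum {: nt.-tuple (option (slot + 'I_nt * bool))} &
               `[< valid_spread (val d : spread T q k) >]].

Definition fPairs (f : bool -> bool -> F) : F :=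
  fAnd [seq fEach 4 (fEach 5 (f p.1 p.2)) | p <- enum {: bool * bool}].

Definition fGood : F :=
  fAnd [seq fEach 4 (fImp (fHas _ b 4) (fColour (fun x =>
          `[< good (hued b x) /\ same_globals (hued b x) x0 >]) 4)) | b <- enum {: bool}].

Definition fColourOK : F :=
  fPairs (fun b b' => fImp (fArgs _ b b' 4 5)
    (fColours (fun x y => tint b x == tint b' y) 4 5)).

Definition at_slot (b : bool) (j : slot) (x : annotation) : bool :=
  `[< sg (hued b x) j = Some (pt (hued b x)) >].

Definition fNamed : F :=
  fAnd [seq fEach 4 (fImp (fHas _ b.1 4)
          (fAnd [:: fImp (fColour (at_slot b.1 b.2) 4) (fArg _ b.1 (nth 0 nm b.2) 4);
                    fImp (fArg _ b.1 (nth 0 nm b.2) 4) (fColour (at_slot b.1 b.2) 4)]))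
       | b : bool * slot <- enum {: bool * slot} & b.2 < size nm].

Definition fInj : F :=
  fPairs (fun b b' => fImp (fAnd [:: fHas _ b 4; fHas _ b' 5;
      fColours (fun x y => [exists j, at_slot b j x && at_slot b' j y]) 4 5])
    (fArgs _ b b' 4 5)).

Definition fAtom (C : concept) : F :=
  if C is CAtom A then
    fImp (W _ (field_is 0 A) 4) (fColour (fun x => `[< holds (LExt C) (hued false x) >]) 4)
  else fTrue _.

Definition fConcepts : F :=
  fEach 4 (fImp (Conj (fConcept _ 4) (fColour free 4))
    (fAnd [seq fAtom C | C <- cl])).

Definition fRoles : F :=
  fEach 4 (fImp (Conj (fRole _ 4) (fColour free 4))
    (fAnd [seq fImp (W _ (field_is 0 r) 4)
                 (fColour (fun x => `[< role_fits r (hued false x) (hued true x) >]) 4)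
          | r <- rr])).

(** A pattern needs two different variables, so the two arguments of one entry are compared through
    two variables that [fSame] forces onto that entry. *)
Definition fLoops : F :=
  fEach 4 (fEach 5 (fImp (fAnd [:: fSame _ 4 5; fRole _ 4; fColour free 4;
                                   fArgs _ false true 4 5])
    (fAnd [seq fImp (W _ (field_is 0 r) 4)
                 (fColour (fun x => `[< holds (LLoop r) (hued false x) >]) 4)
          | r <- rr]))).

Definition fDisjoint : F :=
  fEach 4 (fEach 5 (fImp
    (fColours (fun x y : annotation => [exists z, (z \in x.1.1) && (z \in y.1.1)]) 4 5)
    (fSame _ 4 5))).

(** A set of units has at most [k] elements, so comparing with the weights 1 to [k] is enough,
    however long the binary weights of the input are. *)
Definition fWeights : F :=
  fEach 4 (fAnd [seq fImp (fColour (fun x : annotation => #|x.1.1| == n) 4) (fWeight _ n 4)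
                | n <- iota 1 k]).

Definition fCost : F :=
  fEach 4 (fColour (fun x : annotation => [forall z, (z \in x.1.1) ==> (z < k - c)]) 4).

Section NoMatch.
Variables (d : spread T q k) (e : 'I_nt -> bool).

(** The entry chosen for block [b] sits at variable [10 + b], clear of 4 and 5. Which of its
    arguments is meant is fixed by [e], which ranges over finitely many functions outside the
    formula. *)
Definition fPiece (b : 'I_nt) : F :=
  if has_point d b then
    fAnd [:: W _ [:: here true is_entry] (10 + b); fHas _ (e b) (10 + b);
             fColour (fun x => `[< holds (FMatch (piece d b)) (hued (e b) x) >]) (10 + b)]
  else fBool _ `[< holds (FMatch (piece d b)) x0 >].

Definition fEdge (r : NR) (b b' : 'I_nt) : F :=
  Ex 4 (fAnd [:: W _ [:: here true is_entry] 4; fRole _ 4; fColour free 4;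
                 W _ (field_is 0 r) 4;
                 fArgs _ false (e b) 4 (10 + b); fArgs _ true (e b') 4 (10 + b')]).

Definition fCross (u : atom) : F :=
  if u is QR r t t' then
    match place_of q d t, place_of q d t' with
    | Some (inr (b, f)), Some (inr (b', f')) =>
        if b == b' then fTrue _ else
        if f && f' then fEdge r b b' else Neg (fTrue _)
    | _, _ => fTrue _
    end
  else fTrue _.

Definition fNoMatch : F :=
  Neg (fExs (iota 10 nt) (Conj (fAnd [seq fPiece b | b <- enum 'I_nt])
                               (fAnd [seq fCross u | u <- q]))).

End NoMatch.

Definition fMatch : F :=
  if m then fTrue _ else
  fAnd [seq fAnd [seq fNoMatch d e | e : {ffun 'I_nt -> bool} <- enum {ffun 'I_nt -> bool}]
       | d <- spreads].

Definition fCore : F :=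
  fAnd [:: fBool _ `[< [/\ good x0, tcost T (carrier x0) = Fin c, c <= k &
                           m -> some_match x0] >];
           fGood; fColourOK; fNamed; fInj; fConcepts; fRoles; fLoops; fDisjoint;
           fWeights; fCost; fMatch].

Definition fCore_vars : nat := 10 + nt.

Lemma scoped_core : scoped fCore_vars (iota 10 nt ++ [:: 4; 5]) fCore.
Proof.
set K := fCore_vars; have K4 : 4 < K by [].
have k4 : 3 < 4 <= K by [].
have k5 : 3 < 5 <= K by [].
have sub S (f : F) : {subset S <= [:: 4; 5]} -> scoped K S f ->
    scoped K (iota 10 nt ++ [:: 4; 5]) f.
  by move=> SS; apply: scoped_sub => i /SS h; rewrite mem_cat h orbT.
have each (f : F) : scoped K [::] f -> scoped K (iota 10 nt ++ [:: 4; 5]) (fEach 4 f).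
  move=> sf; apply: (sub [:: 4]); first by move=> i; rewrite !inE => ->.
  by apply: scoped_Each.
have each2 (f : F) : scoped K [::] f ->
    scoped K (iota 10 nt ++ [:: 4; 5]) (fEach 4 (fEach 5 f)).
  by move=> sf; apply: (sub [:: 4; 5]) => //; do 2!apply: scoped_Each => //.
have pairs (f : bool -> bool -> F) : (forall b b', scoped K [::] (f b b')) ->
    scoped K (iota 10 nt ++ [:: 4; 5]) (fPairs f).
  by move=> sf; apply: scoped_And_map => // -[b b'] _; apply: each2.
have col P S : scoped K S (fColour P 4) by apply: scoped_Colour.
have cols P S : scoped K S (fColours P 4 5) by apply: scoped_Colours.
have w ps S : scoped K S (W annotation ps 4) by apply: scoped_W.
have args b b' S : scoped K S (fArgs annotation b b' 4 5) by apply: scoped_Args.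
have has b S : scoped K S (fHas annotation b 4) by apply: scoped_Has.
have same S : scoped K S (fSame annotation 4 5) by apply: scoped_Same.
have tr S : scoped K S (fTrue (letter * annotation)) by apply: scoped_True.
rewrite /fCore; apply: scoped_And => //; cbn [all]; rewrite andbT; apply/and4P; split.
- exact: scoped_Bool.
- by apply: scoped_And_map => // b _; apply: each; apply: scoped_Imp.
- by apply: pairs => b b'; apply: scoped_Imp.
apply/and5P; split.
- apply: scoped_And_map => // b _; apply: each; apply: scoped_Imp => //.
  have sa : scoped K [::] (fArg annotation b.1 (nth 0 nm b.2) 4) by apply: scoped_Arg.
  by apply: scoped_And => //; cbn [all]; rewrite !scoped_Imp.
- apply: pairs => b b'; apply: scoped_Imp => //; apply: scoped_And => //; cbn [all].
  by rewrite cols !andbT; apply/andP; split; apply: scoped_Has.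
- apply: each; apply: scoped_Imp; first by apply: scoped_Conj.
  by apply: scoped_And_map => // C _; case: C => // A; apply: scoped_Imp.
- apply: each; apply: scoped_Imp; first by apply: scoped_Conj.
  by apply: scoped_And_map => // r _; apply: scoped_Imp.
apply/and5P; split.
- apply: each2; apply: scoped_Imp; first by apply: scoped_And => //; cbn [all]; rewrite same args col w.
  by apply: scoped_And_map => // r _; apply: scoped_Imp.
- by apply: each2; apply: scoped_Imp.
- by apply: each; apply: scoped_And_map.
- exact: each.
rewrite /fMatch; case: ifP => // _; apply: scoped_And_map => // d _.
apply: scoped_And_map => // e _; apply/scoped_Neg/scoped_Exs.
- exact: iota_uniq.
- by apply/allP => i; rewrite mem_iota /K /fCore_vars; lia.
- by move=> i; rewrite mem_iota !inE; lia.
have vK (b : 'I_nt) : 3 < 10 + b <= K.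
  by have := ltn_ord b; rewrite /K /fCore_vars; lia.
apply: scoped_Conj; apply: scoped_And_map => //.
  move=> b _; rewrite /fPiece; case: ifP => _; last exact: scoped_Bool.
  by apply: scoped_And => //; cbn [all]; rewrite scoped_W ?scoped_Has ?scoped_Colour.
have edge r b b' : scoped K [:: 4; 5] (fEdge e r b b').
  have vb : 3 < 4 < 10 + b by [].
  have vb' : 3 < 4 < 10 + b' by [].
  apply: (scoped_sub (S := [:: 4])); first by move=> i; rewrite !inE => ->.
  apply: scoped_Ex => //; apply: scoped_And => //; cbn [all].
  rewrite !w col !scoped_Args //; try by case/andP: (vK b).
  by case/andP: (vK b').
move=> [A t|r t t'] _ //; rewrite /fCross.
case: (place_of q d t) => [[j|[b f]]|] //; case: (place_of q d t') => [[j'|[b' f']]|] //.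
by case: ifP => // _; case: ifP => // _; apply: scoped_Neg.
Qed.

(* Keeps unification from comparing unfolded formulas. *)
Local Opaque W W2 fColour fColours fSame fConcept fRole fHas fArg fArgs fWeight fImp fAnd
  fOr fAll fEach fBool fExs.

Section Semantics.
Variables (s : wabox) (u : seq (letter * annotation)).
Hypothesis us : unzip1 u = enc_wabox s.
Variable g0 : annotation.

Definition note (i : nat) : annotation := hue_at g0 s u i.
Definition note_units (i : nat) : {set 'I_k} := (note i).1.1.
Definition note_hue (o : nat * bool) : pointed := rep (tint o.2 (note o.1)).

Let v4 (x : nat) : nat -> nat := vset (fun=> 0) 4 (offset s x).
Let v5 (x y : nat) : nat -> nat := vset (v4 x) 5 (offset s y).

Lemma sem_Each4 (f : F) :
  sem (fEach 4 f) u (fun=> 0) <-> forall x, x < size s -> sem f u (v4 x).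
Proof. exact: sem_Each us _ _ _. Qed.

Lemma sem_Each45 (f : F) :
  sem (fEach 4 (fEach 5 f)) u (fun=> 0) <->
  forall x y, x < size s -> y < size s -> sem f u (v5 x y).
Proof.
split=> [/sem_Each4 h x y xs ys|h].
  exact: (sem_Each us _ _ _).1 (h x xs) y ys.
by apply/sem_Each4 => x xs; apply/(sem_Each us) => y ys; apply: h.
Qed.

Lemma sem_Pairs (f : bool -> bool -> F) :
  sem (fPairs f) u (fun=> 0) <->
  forall b b' x y, x < size s -> y < size s -> sem (f b b') u (v5 x y).
Proof.
split=> [/sem_And_map h b b'|h].
  by move: (h (b, b') (mem_enum _ _)) => /sem_Each45.
by apply/sem_And_map => -[b b'] _; apply/sem_Each45 => x y xs ys; apply: h.
Qed.

Let e4 x : v4 x 4 = offset s x. Proof. by []. Qed.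
Let e54 x y : v5 x y 4 = offset s x. Proof. by []. Qed.
Let e55 x y : v5 x y 5 = offset s y. Proof. by []. Qed.

Lemma sem_Same45 x y : x < size s -> y < size s -> sem (fSame _ 4 5) u (v5 x y) = (x == y).
Proof.
move=> xs ys; rewrite sem_Same; try by rewrite (size_u us) ?e54 ?e55 offset_size.
by rewrite e54 e55; apply/eqP/eqP => [/(offset_inj xs ys)|->].
Qed.

Lemma occursE x b : x < size s ->
  isSome (argument (fact_at s x) b) <-> exists a, occurs s (x, b) a.
Proof.
rewrite /occurs /=; case: argument => [a|] xs; split=> //; first by exists a.
by move=> [a [_]].
Qed.

Lemma sem_Good : sem fGood u (fun=> 0) <->
  forall o a, occurs s o a -> good (note_hue o) /\ same_globals (note_hue o) x0.
Proof.
split=> [/sem_And_map h [x b] a oa|h].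
  have [/= xs _] := oa; move: (h b (mem_enum _ _)) => /sem_Each4/(_ x xs).
  rewrite sem_Imp (sem_Has us _ xs (e4 x)) (sem_Colour g0 us _ xs (e4 x)) => /implyP h'.
  by apply/asboolP; apply: h'; apply/occursE => //; exists a.
apply/sem_And_map => b _; apply/sem_Each4 => x xs.
rewrite sem_Imp (sem_Has us _ xs (e4 x)) (sem_Colour g0 us _ xs (e4 x)).
by apply/implyP => /(occursE b xs)[a oa]; apply/asboolP; apply: h oa.
Qed.

Lemma sem_ColourOK : sem fColourOK u (fun=> 0) <->
  forall x b y b' a, occurs s (x, b) a -> occurs s (y, b') a ->
    tint b (note x) = tint b' (note y).
Proof.
split=> [/sem_Pairs h x b y b' a oa oa'|h].
  have [/= xs _] := oa; have [/= ys _] := oa'; have := h b b' x y xs ys.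
  rewrite sem_Imp (sem_Colours g0 us _ xs (e54 x y) ys (e55 x y)) => /implyP h'.
  by apply/eqP; apply: h'; apply/(sem_Args us _ _ xs (e54 x y) ys (e55 x y)); exists a.
apply/sem_Pairs => b b' x y xs ys.
rewrite sem_Imp (sem_Colours g0 us _ xs (e54 x y) ys (e55 x y)); apply/implyP.
move=> /(sem_Args us _ _ xs (e54 x y) ys (e55 x y)) [a [oa oa']].
by apply/eqP; apply: h oa oa'.
Qed.

Lemma sem_Named : sem fNamed u (fun=> 0) <->
  forall o a (j : slot), occurs s o a -> j < size nm ->
    (sg (note_hue o) j = Some (pt (note_hue o)) <-> a = nth 0 nm j).
Proof.
split=> [/sem_And_map h [x b] a j oa jn|h].
  have [/= xs ax] := oa.
  have bj : (b, j) \in [seq b : bool * slot <- enum {: bool * slot} | b.2 < size nm].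
    by rewrite mem_filter jn mem_enum.
  move: (h _ bj) => /sem_Each4/(_ x xs).
  rewrite sem_Imp (sem_Has us _ xs (e4 x)) ax sem_And; cbn [all]; rewrite !sem_Imp.
  rewrite (sem_Colour g0 us _ xs (e4 x)) andbT => /= /andP[/implyP h1 /implyP h2].
  split=> [sj|aj].
    have /(sem_Arg us _ _ xs (e4 x)) := h1 ltac:(exact/asboolP).
    by rewrite ax => -[].
  by apply/asboolP; apply: h2; apply/(sem_Arg us _ _ xs (e4 x)); rewrite ax aj.
apply/sem_And_map => -[b j]; rewrite mem_filter => /andP[jn _]; apply/sem_Each4 => x xs.
rewrite sem_Imp (sem_Has us _ xs (e4 x)); apply/implyP => /(occursE b xs)[a oa].
rewrite sem_And; cbn [all]; rewrite !sem_Imp (sem_Colour g0 us _ xs (e4 x)) andbT.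
have {}h := h (x, b) a j oa jn; have [_ /= ax] := oa.
apply/andP; split; apply/implyP.
  by move=> /asboolP /h aj; apply/(sem_Arg us _ _ xs (e4 x)); rewrite ax aj.
by move=> /(sem_Arg us _ _ xs (e4 x)); rewrite ax => -[/h ?]; apply/asboolP.
Qed.

Lemma sem_Inj : sem fInj u (fun=> 0) <->
  forall o o' a a' j, occurs s o a -> occurs s o' a' ->
    sg (note_hue o) j = Some (pt (note_hue o)) ->
    sg (note_hue o') j = Some (pt (note_hue o')) -> a = a'.
Proof.
split=> [/sem_Pairs h [x b] [y b'] a a' j oa oa' sj sj'|h].
  have [/= xs ax] := oa; have [/= ys ay] := oa'; have := h b b' x y xs ys.
  rewrite sem_Imp sem_And; cbn [all].
  rewrite (sem_Has us _ xs (e54 x y)) (sem_Has us _ ys (e55 x y)) ax ay.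
  rewrite (sem_Colours g0 us _ xs (e54 x y) ys (e55 x y)) /= andbT => /implyP h'.
  have /(sem_Args us _ _ xs (e54 x y) ys (e55 x y)) [a2 [[_ /=]]] :
      sem (fArgs _ b b' 4 5) u (v5 x y).
    by apply: h'; apply/existsP; exists j; apply/andP; split; apply/asboolP.
  by rewrite ax => -[->] [_ /=]; rewrite ay => -[->].
apply/sem_Pairs => b b' x y xs ys; rewrite sem_Imp sem_And; cbn [all].
rewrite (sem_Has us _ xs (e54 x y)) (sem_Has us _ ys (e55 x y)).
rewrite (sem_Colours g0 us _ xs (e54 x y) ys (e55 x y)) andbT; apply/implyP.
move=> /and3P[/(occursE b xs)[a oa] /(occursE b' ys)[a' oa']].
move=> /existsP[j /andP[/asboolP sj /asboolP sj']].
have aa' := h _ _ _ _ j oa oa' sj sj'; subst a'.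
by apply/(sem_Args us _ _ xs (e54 x y) ys (e55 x y)); exists a.
Qed.

Lemma satisfiedE x : x < size s -> free (note x) <-> satisfied s note_units x.
Proof. by move=> xs; split=> [/eqP|[_ h]]; [split | apply/eqP]. Qed.

Lemma sem_True v : sem (fTrue (letter * annotation)) u v.
Proof. by []. Qed.

Lemma sem_Field0 a v x i : x < size s -> v i = offset s x ->
  sem (W annotation (field_is 0 a) i) u v = (nth 0 (fields (fact_at s x)) 0 == a).
Proof. by move=> xs vi; rewrite (sem_W us _ xs vi) pmatch_field_is //; case: fact_at. Qed.

Lemma sem_Concepts : sem fConcepts u (fun=> 0) <->
  forall i A a, satisfied s note_units i -> fact_at s i = Defs.AC A a -> CAtom A \in cl ->
    holds (LExt (CAtom A)) (note_hue (i, false)).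
Proof.
have semC (f g : F) v : sem (Conj f g) u v = sem f u v && sem g u v by [].
have atomE A x : x < size s -> sem (fAtom (CAtom A)) u (v4 x) =
    ((nth 0 (fields (fact_at s x)) 0 == A) ==> `[< holds (LExt (CAtom A)) (note_hue (x, false)) >]).
  move=> xs; rewrite -[fAtom _]/(fImp _ _) sem_Imp (sem_Field0 _ xs (e4 x)).
  by rewrite (sem_Colour g0 us _ xs (e4 x)).
split=> [/sem_Each4 h x A a si Ex Acl|h].
  have [xs _] := si; have := h x xs; rewrite sem_Imp semC (sem_Concept us xs (e4 x)).
  rewrite (sem_Colour g0 us _ xs (e4 x)) Ex => /implyP H.
  move: (H ((satisfiedE xs).2 si)) => /sem_And_map /(_ _ Acl).
  by rewrite atomE // Ex eqxx => /asboolP.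
apply/sem_Each4 => x xs; rewrite sem_Imp semC (sem_Concept us xs (e4 x)).
rewrite (sem_Colour g0 us _ xs (e4 x)); apply/implyP => /andP[cx /(satisfiedE xs) si].
apply/sem_And_map => C Ccl; case: C Ccl => [A|a|||C D|C D|C|r C|r C] Ccl;
  try exact: sem_True.
rewrite atomE //; apply/implyP => /eqP EA; apply/asboolP.
case Ex: (fact_at s x) cx EA => [A' a|] // _ /= EA; subst A'.
exact: h si Ex Ccl.
Qed.

Lemma sem_Roles : sem fRoles u (fun=> 0) <->
  forall i r a b, satisfied s note_units i -> fact_at s i = AR r a b -> r \in rr ->
    role_fits r (note_hue (i, false)) (note_hue (i, true)).
Proof.
have semC (f g : F) v : sem (Conj f g) u v = sem f u v && sem g u v by [].
split=> [/sem_Each4 h x r a b si Ex rrr|h].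
  have [xs _] := si; have := h x xs; rewrite sem_Imp semC (sem_Role us xs (e4 x)).
  rewrite (sem_Colour g0 us _ xs (e4 x)) Ex => /implyP H.
  move: (H ((satisfiedE xs).2 si)) => /sem_And_map /(_ _ rrr).
  rewrite sem_Imp (sem_Field0 _ xs (e4 x)) Ex eqxx (sem_Colour g0 us _ xs (e4 x)).
  by move=> /asboolP.
apply/sem_Each4 => x xs; rewrite sem_Imp semC (sem_Role us xs (e4 x)).
rewrite (sem_Colour g0 us _ xs (e4 x)); apply/implyP => /andP[cx /(satisfiedE xs) si].
apply/sem_And_map => r rrr; rewrite sem_Imp (sem_Field0 _ xs (e4 x)).
rewrite (sem_Colour g0 us _ xs (e4 x)); apply/implyP => /eqP Er; apply/asboolP.
case Ex: (fact_at s x) cx Er => [|r' a b] // _ /= Er; subst r'.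
exact: h si Ex rrr.
Qed.

Lemma sem_Loops : sem fLoops u (fun=> 0) <->
  forall i r a, satisfied s note_units i -> fact_at s i = AR r a a -> r \in rr ->
    holds (LLoop r) (note_hue (i, false)).
Proof.
split=> [/sem_Each45 h x r a si Ex rrr|h].
  have [xs _] := si; have := h x x xs xs; rewrite sem_Imp sem_And; cbn [all].
  rewrite sem_Same45 // eqxx (sem_Role us xs (e54 x x)) Ex.
  rewrite (sem_Colour g0 us _ xs (e54 x x)) (satisfiedE xs).2 // => /implyP H.
  have A : sem (fArgs annotation false true 4 5) u (v5 x x).
    by apply/(sem_Args us _ _ xs (e54 x x) xs (e55 x x)); exists a; rewrite /occurs /= Ex.
  rewrite A in H; move: (H isT) => /sem_And_map /(_ _ rrr).
  rewrite sem_Imp (sem_Field0 _ xs (e54 x x)) Ex eqxx (sem_Colour g0 us _ xs (e54 x x)).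
  by move=> /asboolP.
apply/sem_Each45 => x y xs ys; rewrite sem_Imp sem_And; cbn [all].
rewrite sem_Same45 // (sem_Role us xs (e54 x y)) (sem_Colour g0 us _ xs (e54 x y)) andbT.
apply/implyP => /and4P[/eqP xy cx /(satisfiedE xs) si]; subst y.
move=> /(sem_Args us _ _ xs (e54 x x) xs (e55 x x)) [a [[_ /= a1] [_ /= a2]]].
apply/sem_And_map => r rrr; rewrite sem_Imp (sem_Field0 _ xs (e54 x x)).
rewrite (sem_Colour g0 us _ xs (e54 x x)); apply/implyP => /eqP Er; apply/asboolP.
case Ex: (fact_at s x) cx Er a1 a2 => [|r' b b'] // _ /= Er [Eb] [Eb'].
by subst r' b b'; apply: h si Ex rrr.
Qed.

Lemma sem_Disjoint : sem fDisjoint u (fun=> 0) <->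
  forall i j z, i < size s -> j < size s -> z \in note_units i -> z \in note_units j -> i = j.
Proof.
split=> [/sem_Each45 h x y z xs ys zx zy|h].
  have := h x y xs ys; rewrite sem_Imp sem_Same45 //.
  rewrite (sem_Colours g0 us _ xs (e54 x y) ys (e55 x y)) => /implyP H.
  by apply/eqP/H/existsP; exists z; apply/andP.
apply/sem_Each45 => x y xs ys; rewrite sem_Imp sem_Same45 //.
rewrite (sem_Colours g0 us _ xs (e54 x y) ys (e55 x y)); apply/implyP.
by move=> /existsP[z /andP[zx zy]]; apply/eqP; apply: h zx zy.
Qed.

Lemma sem_Weights : sem fWeights u (fun=> 0) <->
  forall i, i < size s -> note_units i != finset.set0 -> weight_at s i = Fin #|note_units i|.
Proof.
split=> [/sem_Each4 h x xs nx|h].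
  have pos : 0 < #|note_units x| by rewrite card_gt0.
  have nk : #|note_units x| \in iota 1 k.
    by rewrite mem_iota pos add1n ltnS -[X in _ <= X]card_ord max_card.
  move: (h x xs) => /sem_And_map/(_ _ nk); rewrite sem_Imp (sem_Colour g0 us _ xs (e4 x)).
  by rewrite eqxx (sem_Weight us pos xs (e4 x)) => /eqP.
apply/sem_Each4 => x xs; apply/sem_And_map => n; rewrite mem_iota => /andP[n0 _].
rewrite sem_Imp (sem_Colour g0 us _ xs (e4 x)) (sem_Weight us n0 xs (e4 x)).
apply/implyP => /eqP En; rewrite h //; first by rewrite [note_units x]/note_units En.
by rewrite -card_gt0 [note_units x]/note_units En.
Qed.

Lemma sem_Cost : sem fCost u (fun=> 0) <->
  forall i z, i < size s -> z \in note_units i -> z < k - c.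
Proof.
split=> [/sem_Each4 h x z xs zx|h].
  have := h x xs; rewrite (sem_Colour g0 us _ xs (e4 x)) => /forallP/(_ z)/implyP.
  by apply.
apply/sem_Each4 => x xs; rewrite (sem_Colour g0 us _ xs (e4 x)).
by apply/forallP => z; apply/implyP => zx; apply: h xs zx.
Qed.

Lemma sem_Edge (e : 'I_nt -> bool) r (b b' : 'I_nt) v :
  v (10 + b) <= size u -> v (10 + b') <= size u ->
  forall x x', x < size s -> v (10 + b) = offset s x -> x' < size s -> v (10 + b') = offset s x' ->
  sem (fEdge e r b b') u v <-> exists z a a', [/\ satisfied s note_units z,
    fact_at s z = AR r a a', occurs s (x, e b) a & occurs s (x', e b') a'].
Proof.
move=> bu bu' x x' xs vx xs' vx'.
have w10 y (i : 'I_nt) : vset v 4 y (10 + i) = v (10 + i) by [].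
have w4 y : vset v 4 y 4 = y by [].
have body z : z < size s ->
    sem (fAnd [:: W _ [:: here true is_entry] 4; fRole _ 4; fColour free 4;
                 W _ (field_is 0 r) 4;
                 fArgs _ false (e b) 4 (10 + b); fArgs _ true (e b') 4 (10 + b')]) u
      (vset v 4 (offset s z)) <->
    satisfied s note_units z /\ exists a a', [/\ fact_at s z = AR r a a',
       occurs s (x, e b) a & occurs s (x', e b') a'].
  move=> zs; rewrite sem_And; cbn [all].
  have Ez := w4 (offset s z).
  rewrite (sem_here us) Ez onth_offset // is_entry_opener (sem_Role us zs Ez).
  rewrite (sem_Colour g0 us _ zs Ez) (sem_Field0 _ zs Ez) andbT.
  have vb : vset v 4 (offset s z) (10 + b) = offset s x by rewrite w10.
  have vb' : vset v 4 (offset s z) (10 + b') = offset s x' by rewrite w10.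
  split=> [/and5P[_ rz /(satisfiedE zs) sz /eqP Er]|[sz [a [a' [Ez' oa oa']]]]].
    move=> /andP[/(sem_Args us _ _ zs Ez xs vb) [a [[_ /= ea] oa]]].
    move=> /(sem_Args us _ _ zs Ez xs' vb') [a' [[_ /= ea'] oa']].
    split=> //; exists a, a'; split=> //.
    by case: (fact_at s z) rz Er ea ea' => [|r0 b0 b1] // _ /= -> [->] [->].
  rewrite Ez' eqxx (satisfiedE zs).2 //=; apply/andP; split.
    by apply/(sem_Args us _ _ zs Ez xs vb); exists a; rewrite /occurs /= Ez'.
  by apply/(sem_Args us _ _ zs Ez xs' vb'); exists a'; rewrite /occurs /= Ez'.
split=> [/sem_Ex[y yu hy]|[z [a [a' [sz Ez oa oa']]]]].
  have /(sem_entry us)[|z zs Ez] : sem (W _ [:: here true is_entry] 4) u (vset v 4 y).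
  - by move: hy; rewrite sem_And; cbn [all] => /andP[].
  - by rewrite w4.
  rewrite w4 in Ez; subst y.
  by move/(body z zs): hy => [sz [a [a' [E1 E2 E3]]]]; exists z, a, a'.
have [zs _] := sz; apply/sem_Ex; exists (offset s z).
  by rewrite (size_u us) offset_size.
by apply/(body z zs); split=> //; exists a, a'.
Qed.

Lemma has_point_place (d : spread T q k) t b :
  place_of q d t = Some (inr (b, true)) -> has_point d b.
Proof.
move=> E; rewrite /has_point -E mem_nth // ltnNge; apply/negP => le.
by move: E; rewrite /place_of nth_default.
Qed.

Lemma sem_Cross d e v (x : 'I_nt -> nat) :
  (forall b, has_point d b -> x b < size s /\ v (10 + b) = offset s (x b)) ->
  sem (fAnd [seq fCross d e u | u <- q]) u v <->
  cross_atoms d (fun r b b' => exists z a a', [/\ satisfied s note_units z,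
    fact_at s z = AR r a a', occurs s (x b, e b) a & occurs s (x b', e b') a']).
Proof.
move=> vx; have edge r b b' : has_point d b -> has_point d b' ->
    sem (fEdge e r b b') u v <-> exists z a a', [/\ satisfied s note_units z,
      fact_at s z = AR r a a', occurs s (x b, e b) a & occurs s (x b', e b') a'].
  move=> /vx[xs E] /vx[xs' E'].
  by apply: sem_Edge => //; rewrite ?E ?E' (size_u us) offset_size.
split=> [/sem_And_map h r t t' b b' f f' rq pt pt' bb|h].
  have := h _ rq; rewrite /fCross pt pt' (negPf bb).
  case: f pt => [|//] pt; case: f' pt' => [|//] pt' /edge H.
  by split=> //; apply: H; [apply: has_point_place pt | apply: has_point_place pt'].
apply/sem_And_map => -[A t|r t t'] uq; first exact: sem_True.
rewrite /fCross; case pt: (place_of q d t) => [[j|[b f]]|]; try exact: sem_True.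
case pt': (place_of q d t') => [[j'|[b' f']]|]; try exact: sem_True.
have [_|bb] := eqVneq b b'; first exact: sem_True.
have [ft ft' H] := h _ _ _ _ _ _ _ uq pt pt' bb; rewrite ft ft'.
rewrite ft in pt; rewrite ft' in pt'.
by apply/edge => //; [apply: has_point_place pt | apply: has_point_place pt'].
Qed.

Lemma sem_NoMatch : sem (fAnd [seq fAnd [seq fNoMatch d e |
      e : {ffun 'I_nt -> bool} <- enum {ffun 'I_nt -> bool}] | d <- spreads]) u (fun=> 0) <->
  no_match s note_units note_hue x0.
Proof.
have semC (f g : F) v : sem (Conj f g) u v = sem f u v && sem g u v by [].
have pieceP (d : spread T q k) (e : 'I_nt -> bool) v (b : 'I_nt) x :
    x < size s -> v (10 + b) = offset s x -> has_point d b ->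
    sem (fPiece d e b) u v <->
    (exists a, occurs s (x, e b) a) /\ holds (FMatch (piece d b)) (note_hue (x, e b)).
  move=> xs vb hb; rewrite /fPiece hb sem_And; cbn [all].
  rewrite (sem_here us) vb onth_offset // is_entry_opener (sem_Has us _ xs vb).
  rewrite (sem_Colour g0 us _ xs vb) andbT andTb.
  split=> [/andP[/(occursE (e b) xs) oa /asboolP h]|[oa h]] //.
  by apply/andP; split; [apply/(occursE (e b) xs) | apply/asboolP].
split=> [/sem_And_map h d o vd [pieces cross]|h].
  have szd : size d == nt by case: vd => ->.
  have din : d \in spreads.
    apply/mapP; exists (Tuple szd) => //.
    by rewrite mem_filter mem_enum andbT; apply/asboolP.
  pose e : {ffun 'I_nt -> bool} := [ffun b => (o b).2].
  move: (h d din) => /sem_And_map /(_ e (mem_enum _ _)).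
  apply/negP; rewrite negbK.
  (* Variable [10 + b] points at the entry of block [b] if the block is hit at its point; all other
     variables stay at 0. *)
  pose w (i : nat) : nat :=
    if insub (i - 10) is Some b then
      if (10 <= i) && has_point d b then offset s (o b).1 else 0 else 0.
  have wb (b : 'I_nt) : has_point d b -> w (10 + b) = offset s (o b).1.
    by move=> hb; rewrite /w addKn valK leq_addr hb.
  have xb b : has_point d b -> (o b).1 < size s /\ w (10 + b) = offset s (o b).1.
    by move=> hb; have := pieces b; rewrite hb => -[[a [lt _]] _]; rewrite wb.
  apply: (sem_Exs_intro (w := w)).
  - exact: iota_uniq.
  - move=> i; rewrite mem_iota /w => ni; case: insubP => // b lt _.
    by case: (leqP 10 i) => // le; case/negP: ni; rewrite le -ltn_subLR.
  - move=> i _; rewrite /w; case: insub => // b; case: ifP => // _.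
    by rewrite (size_u us) offset_size.
  rewrite semC; apply/andP; split.
    apply/sem_And_map => b _; have := pieces b; case: ifP => [hb [oa hm]|hb hm].
      have [xs wo] := xb b hb; apply/(pieceP d e w b (o b).1 xs wo hb).
      by rewrite ffunE; move: oa hm; case: (o b).
    by rewrite /fPiece hb sem_Bool; apply/asboolP.
  apply/(@sem_Cross d e w (fun b => (o b).1) xb).
  move=> r t t' b b' f f' rq pt pt' bb; have [ft ft' [z [a [a' [sz Ez oa oa']]]]] :=
    cross r t t' b b' f f' rq pt pt' bb.
  by split=> //; exists z, a, a'; rewrite !ffunE.
apply/sem_And_map => d /mapP[d']; rewrite mem_filter => /andP[/asboolP vd _] ->.
apply/sem_And_map => e _; apply/negP => /sem_Exs[w [fw _ wu]].
move: fw; rewrite semC => /andP[/sem_And_map pieces /(@sem_Cross _ e w) cross].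
have /choice [x xP] : forall b : 'I_nt, exists x, has_point (val d' : spread T q k) b ->
    x < size s /\ w (10 + b) = offset s x.
  move=> b; case hb: (has_point _ b); last by exists 0.
  have := pieces b (mem_enum _ _); rewrite /fPiece hb sem_And; cbn [all] => /andP[+ _].
  move=> /(sem_entry us)[|y ys Ey]; last by exists y.
  by apply: wu; rewrite mem_iota; have := ltn_ord b; lia.
apply: (h (val d') (fun b => (x b, e b)) vd); split; last exact: cross xP.
move=> b; have := pieces b (mem_enum _ _); case: ifP => [hb|hb].
  by have [xs wb] := xP b hb; move=> /(pieceP _ e w b (x b) xs wb hb).
by rewrite /fPiece hb sem_Bool => /asboolP.
Qed.

(** [rep] need not be injective, so equal hues do not give back the equality of tints that
    [fColourOK] tests; hence the second conjunct. *)
Theorem sem_Core : sem fCore u (fun=> 0) <-> (certified s note_units note_hue x0 c m /\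
  forall x b y b' a, occurs s (x, b) a -> occurs s (y, b') a ->
    tint b (note x) = tint b' (note y)).
Proof.
rewrite sem_And; cbn [all]; rewrite sem_Bool andbT; split.
  case/and4P => /asboolP[h0 hc ck hm] /sem_Good h1 /sem_ColourOK h2.
  case/and5P => /sem_Named h3 /sem_Inj h4 /sem_Concepts h5 /sem_Roles h6.
  case/and5P => /sem_Loops h7 /sem_Disjoint h8 /sem_Weights h9 /sem_Cost h10 h11.
  split=> //; split=> //.
    by move=> [x b] [y b'] a oa oa'; rewrite /note_hue /= (h2 _ _ _ _ _ oa oa').
  by move: hm h11; rewrite /fMatch; case: (m) => [/(_ isT) //|_ /sem_NoMatch].
move=> [[h0 h1 h2 h3 h4 h5 h6 h7 h8 h9 h10 [ck h11] h12] hsame].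
apply/and4P; split; first apply/asboolP.
- by split=> // mt; move: h12; rewrite mt.
- exact/sem_Good.
- exact/sem_ColourOK.
apply/and5P; split.
- exact/sem_Named.
- exact/sem_Inj.
- exact/sem_Concepts.
- exact/sem_Roles.
apply/and5P; split.
- exact/sem_Loops.
- exact/sem_Disjoint.
- exact/sem_Weights.
- exact/sem_Cost.
rewrite /fMatch; case: (m) h12 => [_|]; first exact: sem_True.
by move/sem_NoMatch.
Qed.

End Semantics.
End Core.

Local Opaque fCore fValid.

(** * Certificates and bounded-cost interpretations *)

Section Languages.
Variables (T : wtbox) (q : bcq) (k : nat).

Local Notation colour := (colour T q k).
Local Notation pointed := (pointed T q k).
Local Notation annotation := (annotation T q k).

Lemma unit_dom_nonempty : [set: NI + unit] !=set0.
Proof. by exists (inl 0). Qed.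

Definition unit_interp : interp :=
  {| other := unit; dom_nonempty := unit_dom_nonempty;
     Cint := fun=> set0; Cint_sub := fun A => @sub0set _ _;
     Rint := fun=> set0; Rint_sub := fun r => @sub0set _ _ |}.

(** The default for unrealised colours may be arbitrary, because [fCore] tests the representatives
    themselves for goodness. *)
Definition representative (g : colour) : pointed :=
  if pselect (exists x : pointed, good x /\ colour_of x = g) is left h then projT1 (cid h)
  else @PointedInterp T q k unit_interp (fun=> None) (inl 0).

Lemma representativeP (x : pointed) : good x ->
  good (representative (colour_of x)) /\
  colour_of (representative (colour_of x)) = colour_of x.
Proof.
move=> gx; rewrite /representative; case: pselect => [h|[]]; last by exists x.
by case: cid.
Qed.

(** The colour of the base interpretation and the TBox cost belong to no position of the word, so
    they are guessed by a finite disjunction. *)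
Definition fModel (m : bool) : fo (letter * annotation) :=
  fOr [seq fCore representative (representative gc.1) gc.2 m
      | gc <- [seq (g, c) | g <- enum {: colour}, c <- iota 0 k.+1]].

Lemma scoped_Or_map K S (A B : eqType) (f : A -> fo B) (l : seq A) : 4 < K ->
  (forall x, x \in l -> scoped K S (f x)) -> scoped K S (fOr [seq f x | x <- l]).
Proof. by move=> K5 h; apply: scoped_Or => //; rewrite all_map; apply/allP. Qed.

Lemma scoped_Model m : scoped (fCore_vars q) (iota 10 (size (bcq_terms q)) ++ [:: 4; 5]) (fModel m).
Proof. by apply: scoped_Or_map => // x _; apply: scoped_core. Qed.

Definition annotation0 : annotation :=
  (finset.set0, nseq_tuple _ false, nseq_tuple _ false).

Lemma model_sound m u K :
  tbox K = T -> unzip1 u = enc_wabox (abox K) -> sem (fModel m) u (fun=> 0) ->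
  exists I, [/\ interprets I K q, ele_int (cost K I) k &
    if m then sat_bcq I q else ~ sat_bcq I q].
Proof.
move=> KT us; rewrite /fModel sem_Or has_map => /hasP[[g c] _ sm].
have [cert _] := (sem_Core representative (representative g) c m us annotation0).1 sm.
exact: (certified_sound cert).
Qed.

Lemma certified_units s units units' hue (x0 : pointed) c m :
  (forall i, i < size s -> units i = units' i) ->
  certified s units hue x0 c m -> certified s units' hue x0 c m.
Proof.
move=> E H; have sat i : satisfied s units' i <-> satisfied s units i.
  by split=> -[im]; [rewrite -E | rewrite E].
split.
- exact: cert_base H.
- exact: cert_good H.
- exact: cert_same H.
- exact: cert_named H.
- exact: cert_inj H.
- by move=> i A a /sat; apply: cert_concept H _ _ _.
- by move=> i r a b /sat; apply: cert_role H _ _ _ _.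
- by move=> i r a /sat; apply: cert_loop H _ _ _.
- by move=> i j x im jm; rewrite -!E //; apply: cert_disjoint H _ _ _ im jm.
- by move=> i im; rewrite -E //; apply: cert_weight H _ im.
- exact: cert_tcost H.
- by have [ck h] := cert_cost H; split=> // i x im; rewrite -E //; apply: h.
have := cert_match H; case: (m) => // nm d o vd [ok cross]; apply: (nm d o vd).
split=> // r t t' b b' f f' rq pt pt' bb.
have [ft ft' [z [a [a' [sz Ez oa oa']]]]] := cross r t t' b b' f f' rq pt pt' bb.
by split=> //; exists z, a, a'; split=> //; apply/sat.
Qed.

Lemma model_complete m K I :
  tbox K = T -> interprets I K q -> ele_int (cost K I) k ->
  (if m then sat_bcq I q else ~ sat_bcq I q) ->
  exists2 ts : seq annotation, size ts = size (enc_wabox (abox K)) &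
    sem (fModel m) (zip (enc_wabox (abox K)) ts) (fun=> 0).
Proof.
move=> KT int le hm; have [units [hue [x0 [c cert]]]] := certified_complete KT int le hm.
set s := abox K in cert *; set w := enc_wabox s.
pose kappa i : annotation :=
  (units i, colour_of (hue (i, false)), colour_of (hue (i, true))).
(* This is the entry starting at position [y]; elsewhere [find] returns [size s], and the annotation
   is immaterial. *)
pose at_pos y := find (fun i => offset s i == y) (iota 0 (size s)).
pose ts := mkseq (fun y => kappa (at_pos y)) (size w).
have szts : size ts = size w by rewrite size_mkseq.
exists ts => //; set u := zip w ts.
have us : unzip1 u = enc_wabox s by rewrite unzip1_zip // szts.
have noteE i : i < size s -> note s u annotation0 i = kappa i.
  move=> im; have at_i : at_pos (offset s i) = i.
    have hs : has (fun j => offset s j == offset s i) (iota 0 (size s)).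
      by apply/hasP; exists i; rewrite ?mem_iota.
    have lt := hs; rewrite has_find size_iota in lt.
    have := nth_find 0 hs; rewrite nth_iota // add0n => /eqP.
    exact: offset_inj.
  have lt : offset s i < size w by rewrite -onthTE onth_offset.
  have Eo : onth u (offset s i) = Some (nth (LSep, annotation0) u (offset s i)).
    have := onthTE u (offset s i); rewrite size_zip szts minnn lt -odflt_onth.
    by case: onth.
  by rewrite /note /hue_at Eo /= nth_zip //= nth_mkseq // at_i.
have gr o a : occurs s o a -> good (hue o) by move=> /(cert_good cert)[].
have hueE o a : occurs s o a ->
    note_hue representative s u annotation0 o = representative (colour_of (hue o)).
  by move=> [om _]; rewrite /note_hue noteE // /kappa /tint; case: o om => i [].
have [g0 c0] := representativeP (cert_base cert).
have cert' : certified s (note_units s u annotation0)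
    (note_hue representative s u annotation0) (representative (colour_of x0)) c m.
  apply: (certified_units (units := units)).
    by move=> i im; rewrite /note_units noteE.
  apply: (certified_recolour cert) => //.
    by move=> o a oa; rewrite (hueE o a oa); apply: representativeP (gr o a oa).
  move=> o o' a oa oa'; rewrite (hueE o a oa) (hueE o' a oa').
  by rewrite (cert_same cert oa oa').
rewrite /fModel sem_Or has_map; apply/hasP; exists (colour_of x0, c).
  apply/allpairsP; exists (colour_of x0, c); split=> //; first by rewrite mem_enum.
  by rewrite [_.2]/= mem_iota add0n ltnS; case: (cert_cost cert).
apply: (sem_Core representative (representative (colour_of x0)) c m us annotation0).2.
split=> // x b y b' a oa oa'.
have [/= xs _] := oa; have [/= ys _] := oa'; rewrite !noteE //.
have := cert_same cert oa oa'; rewrite /kappa /tint.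
by case: b {oa}; case: b' {oa'} => ->.
Qed.

End Languages.

(** * Membership in NP and coNP *)

Section Complexity.
Variables (T : wtbox) (q : bcq).
Hypothesis wT : weighting T.

Lemma in_NP_possible (k : nat) : in_NP (possible_language T q k).
Proof.
have sc := scoped_Model T q k true; have scv := @scoped_Valid (annotation T q k) (fCore_vars q) isT.
apply: (in_NP_fo (annotation0 T q k) (K := fCore_vars q)
  (f := Conj (@fValid _) (fModel T q k true))) => //.
  by apply/andP; split; [exact: scoped_wf scv | exact: scoped_wf sc].
move=> w; split=> [[K [KT -> [I [int le sat]]]]|[ts szts /andP[/sem_Valid[s us ws] sm]]].
  have [ts szts sm] := @model_complete T q k true K I KT int le sat.
  exists ts => //; apply/andP; split=> //; apply/sem_Valid; exists (abox K).
    by rewrite unzip1_zip // szts.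
  exact: abox_weighting.
have wE : unzip1 (zip w ts) = w by rewrite unzip1_zip // szts.
exists (WKB wT ws); split=> //=; first by rewrite -us wE.
have [I [int le sat]] := @model_sound T q k true (zip w ts) (WKB wT ws) erefl us sm.
by exists I.
Qed.

(** The complement of the language contains all words that encode no weighted ABox, so validity is a
    premise of the formula here, whereas it is a conjunct for [possible_language]. *)
Lemma in_coNP_certain (k : nat) : in_coNP (certain_language T q k).
Proof.
have sc := scoped_Model T q k false; have scv := @scoped_Valid (annotation T q k) (fCore_vars q) isT.
apply: (in_NP_fo (annotation0 T q k) (K := fCore_vars q)
  (f := Neg (Conj (@fValid _) (Neg (fModel T q k false))))) => //.
  by apply/andP; split; [exact: scoped_wf scv | exact: scoped_wf sc].
have semN f u v : sem (Neg (Conj (@fValid (annotation T q k)) (Neg f))) u v =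
    ~~ sem (@fValid _) u v || sem f u v.
  exact: (etrans (negb_and _ _) (congr1 (orb _) (negbK _))).
move=> w; split=> [nc|[ts szts sm] [K [KT wE cert]]].
  have [[s ws we]|nv] := pselect (exists2 s : wabox, weighting s & w = enc_wabox s); last first.
    exists (nseq (size w) (annotation0 T q k)); first by rewrite size_nseq.
    rewrite semN; apply/orP; left; apply/negP => /sem_Valid[s us ws]; apply: nv.
    by exists s => //; rewrite -us unzip1_zip // size_nseq.
  have [I [int le nsat]] : exists I, [/\ interprets I (WKB wT ws) q,
      ele_int (cost (WKB wT ws) I) k & ~ sat_bcq I q].
    apply: contrapT => no; apply: nc; exists (WKB wT ws); split=> // I int le.
    by apply: contrapT => ns; apply: no; exists I.
  have [ts szts sm] := @model_complete T q k false (WKB wT ws) I erefl int le nsat.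
  by exists ts; rewrite we // semN; apply/orP; right.
have us : unzip1 (zip w ts) = enc_wabox (abox K) by rewrite unzip1_zip // szts.
move: sm; rewrite semN => /orP[/negP nv|sm].
  by apply: nv; apply/sem_Valid; exists (abox K) => //; apply: abox_weighting.
have [I [int le nsat]] := @model_sound T q k false (zip w ts) K KT us sm.
exact: nsat (cert I int le).
Qed.

(** A negative bound admits no interpretation: nothing is possible, and everything is certain, so
    only the validity of the encoding remains to be decided. *)
Lemma no_negative_cost K I n : ~ ele_int (cost K I) (Negz n).
Proof. by case: (cost K I). Qed.

Lemma in_NP_possible_negative n : in_NP (possible_language T q (Negz n)).
Proof.
apply: (in_NP_fo tt (K := 4) (f := Neg (fTrue _))) => // w; split=> [[K [_ _ [I []]]]|[]] //.
by move=> _ /no_negative_cost.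
Qed.

Lemma in_coNP_certain_negative n : in_coNP (certain_language T q (Negz n)).
Proof.
have scv := @scoped_Valid unit 5 isT.
apply: (in_NP_fo tt (K := 5) (f := Neg (@fValid _)) isT (scoped_wf scv)).
move=> w; split=> [nc|[ts szts nv] [K [KT wE _]]].
  exists (nseq (size w) tt); first by rewrite size_nseq.
  apply/negP => /sem_Valid[s us ws]; apply: nc; exists (WKB wT ws); split=> //.
    by rewrite /= -us unzip1_zip // size_nseq.
  by move=> I _ /no_negative_cost.
move/negP: nv; apply; apply/sem_Valid; exists (abox K); last exact: abox_weighting.
by rewrite unzip1_zip // szts.
Qed.

End Complexity.

Theorem theorem9 :
  (forall (T : wtbox) (q : bcq) (k : int),
      weighting T -> in_NP (possible_language T q k)) /\
  (forall (T : wtbox) (q : bcq) (k : int),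
      weighting T -> in_coNP (certain_language T q k)).
Proof.
split=> T q [n|n] wT.
- exact: in_NP_possible.
- exact: in_NP_possible_negative.
- exact: in_coNP_certain.
- exact: in_coNP_certain_negative.
Qed.
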